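(* Let $d\ge 3$ be a fixed integer and let $G$ be the random $d$-regular DAG on $n$ (with source $v$), and write $g_j=g_j(G,v)$. Let $\omega=\omega(n)$ be any function that tends to infinity (arbitrarily slowly) as $n\to\infty$. Then: (i) A.a.s. $g_1=d$. (ii) If $2\le j=O(1)$, then a.a.s. $g_j=d-2+\frac1j$. (iii) If $\omega\le j\le \log_{d-1}n-\omega\log\log n$, then a.a.s. $g_j=d-2$. (iv) If $\log_{d-1}n-\omega\log\log n\le j\le \log_{d-1}n-\frac52 s\log_2\log n+\log_{d-1}\log n-O(1)$ for some $s\in\mathbb{N}^+$, then a.a.s. $d-2-\frac1s\le g_j\le d-2$. (v) Let $s\in\mathbb{N}^+$, $s\ge 4$. There exists a constant $C_s>0$ such that if $j\ge \log_{d-1}n+C_s$, then a.a.s. $g_j\le d-2-\frac1s$.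
   Context: Seepage game: let $G$ be a finite directed acyclic graph (DAG) and $v$ a node (the source). For $i\in\mathbb{N}$ let $L_i=L_i(G,v)=\{u\in V(G):\mathrm{dist}(u,v)=i\}$ (directed distance from $v$). For $j\in\mathbb{N}^+$ with $L_j\neq\emptyset$ and real $r>0$, the game $\mathcal{G}(G,v,j,r)$ is played by two players, the sludge and the greens, in discrete time-steps; at time-step $t$ the greens protect exactly $r_t=\lfloor rt\rfloor-\lfloor r(t-1)\rfloor$ new nodes. The sludge starts at (contaminates) $v_1=v$, and then the greens protect $r_1$ nodes of $G\setminus\{v\}$. At each time $t\ge2$, the sludge first moves along a directed edge from $v_{t-1}$ to a non-protected out-neighbour $v_t$ (contaminating it), and then the greens protect $r_t$ nodes that are neither protected nor contaminated. Protected nodes stay protected forever. The game ends when the sludge cannot move; the sludge wins if it reaches a node of $L_j$ (the sinks), otherwise the greens win. The green number is $g_j(G,v)=\inf\{r\in\mathbb{R}^+:\ \text{the greens win }\mathcal{G}(G,v,j,r)\}$. Random DAG model with parameters $n\in\mathbb{N}^+$ and a sequence $\mathbf{w}=(w_1,w_2,\dots)$ of non-negative integers: $L_0=\{v\}$. Inductively, once layers $L_0,\dots,L_k$ have been created, their nodes are labelled $v_1=v,v_2,\dots$ layer by layer, so that $L_k=\{v_{d_{k-1}+1},\dots,v_{d_k}\}$ with $d_k=\sum_{i=0}^k|L_i|$. Take a new set $S$ of $n$ nodes; each $v_i\in L_k$ independently generates $\max\{w_i-\deg^-(v_i),0\}$ directed edges from $v_i$ to nodes of $S$, each endpoint chosen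 independently and uniformly at random from $S$ (parallel edges possible). The nodes of $S$ chosen at least once form $L_{k+1}$. The random $d$-regular DAG is this model with $w_i=d$ for all $i$. Asymptotics are as $n\to\infty$; an event holds asymptotically almost surely (a.a.s.) if its probability tends to $1$ as $n\to\infty$.
   Formalization: (iii) is stated as g_j = d-2+o(1), since for slowly growing j one has a.a.s. g_j = d-2+1/j > d-2; in (iv) omega must grow slowly, omega log log n = o(log n), since otherwise j = 2 would be allowed, contradicting (ii). *)

(* Defs.v *)
From HB Require Import structures.
From mathcomp Require Import all_boot all_order all_algebra.
From mathcomp Require Import all_classical all_reals all_analysis.

Set Implicit Arguments.
Unset Strict Implicit.
Unset Printing Implicit Defensive.

Import Order.TTheory GRing.Theory Num.Theory.
Import numFieldNormedType.Exports.


Local Open Scope ring_scope.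

(* Parallel edges are irrelevant to the game, so only adjacency is recorded. *)
Record dag (T : finType) := Dag {
  vertices : {set T};
  edge : rel T;
  edge_vertices : forall x y, edge x y -> (x \in vertices) && (y \in vertices);
  edge_acyclic : forall x y, edge x y -> ~~ connect edge y x }.

Definition walk (T : finType) (G : dag T) (i : nat) (x y : T) : bool :=
  [exists p : i.-tuple T, path (edge G) x p && (last x p == y)].

Definition layer (T : finType) (G : dag T) (v : T) (i : nat) : {set T} :=
  [set u in vertices G | walk G i v u & [forall k : 'I_i, ~~ walk G k v u]].

Definition quota (R : realType) (r : R) (t : nat) : nat :=
  absz (Num.floor (r * t%:R) - Num.floor (r * t.-1%:R)).

Definition available (T : finType) (G : dag T) (C P : {set T}) : {set T} :=
  vertices G :\: (C :|: P).

(* The greens have a winning strategy from the position where, at time t, the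
   sludge has just arrived at x, C is the set of contaminated nodes (x
   included), P the set of protected nodes, and the greens are to move.  If
   fewer than quota r t nodes are available, the greens protect all of them.
   When no y is a legal sludge move the premise on y is void: the game stops. *)
Inductive greens_win_from (R : realType) (T : finType) (G : dag T) (v : T)
    (j : nat) (r : R) (t : nat) (C P : {set T}) (x : T) : Prop :=
  GreensWinFrom (Q : {set T}) of
      x \notin layer G v j
    & Q \subset available G C P
    & #|Q| = minn (quota r t) #|available G C P|
    & (forall y, edge G x y -> y \notin P :|: Q ->
         greens_win_from G v j r t.+1 (y |: C) (P :|: Q) y).

Definition greens_win (R : realType) (T : finType) (G : dag T) (v : T)
    (j : nat) (r : R) : Prop :=
  greens_win_from G v j r 1 [set v] finset.set0 v.

Definition green_number (R : realType) (T : finType) (G : dag T) (v : T)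
    (j : nat) : R :=
  inf [set r : R | 0 < r /\ greens_win G v j r]%classic.

(* Potential nodes of the random DAG built in m rounds: None is the source and
   Some (k, u) is the element u of the fresh n-set used in round k, so that it
   can only belong to the layer k.+1. *)
Definition node (m n : nat) : finType := option ('I_m * 'I_n)%type.

(* An outcome gives d endpoints to every potential node.  Under the uniform law
   on outcomes they are independent and uniform on 'I_n.  An actual node x of
   in-degree deg uses only its first d - deg (truncated) endpoints; the others
   are discarded, which does not affect the law of the DAG. *)
Definition outcome (m n d : nat) : finType :=
  {ffun (node m n * 'I_d)%type -> 'I_n}.

Definition indegree (m n d : nat) (f : outcome m n d)
    (A : {set node m n * 'I_d}) (u : 'I_n) : nat :=
  #|[set s in A | f s == u]|.

(* The edges, with multiplicity, generated by the nodes of the layer k: (x, e)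
   stands for the edge from x to f (x, e). *)
Fixpoint generated (m n d : nat) (f : outcome m n d) (k : nat) :
    {set node m n * 'I_d} :=
  if k is k'.+1 then
    [set s : node m n * 'I_d | if s.1 is Some (i, u) then
               [&& i == k' :> nat, (0 < indegree f (generated f k') u)%N
                 & (s.2 < d - indegree f (generated f k') u)%N]
             else false]
  else [set s : node m n * 'I_d | s.1 == None].

Definition rdag_vertices (m n d : nat) (f : outcome m n d) : {set node m n} :=
  [set y : node m n | if y is Some (i, u) then (0 < indegree f (generated f i) u)%N
           else true].

Definition rdag_edge (m n d : nat) (f : outcome m n d) : rel (node m n) :=
  fun x y => if y is Some (i, u) then
    [exists e : 'I_d, ((x, e) \in generated f i) && (f (x, e) == u)] else false.

Definition level (m n : nat) (x : node m n) : nat :=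
  if x is Some (i, _) then i.+1 else 0.

Lemma generated_level (m n d : nat) (f : outcome m n d) k s :
  s \in generated f k -> s.1 \in rdag_vertices f /\ level s.1 = k.
Proof.
case: k => [|k]; case: s => [[[i u]|] e]; rewrite !inE //=.
by case/and3P => /eqP -> ? _.
Qed.

Lemma rdag_edge_level (m n d : nat) (f : outcome m n d) x y :
  rdag_edge f x y -> level y = (level x).+1.
Proof.
case: y => [[i u]|] //= /existsP[e /andP[/generated_level[_ /= ->] _]] //.
Qed.

Lemma rdag_edge_vertices (m n d : nat) (f : outcome m n d) x y :
  rdag_edge f x y -> (x \in rdag_vertices f) && (y \in rdag_vertices f).
Proof.
case: y => [[i u]|] //= /existsP[e /andP[xe fe]].
have [-> _] := generated_level xe; rewrite inE /= /indegree.
by apply/card_gt0P; exists (x, e); rewrite inE xe.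
Qed.

Lemma rdag_edge_acyclic (m n d : nat) (f : outcome m n d) x y :
  rdag_edge f x y -> ~~ connect (rdag_edge f) y x.
Proof.
move=> xy; apply/negP => /connectP[p].
have: (level x < level y)%N by rewrite (rdag_edge_level xy).
elim: p y {xy} => [|z p IHp] y /= lt_xy; first by move=> _ xy; rewrite xy ltnn in lt_xy.
case/andP=> /rdag_edge_level yz; apply: IHp.
by rewrite yz; apply: leqW.
Qed.

(* The first m layers after the source of the random d-regular DAG on n; the
   source is None. *)
Definition rdag (m n d : nat) (f : outcome m n d) : dag (node m n) :=
  Dag (@rdag_edge_vertices m n d f) (@rdag_edge_acyclic m n d f).

Definition rdag_green_number (R : realType) (m n d : nat) (f : outcome m n d)
    (j : nat) : R :=
  green_number R (rdag f) None j.

Definition uniform_pr (R : realType) (Omega : finType) (E : Omega -> Prop) : R :=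
  #|[set f : Omega | `[< E f >]]|%:R / #|Omega|%:R.

(* "A.a.s. E (g_j)" as n tends to infinity, where j depends on n.  The game on
   L_j is insensitive to how many layers beyond L_j are generated; every number
   m n >= j n of rounds is covered. *)
Definition aas_green (R : realType) (d : nat) (j : nat -> nat)
    (E : nat -> R -> Prop) : Prop :=
  forall m : nat -> nat, (forall n, (j n <= m n)%N) ->
    (uniform_pr R (fun f : outcome (m n) n d => E n (rdag_green_number R f (j n)))
      @[n --> \oo] --> (1 : R))%classic.

Definition logb (R : realType) (b x : R) : R := ln x / ln b.

(* Main.v *)
Require Import Defs.
From mathcomp Require Import all_boot all_order all_algebra.
From mathcomp Require Import all_classical all_reals all_analysis.
From mathcomp Require Import ring lra zify.

(* Every edge of the random DAG joins consecutive levels, so the game is played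
   level by level.

   Greens.  A losing position with quota d - 2 has in-degree 1 and d - 1 losing
   children.  With quota d - 2 throughout, a loss thus yields a
   full (d - 1)-ary tree whose last slots, more than sqrt n of them, have distinct
   endpoints, which is unlikely.  For (v) it suffices to take s = 4.  Then every
   fourth quota is d - 3, where the sludge picks one losing child and in-degree 2
   may occur, so the number N of losing positions is multiplied by at least
   (d - 1)^3 / 2 >= 4 in each block.  There are few choices in terms of N, and each
   requires (d - 1)^2 N slots of the last level to hit nothing else, which has
   probability at most exp(- 0.29 (d - 1)^2 N) once that level has 0.3 n slots.  A level
   log_(d-1) n + O(1) has that many slots a.a.s., by a second moment bound.

   Sludge.  A node is good if its in-degree is 1, and a slot is dead if it leads
   to a node that is not good.  Below a good node the good nodes form a tree, and
   each protected node spoils at most one subtree.  If r < d - 2 - 1/s, then once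
   in s steps the sludge can choose between two clean subtrees, and it halves the
   number of dead slots ahead.  Over blocks of h = s b levels this removes 2^b
   dead slots, while a.a.s. each node has only O(log n) of them below it at each
   level of the next block. *)

Set Implicit Arguments.
Unset Strict Implicit.
Unset Printing Implicit Defensive.

Import Order.TTheory GRing.Theory Num.Theory.
Import numFieldNormedType.Exports.

Local Open Scope ring_scope.

(** * Uniform probability *)

(** The edges into level k are functions of the endpoints below level k, so once these are frozen
    the slots of level k are independent and uniform. Each probabilistic event is therefore phrased
    through the slots of one level and bounded by resampling that level alone. The obstacle in (v)
    is that the set of losing positions depends on all later levels: the union bound runs over
    candidate sets read off the lower levels, and instead of counting them it sums the weights w^N,
    which stay bounded from block to block. Of the exponent 0.29 (d - 1)^2 N, the share 0.28 pays
    for this sum and 0.01 is left over. In (iv), removing the dead slots of a block needs 2^b to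
    exceed h log n up to a constant, so b must be a little more than log_2 log n, and 5/4 log_2 log
    n is taken. The dead slots in question lie less than 2 h = 2 s b levels below a node, and there
    are O(log n) of them on a level when (d - 1)^(j + 2 h) = O(n log n); this is the origin of 5/2 s
    log_2 log n and of the term log_(d-1) log n in the hypothesis on j. *)

Definition mean (R : realType) (Omega : finType) (phi : Omega -> R) : R :=
  (\sum_f phi f) / #|Omega|%:R.

Lemma uniform_prE (R : realType) (Omega : finType) (E : Omega -> Prop) :
  uniform_pr R E = mean (fun f => `[< E f >]%:R).
Proof.
rewrite /uniform_pr /mean -sum1_card natr_sum; congr (_ / _).
rewrite big_mkcond /=; apply: eq_bigr => f _.
by rewrite inE; case: `[< E f >].
Qed.

Lemma mean_le (R : realType) (Omega : finType) (phi psi : Omega -> R) :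
  (forall f, phi f <= psi f) -> mean phi <= mean psi.
Proof.
move=> le_f; rewrite /mean ler_wpM2r ?invr_ge0 ?ler0n //.
exact: ler_sum.
Qed.

Lemma eq_mean (R : realType) (Omega : finType) (phi psi : Omega -> R) :
  phi =1 psi -> mean phi = mean psi.
Proof. by move=> eq_f; rewrite /mean (eq_bigr psi). Qed.

Lemma meanZ (R : realType) (Omega : finType) (c : R) (phi : Omega -> R) :
  mean (fun f => c * phi f) = c * mean phi.
Proof. by rewrite /mean -mulr_sumr mulrA. Qed.

Lemma meanD (R : realType) (Omega : finType) (phi psi : Omega -> R) :
  mean (fun f => phi f + psi f) = mean phi + mean psi.
Proof. by rewrite /mean big_split mulrDl. Qed.

Lemma mean_sum (R : realType) (Omega I : finType) (phi : I -> Omega -> R) :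
  mean (fun f => \sum_i phi i f) = \sum_i mean (phi i).
Proof. by rewrite /mean exchange_big mulr_suml. Qed.

Lemma mean_cst (R : realType) (Omega : finType) (c : R) :
  (0 < #|Omega|)%N -> mean (fun _ : Omega => c) = c.
Proof.
by move=> O_gt0; rewrite /mean sumr_const -[c *+ _]mulr_natr mulfK // pnatr_eq0 -lt0n.
Qed.

Lemma upr_ge0 (R : realType) (Omega : finType) (E : Omega -> Prop) :
  0 <= uniform_pr R E.
Proof. by rewrite divr_ge0 ?ler0n. Qed.

Lemma upr_le (R : realType) (Omega : finType) (E E' : Omega -> Prop) :
  (forall f, E f -> E' f) -> uniform_pr R E <= uniform_pr R E'.
Proof.
move=> EE'; rewrite !uniform_prE; apply: mean_le => f.
by case: asboolP => [/EE' Ef|_]; [rewrite asboolT|rewrite ler0n].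
Qed.

Lemma upr0 (R : realType) (Omega : finType) (E : Omega -> Prop) :
  (forall f, ~ E f) -> uniform_pr R E = 0.
Proof.
move=> nE; rewrite /uniform_pr (_ : [set f | _] = finset.set0) ?cards0 ?mul0r //.
by apply/setP => f; rewrite !inE; apply/asboolP/nE.
Qed.

Lemma upr_or (R : realType) (Omega : finType) (E E' : Omega -> Prop) :
  uniform_pr R (fun f => E f \/ E' f) <= uniform_pr R E + uniform_pr R E'.
Proof.
rewrite !uniform_prE -meanD; apply: mean_le => f.
case: (asboolP (E f)) => [Ef|nEf]; case: (asboolP (E' f)) => [E'f|nE'f];
  case: asboolP => [[]|] //= _; rewrite -?natrD ?ler_nat //.
Qed.

Lemma upr_seq (R : realType) (Omega : finType) (I : eqType) (s : seq I)
    (E : I -> Omega -> Prop) :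
  uniform_pr R (fun f => exists2 i, i \in s & E i f) <=
  \sum_(i <- s) uniform_pr R (E i).
Proof.
elim: s => [|i s IHs]; first by rewrite big_nil upr0 // => f [].
rewrite big_cons; apply: le_trans (lerD (lexx _) IHs).
apply: le_trans (upr_or _ _ _); apply: upr_le => f [k].
by rewrite inE => /orP[/eqP ->|ks] Ek; [left|right; exists k].
Qed.

Lemma upr_ex (R : realType) (Omega I : finType) (E : I -> Omega -> Prop) :
  uniform_pr R (fun f => exists i, E i f) <= \sum_i uniform_pr R (E i).
Proof.
rewrite -big_enum; apply: le_trans (upr_seq _ _ _).
by apply: upr_le => f [i Ei]; exists i; rewrite ?mem_enum.
Qed.

Lemma upr_compl (R : realType) (Omega : finType) (E : Omega -> Prop) :
  (0 < #|Omega|)%N -> uniform_pr R E = 1 - uniform_pr R (fun f => ~ E f).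
Proof.
move=> O0; apply/eqP; rewrite eq_sym subr_eq !uniform_prE -meanD.
rewrite (_ : (fun f => _) = fun=> 1) ?mean_cst //.
by apply/funext => f; rewrite asbool_neg; case: asboolP => _; rewrite ?addr0 ?add0r.
Qed.

Lemma markov_upr (R : realType) (Omega : finType) (phi : Omega -> R) (t : R) :
  0 < t -> (forall f, 0 <= phi f) ->
  uniform_pr R (fun f => t <= phi f) <= mean phi / t.
Proof.
move=> t0 phi0; rewrite mulrC -meanZ uniform_prE; apply: mean_le => f.
case: asboolP => [le_t|_]; last by rewrite mulr_ge0 // invr_ge0 ltW.
by rewrite mulrC ler_pdivlMr // mul1r.
Qed.

(** * Independence of the coordinates: partial resampling, hitting and collision estimates *)

Definition mix (X V : finType) (p : pred X) (f g : {ffun X -> V}) :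
  {ffun X -> V} := [ffun s => if p s then g s else f s].

(* Swapping the coordinates in p is a measure-preserving involution of pairs. *)
Lemma mean_mix (R : realType) (X V : finType) (p : pred X)
    (phi : {ffun X -> V} -> R) : (0 < #|{ffun X -> V}|)%N ->
  mean phi = mean (fun f => mean (fun g => phi (mix p f g))).
Proof.
move=> O0.
have -> : mean phi = mean (fun f => mean (fun _ : {ffun X -> V} => phi f)).
  by apply: eq_mean => f; rewrite mean_cst.
rewrite /mean -!mulr_suml !pair_bigA /=; congr (_ / _ / _).
pose h (u : {ffun X -> V} * {ffun X -> V}) := (mix p u.1 u.2, mix p u.2 u.1).
have hK : involutive h.
  by case=> f g; rewrite /h; congr pair; apply/ffunP => s; rewrite !ffunE; case: (p s).
by rewrite (reindex_inj (inv_inj hK)).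
Qed.

Lemma upr_mix (R : realType) (X V : finType) (p : pred X)
    (E : {ffun X -> V} -> Prop) (eps : R) : (0 < #|{ffun X -> V}|)%N ->
  (forall f, uniform_pr R (fun g => E (mix p f g)) <= eps) ->
  uniform_pr R E <= eps.
Proof.
move=> O0 le_eps; rewrite uniform_prE (mean_mix p) // -(mean_cst eps O0).
by apply: mean_le => f; rewrite -uniform_prE.
Qed.

Lemma mean_prod (R : realType) (X V : finType) (h : X -> V -> R) :
  mean (fun g : {ffun X -> V} => \prod_x h x (g x)) = \prod_x mean (h x).
Proof.
rewrite /mean -(bigA_distr_bigA h) card_ffun big_split /= prodr_const.
by rewrite natrX exprVn.
Qed.

Lemma mean_coord (R : realType) (X V : finType) (b : X) (F : V -> R) :
  (0 < #|V|)%N -> mean (fun g : {ffun X -> V} => F (g b)) = mean F.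
Proof.
move=> V0; pose h x v := if x == b then F v else 1.
transitivity (mean (fun g : {ffun X -> V} => \prod_x h x (g x))).
  apply: eq_mean => g; rewrite (bigD1 b) //= /h eqxx big1 ?mulr1 // => x /negPf.
  by move=> ->.
rewrite mean_prod (bigD1 b) //= /h eqxx big1 ?mulr1 // => x /negPf ->.
exact: mean_cst.
Qed.

Lemma mean_in (R : realType) (V : finType) (U : {set V}) :
  mean (fun v => (v \in U)%:R) = #|U|%:R / #|V|%:R :> R.
Proof.
rewrite /mean -sum1_card natr_sum big_mkcond [in RHS]big_mkcond /=.
by congr (_ / _); apply: eq_bigr => v _; case: (v \in U).
Qed.

Lemma mean_avoid (R : realType) (X V : finType) (A : {set X}) (U : {set V}) :
  (0 < #|V|)%N ->
  mean (fun g : {ffun X -> V} => [forall a in A, g a \notin U]%:R) =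
  (1 - #|U|%:R / #|V|%:R) ^+ #|A| :> R.
Proof.
move=> V0; pose h x v : R := if x \in A then (v \notin U)%:R else 1.
transitivity (mean (fun g : {ffun X -> V} => \prod_x h x (g x))).
  apply: eq_mean => g; case: (boolP [forall a in A, _]) => [/forall_inP gU|].
    by rewrite big1 // => x _; rewrite /h; case: ifP => // /gU ->.
  rewrite negb_forall => /existsP[a]; rewrite negb_imply negbK => /andP[aA gaU].
  by rewrite (bigD1 a) //= /h aA gaU mul0r.
rewrite mean_prod -prodr_const [in RHS]big_mkcond /=; apply: eq_bigr => x _.
rewrite /h; case: ifP => _; last exact: mean_cst.
have -> : mean (fun v => (v \notin U)%:R) = mean (fun v => 1 + -1 * (v \in U)%:R) :> R.
  by apply: eq_mean => v; case: (v \in U); rewrite ?mulr0 ?mulr1 ?addr0 ?subrr.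
by rewrite meanD mean_cst // meanZ mean_in mulN1r.
Qed.

Lemma exp_le_expR (R : realType) (y : R) (k : nat) :
  0 <= 1 - y -> (1 - y) ^+ k <= expR (- (k%:R * y)).
Proof.
move=> y1; rewrite -mulrN mulrC expRM_natr lerXn2r ?nnegrE ?expR_ge0 //.
exact: expR_ge1Dx.
Qed.

Lemma card_ffun_gt0 (X V : finType) : (0 < #|V|)%N -> (0 < #|{ffun X -> V}|)%N.
Proof. by move=> V0; rewrite card_ffun expn_gt0 V0. Qed.

Lemma upr_isolated (R : realType) (X V : finType) (A B : {set X}) :
  (0 < #|V|)%N -> [disjoint A & B] ->
  uniform_pr R (fun g : {ffun X -> V} => {in B &, injective g} /\
    forall a b, a \in A -> b \in B -> g a != g b) <=
  expR (- (#|A|%:R * (#|B|%:R / #|V|%:R))).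
Proof.
move=> V0 dAB; apply: (@upr_mix _ _ _ (fun x => x \in A)); first exact: card_ffun_gt0.
move=> f; have mixB g b : b \in B -> mix (fun x => x \in A) f g b = f b.
  by move=> bB; rewrite ffunE (disjointFl dAB bB).
have [injf|ninj] := pselect {in B &, injective f}; last first.
  rewrite upr0 ?expR_ge0 // => g [inj _]; apply: ninj => b c bB cB fbc.
  by apply: inj => //; rewrite !mixB.
have cU : #|f @: B| = #|B| by rewrite card_in_imset.
apply: (@le_trans _ _ ((1 - #|f @: B|%:R / #|V|%:R) ^+ #|A|)); last first.
  rewrite cU; apply: exp_le_expR; rewrite subr_ge0 ler_pdivrMr ?ltr0n // mul1r ler_nat.
  by rewrite -cU max_card.
rewrite -(@mean_avoid _ X) // uniform_prE; apply: mean_le => g.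
case: asboolP => [[_ H]|_]; last by rewrite ler0n.
rewrite (_ : [forall a in A, _] = true) //; apply/forall_inP => a aA.
apply/imsetP => -[b bB gab]; have := H a b aA bB.
by rewrite (mixB g b bB) -gab /mix ffunE aA eqxx.
Qed.

(** A birthday bound obtained by splitting: k slots of [B] have to avoid the values of the others,
    of which there are at least k. *)
Lemma upr_injective (R : realType) (X V : finType) (B : {set X}) (k : nat) :
  (0 < #|V|)%N -> (k.*2 <= #|B|)%N ->
  uniform_pr R (fun g : {ffun X -> V} => {in B &, injective g}) <=
  expR (- (k%:R ^+ 2 / #|V|%:R)).
Proof.
move=> V0 kB.
have [B1 [B1B cB1]] : exists B1 : {set X}, B1 \subset B /\ #|B1| = k.
  have kB' : (k <= #|B|)%N by lia.
  exists [set x in take k (enum B)]; split.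
    by apply/fintype.subsetP => x; rewrite inE => /mem_take; rewrite mem_enum.
  rewrite cardsE; move/card_uniqP: (take_uniq k (enum_uniq (mem B))) => ->.
  by rewrite size_take -cardE; case: ltngtP kB'.
have dis : [disjoint B1 & B :\: B1] by rewrite -setI_eq0 finset.setIDA finset.setIC -finset.setIDA finset.setDv finset.setI0.
apply: (@le_trans _ _ (expR (- (#|B1|%:R * (#|B :\: B1|%:R / #|V|%:R))))).
  apply: le_trans (upr_isolated R V0 dis); apply: upr_le => g inj; split.
    by move=> b c /setDP[bB _] /setDP[cB _]; exact: inj.
  move=> a b aB1 /setDP[bB bB1]; apply: contraNneq bB1 => /inj <- //.
  exact: (fintype.subsetP B1B).
rewrite ler_expR lerN2 cB1 expr2 -mulrA ler_wpM2l // ler_wpM2r ?invr_ge0 //.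
by rewrite ler_nat cardsD (finset.setIidPr B1B) cB1; lia.
Qed.

Lemma upr_collision (R : realType) (X V : finType) (A : {set X}) : (0 < #|V|)%N ->
  uniform_pr R (fun g : {ffun X -> V} => ~ {in A &, injective g}) <=
  #|A|%:R ^+ 2 / #|V|%:R.
Proof.
move=> V0; pose E (u : X * X) (g : {ffun X -> V}) := g u.1 = g u.2.
pose I := [seq u <- enum (finset.setX A A) | u.1 != u.2].
apply: (@le_trans _ _ (\sum_(u <- I) uniform_pr R (E u))).
  apply: le_trans (upr_seq _ _ _); apply: upr_le => g; apply: contra_notP => nE.
  move=> a b aA bA gab; apply/eqP/negPn/negP => ab; apply: nE.
  by exists (a, b); rewrite // mem_filter ab mem_enum inE aA.
have le1 u : u \in I -> uniform_pr R (E u) <= #|V|%:R^-1.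
  case: u => a b; rewrite mem_filter /= => /andP[ab _].
  apply: (@upr_mix _ _ _ (pred1 a)); first exact: card_ffun_gt0.
  move=> f; rewrite uniform_prE.
  rewrite (_ : #|V|%:R^-1 = #|[set f b]|%:R / #|V|%:R); last by rewrite cards1 mul1r.
  rewrite -(mean_in R) -(@mean_coord R X V a (fun v => (v \in [set f b])%:R) V0).
  apply: mean_le => g; rewrite /E !ffunE /= eqxx eq_sym (negPf ab) inE.
  by case: asboolP => [->|]; rewrite ?eqxx // ler0n.
rewrite big_seq; apply: (@le_trans _ _ (\sum_(u <- I | u \in I) #|V|%:R^-1)).
  by apply: ler_sum => u; exact: le1.
rewrite -big_seq big_const_seq iter_addr addr0 -[_ *+ count _ _]mulr_natl ler_wpM2r ?invr_ge0 //.
rewrite -natrX ler_nat count_predT size_filter (leq_trans (count_size _ _)) //.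
by rewrite -cardE cardsX mulnn.
Qed.

Lemma expr_bernoulli (R : realFieldType) (x : R) k : 0 <= x <= 1 ->
  1 - k%:R * x <= (1 - x) ^+ k.
Proof.
move=> /andP[x0 x1]; elim: k => [|k IHk]; first by rewrite expr0 mul0r subr0.
rewrite exprS; apply: (@le_trans _ _ ((1 - x) * (1 - k%:R * x))); last first.
  by rewrite ler_wpM2l // subr_ge0.
rewrite -natr1; have : 0 <= k%:R * x * x by rewrite !mulr_ge0.
by move: (k%:R : R) => K; lra.
Qed.

(* Second moment: if Z is the number of values missed by A, then
   E Z^2 <= n p + n (n - 1) p^2 with p = (1 - 1/n)^|A|, so that
   Var Z <= n p (1 - p) <= |A|. *)
Lemma upr_image_small (R : realType) (X V : finType) (A : {set X}) (lam : R) :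
  (1 < #|V|)%N -> 0 < lam ->
  uniform_pr R (fun g : {ffun X -> V} =>
     #|g @: A|%:R <= #|V|%:R * (1 - (1 - #|V|%:R^-1) ^+ #|A|) - lam) <=
  #|A|%:R / lam ^+ 2.
Proof.
move=> V1 lam0; have V0 : (0 < #|V|)%N by apply: leq_trans V1.
have O_gt0 := card_ffun_gt0 X V0.
set n : R := #|V|%:R; have n0 : 0 < n by rewrite ltr0n.
have n1 : 2 <= n by rewrite ler_nat.
set p := (1 - n^-1) ^+ #|A|.
have inv1 : n^-1 <= 1 by rewrite invf_le1 // ltW //; lra.
have inv0 : 0 < n^-1 by rewrite invr_gt0.
have p0 : 0 <= p by rewrite exprn_ge0 // subr_ge0.
pose miss (g : {ffun X -> V}) u : R := [forall a in A, g a \notin [set u]]%:R.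
pose Z g := \sum_u miss g u.
have missE g u : miss g u = (u \notin g @: A)%:R.
  congr (nat_of_bool _)%:R; apply/forall_inP/negP => [H /imsetP[a aA ua]|H a aA].
    by have := H a aA; rewrite inE ua eqxx.
  by rewrite inE; apply/eqP => gau; apply: H; apply/imsetP; exists a.
have ZE g : Z g = n - #|g @: A|%:R.
  rewrite /Z (eq_bigr (fun u => 1 - (u \in g @: A)%:R)); last first.
    by move=> u _; rewrite missE; case: (u \in _); rewrite ?subrr ?subr0.
  rewrite sumrB sumr_const; congr (_ - _); rewrite -sum1_card natr_sum [RHS]big_mkcond /=.
  by apply: eq_bigr => u _; case: ifP.
have meanZ1 : mean Z = n * p.
  rewrite (@mean_sum R _ _ (fun u g => miss g u)) (eq_bigr (fun=> p)) => [|u _].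
    by rewrite sumr_const -[LHS]mulr_natl.
  by rewrite mean_avoid // cards1 mul1r.
have mean2 u v : u != v -> mean (fun g => miss g u * miss g v) <= p ^+ 2.
  move=> uv; rewrite (_ : (fun g => _) =
     (fun g : {ffun X -> V} => [forall a in A, g a \notin [set u; v]]%:R)).
    rewrite mean_avoid // cards2 uv -exprM mulnC exprM lerXn2r ?nnegrE //.
    - by rewrite subr_ge0 ler_pdivrMr // mul1r.
    - by rewrite exprn_ge0 // subr_ge0.
    - rewrite -[(true.+1)%:R]/(2 : R) -/n; have := sqr_ge0 (n^-1); rewrite !expr2.
      by move: (n^-1) => t; lra.
  apply/funext => g; rewrite /miss -natrM mulnb; congr (nat_of_bool _)%:R.
  apply/andP/forall_inP => [[/forall_inP H /forall_inP K] a aA|H].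
    by have := H a aA; have := K a aA; rewrite !inE negb_or => -> ->.
  by split; apply/forall_inP => a /H; rewrite !inE negb_or => /andP[].
have mean1 u : mean (fun g => miss g u * miss g u) = p.
  rewrite (_ : (fun g => _) = (fun g => miss g u)); last first.
    by apply/funext => g; rewrite /miss; case: [forall _ in _, _]; rewrite ?mulr1 ?mulr0.
  by rewrite mean_avoid // cards1 mul1r.
have meanZ2 : mean (fun g => Z g ^+ 2) <= n * p + n * (n - 1) * p ^+ 2.
  rewrite (_ : (fun g => _) = (fun g => \sum_u \sum_v miss g u * miss g v)); last first.
    by apply/funext => g; rewrite expr2 /Z mulr_suml; apply: eq_bigr => u _; rewrite mulr_sumr.
  rewrite (mean_sum (fun u g => \sum_v miss g u * miss g v)).
  apply: (@le_trans _ _ (\sum_(u : V) (p + (n - 1) * p ^+ 2))); last first.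
    by rewrite sumr_const -[X in X <= _]mulr_natl -/n; lra.
  apply: ler_sum => u _; rewrite (mean_sum (fun v g => miss g u * miss g v)).
  rewrite (bigD1 u) //= mean1 lerD2l.
  apply: (@le_trans _ _ (\sum_(v | v != u) p ^+ 2)).
    by apply: ler_sum => v vu; apply: mean2; rewrite eq_sym.
  rewrite sumr_const -[X in X <= _]mulr_natl ler_wpM2r ?(exprn_ge0 _ p0) //.
  rewrite (_ : #|_| = (#|V| - 1)%N); first by rewrite natrB.
  by rewrite subn1 -(cardC1 u); apply: eq_card => v; rewrite !inE.
apply: (@le_trans _ _ (uniform_pr R (fun g : {ffun X -> V} => lam ^+ 2 <= (Z g - n * p) ^+ 2))).
  apply: upr_le => g; rewrite -/n -/p => le_g; have {}le_g : lam <= Z g - n * p.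
    by rewrite ZE; lra.
  by rewrite lerXn2r ?nnegrE ?(ltW lam0) // (le_trans (ltW lam0)).
apply: le_trans (markov_upr (exprn_gt0 2 lam0) (fun g => sqr_ge0 _)) _.
rewrite ler_wpM2r ?invr_ge0 ?(ltW (exprn_gt0 2 lam0)) //.
rewrite (_ : (fun g => _) = (fun g => Z g ^+ 2 + (- (2 * n * p) * Z g + (n * p) ^+ 2))); last first.
  by apply/funext => g; ring.
rewrite !meanD mean_cst // meanZ meanZ1.
have p1 : 1 - #|A|%:R * n^-1 <= p by apply: expr_bernoulli; rewrite inv1 ltW.
have pl1 : p <= 1 by apply: exprn_ile1; lra.
have : n * p * (1 - p) <= #|A|%:R.
  apply: (@le_trans _ _ (n * 1 * (#|A|%:R * n^-1))); last first.
    by rewrite mulr1 mulrCA mulfV ?mulr1 // gt_eqF.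
  apply: ler_pM; [exact: mulr_ge0 (ltW n0) p0| lra | |lra].
  by rewrite ler_wpM2l // ltW.
move: meanZ2; lra.
Qed.

(* Revealing A first and then l one slot at a time, each new slot hits an
   earlier value with probability at most (#|A| + size l) / #|V|, and a hit makes
   at most two more slots of l collide. *)
Lemma mean_hits (R : realType) (X V : finType) (A : {set X}) (l : seq X) :
  (0 < #|V|)%N -> uniq l -> {in l, forall b, b \notin A} ->
  exists hits : {ffun X -> V} -> nat,
    [/\ forall g g' : {ffun X -> V},
          (forall a, (a \in A) || (a \in l) -> g a = g' a) -> hits g = hits g',
        forall g : {ffun X -> V},
          (#|[set b in l | [exists a, [&& (a \in A) || (a \in l), a != b
              & g a == g b]]]| <= (hits g).*2)%N
      & mean (fun g => 2 ^+ hits g) <=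
          (1 + (#|A| + size l)%:R / #|V|%:R) ^+ size l :> R].
Proof.
move=> V0; have O_gt0 := card_ffun_gt0 X V0.
elim/last_ind: l => [|l b IHl] uql dis.
  exists (fun=> 0%N); split => [//|g|]; last by rewrite mean_cst // expr0.
  by rewrite leqn0 cards_eq0; apply/eqP/setP => b; rewrite !inE.
have [bl ul] : b \notin l /\ uniq l by move: uql; rewrite rcons_uniq => /andP.
have bA : b \notin A by apply: dis; rewrite mem_rcons inE eqxx.
have [|hits [Hdep Hd Hm]] := IHl ul.
  by move=> c cl; apply: dis; rewrite mem_rcons inE cl orbT.
pose T := [set a | (a \in A) || (a \in l)].
pose S (g : {ffun X -> V}) := g @: T.
have cT : (#|T| <= #|A| + size l)%N.
  rewrite (_ : T = A :|: [set a in l]); last by apply/setP => a; rewrite !inE.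
  by rewrite (leq_trans (leq_card_setU _ _)) // leq_add2l cardsE card_size.
exists (fun g => (hits g + (g b \in S g))%N); split => [g g' eq_g|g|].
- have eqT a : a \in T -> g a = g' a.
    by rewrite inE => aT; apply: eq_g; rewrite mem_rcons inE orbCA aT orbT.
  rewrite (Hdep g g') => [|a aT]; last by apply: eqT; rewrite inE.
  congr (_ + (nat_of_bool _))%N; rewrite (eq_g b) ?mem_rcons ?inE ?eqxx ?orbT //.
  by rewrite /S (eq_in_imset eqT).
- set D' := [set _ in _ | _]; pose D0 := [set b in l | [exists a, [&& (a \in A) || (a \in l), a != b & g a == g b]]].
  have {}Hd : (#|D0| <= (hits g).*2)%N by exact: Hd.
  have D'P c : c \in D' -> [\/ c \in D0, c = b | (c \in l) /\ g b = g c].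
    rewrite !inE mem_rcons inE => /andP[/predU1P[->|cl]]; first by constructor 2.
    case/existsP => a /and3P[]; rewrite mem_rcons inE => aT ac /eqP gac.
    have [ab|ab] := eqVneq a b; first by constructor 3; rewrite -ab.
    constructor 1; rewrite cl; apply/existsP; exists a.
    by rewrite ac gac eqxx; move: aT; rewrite (negPf ab) /= => ->.
  have [hit|nhit] := boolP (g b \in S g); last first.
    rewrite addn0; apply: leq_trans Hd; apply/subset_leq_card/fintype.subsetP => c cD'.
    case: (D'P c cD') => // [cb|[cl gbc]]; last first.
      by case/imsetP: nhit; exists c; rewrite // inE cl orbT.
    move: cD'; rewrite inE cb => /andP[_ /existsP[a /and3P[aT ab /eqP gab]]].
    case/imsetP: nhit; exists a => //; rewrite inE.
    by move: aT; rewrite mem_rcons inE (negPf ab).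
  (* Two slots of [l] that share the value of [b] already collide with each other, hence lie in
     [D0]. A hit thus adds at most one slot besides [b]. *)
  pose N := [set c in l | (c \notin D0) && (g b == g c)].
  have N1 : (#|N| <= 1)%N.
    apply/card_le1_eqP => c c'; rewrite !(inE, negb_and) => /and3P[cl cD /eqP gc] /and3P[cl' _ /eqP gc'].
    apply/eqP/negPn/negP => cc'; move: cD; rewrite cl /= => /existsP; apply.
    by exists c'; rewrite cl' orbT cc' -gc -gc' eqxx.
  have sub : D' \subset D0 :|: (b |: N).
    apply/fintype.subsetP => c /[dup] cD' /D'P[cD|->|[cl gbc]].
    - by rewrite inE cD.
    - by rewrite !inE eqxx orbT.
    - by rewrite !(inE, cl, gbc, eqxx) /=; case: ([exists _, _]); rewrite ?orbT.
  rewrite (leq_trans (subset_leq_card sub)) // (leq_trans (leq_card_setU _ _)) //.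
  rewrite addn1 doubleS -addn2 leq_add // (leq_trans (leq_card_setU _ _)) //.
  by rewrite cards1 -[2%N]/(1 + 1)%N leq_add2l.
rewrite (mean_mix (pred1 b)) // size_rcons exprS.
have q0 (k : nat) : 0 <= k%:R / #|V|%:R :> R by rewrite divr_ge0.
apply: (@le_trans _ _ (mean (fun f => (1 + (#|A| + (size l).+1)%:R / #|V|%:R) * 2 ^+ hits f))).
  apply: mean_le => f.
  have TE a g : a \in T -> mix (pred1 b) f g a = f a.
    rewrite inE ffunE /=; case: eqP => // ->.
    by rewrite (negPf bA) (negPf bl).
  rewrite (_ : (fun g => _) = fun g : {ffun X -> V} => 2 ^+ hits f * (1 + (g b \in S f)%:R)).
    rewrite meanZ mulrC ler_wpM2r ?exprn_ge0 // meanD mean_cst // lerD2l.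
    rewrite (@mean_coord R X V b (fun v => (v \in S f)%:R)) // mean_in.
    rewrite ler_wpM2r ?invr_ge0 // ler_nat addnS leqW //.
    by rewrite (leq_trans (leq_imset_card _ _)).
  apply/funext => g; rewrite exprD (Hdep _ f) => [|a aT]; last by rewrite TE ?inE.
  congr (_ * _); rewrite {1}/mix ffunE /= eqxx /S (eq_in_imset (g := f)) => [|a /TE //].
  by case: (_ \in _); rewrite ?expr1 ?expr0 ?addr0.
rewrite meanZ ler_wpM2l ?addr_ge0 //; apply: le_trans Hm _.
rewrite lerXn2r ?nnegrE ?addr_ge0 // lerD2l ler_wpM2r ?invr_ge0 // ler_nat.
by rewrite addnS.
Qed.

(** * The random DAG and strategies of the greens *)

Definition indeg (m n d : nat) (f : outcome m n d) (y : node m n) : nat :=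
  if y is Some (i, u) then indegree f (generated f i) u else 0.

(** Parallel edges occupy distinct slots, while they contribute one element to [outs]; the
    probabilistic estimates count slots, the game sees only [outs]. *)
Definition slots (m n d : nat) (f : outcome m n d) (x : node m n) :
    {set node m n * 'I_d} := [set s in generated f (level x) | s.1 == x].

Definition outs (m n d : nat) (f : outcome m n d) (x : node m n) :
    {set node m n} := [set y | rdag_edge f x y].

(** Locality: whether a slot of level k is generated depends only on endpoints of lower slots. This
    is what allows a level to be resampled with its set of slots fixed. *)
Lemma generated_agree (m n d : nat) (f f' : outcome m n d) k :
  (forall s, (level s.1 < k)%N -> f s = f' s) ->
  forall k', (k' <= k)%N -> generated f k' = generated f' k'.
Proof.
move=> ff'; elim=> [//|k' IHk] lt_k.
have eq_deg u : indegree f (generated f k') u = indegree f' (generated f' k') u.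
  rewrite -(IHk (ltnW lt_k)); apply: eq_card => s; rewrite !inE.
  have [sA|//] := boolP (s \in generated f k'); rewrite /= ff' //.
  by have [_ ->] := generated_level sA.
by apply/setP => -[[[i u]|] e]; rewrite !inE //= eq_deg.
Qed.

Lemma indegree_agree (m n d : nat) (f f' : outcome m n d) k :
  (forall s, (level s.1 < k)%N -> f s = f' s) ->
  forall k' u, (k' < k)%N ->
  indegree f (generated f k') u = indegree f' (generated f' k') u.
Proof.
move=> ff' k' u lt_k; rewrite -(generated_agree ff' (ltnW lt_k)).
apply: eq_card => s; rewrite !inE; have [sA|//] := boolP (s \in _).
by rewrite /= ff' //; have [_ ->] := generated_level sA.
Qed.

Lemma rdag_edge_agree (m n d : nat) (f f' : outcome m n d) k x y :
  (forall s, (level s.1 < k)%N -> f s = f' s) -> (level y <= k)%N ->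
  rdag_edge f x y = rdag_edge f' x y.
Proof.
move=> ff'; case: y => [[i u]|] //= ik; apply: eq_existsb => e.
rewrite -(generated_agree ff' (ltnW ik)); have [xA|//] := boolP (_ \in _).
by rewrite /= ff' //; have [_ /= ->] := generated_level xA.
Qed.

Lemma rdag_edgeP (m n d : nat) (f : outcome m n d) x (i : 'I_m) u :
  reflect (exists2 s, s \in generated f i & s.1 = x /\ f s = u)
          (rdag_edge f x (Some (i, u))).
Proof.
apply: (iffP existsP) => [[e /andP[xA /eqP fx]]|[[y e] sA [/= <- <-]]].
  by exists (x, e).
by exists e; rewrite sA eqxx.
Qed.

Lemma generated_oversize (m n d : nat) (f : outcome m n d) k :
  (m < k)%N -> generated f k = finset.set0.
Proof.
case: k => // k mk; apply/setP => -[[[i u]|] e]; rewrite !inE //=.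
by case: eqP => //= ik; have := ltn_ord i; rewrite ik; lia.
Qed.

Lemma card_slots (m n d : nat) (f : outcome m n d) x :
  x \in rdag_vertices f -> #|slots f x| = (d - indeg f x)%N.
Proof.
move=> xv; have card_lt k : (k <= d)%N -> #|[set e : 'I_d | (e < k)%N]| = k.
  move=> kd; have winj : injective (widen_ord kd).
    by move=> a b /(congr1 val) /= /val_inj.
  rewrite -[RHS]card_ord -(card_imset _ winj).
  apply: eq_card => e; rewrite inE; apply/idP/imsetP => [ek|[e' _ ->]].
    by exists (Ordinal ek) => //; apply: val_inj.
  exact: (ltn_ord e').
rewrite -[RHS]card_lt ?leq_subr //.
have inj : injective (fun e : 'I_d => (x, e)) by move=> e e' [].
rewrite -(card_imset _ inj); apply: eq_card => -[y e].
rewrite !inE; apply/andP/imsetP => [[/= yA /eqP yx]|[e' + [-> ->]]].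
  exists e; last by rewrite yx.
  rewrite inE; case: {xv inj}x y yA yx => [[i u]|] // y; last by rewrite /= subn0.
  by rewrite /= inE /= => + yx; rewrite yx => /and3P[].
rewrite inE; case: x xv {inj} => [[i u]|]; last by move=> _ _; rewrite /= !inE.
by rewrite /= !inE /= => -> ->; rewrite !eqxx.
Qed.

Lemma indeg_gt0 (m n d : nat) (f : outcome m n d) x :
  x \in rdag_vertices f -> (0 < level x)%N -> (0 < indeg f x)%N.
Proof. by case: x => [[i u]|]; rewrite // inE. Qed.

Lemma card_outs_slots (m n d : nat) (f : outcome m n d) x :
  (#|outs f x| <= #|slots f x|)%N.
Proof.
have [lx|lx] := ltnP (level x) m; last first.
  rewrite (_ : outs f x = finset.set0) ?cards0 //; apply/setP => y; rewrite !inE.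
  apply/negP => xy; have := rdag_edge_level xy.
  by case: y xy => [[i u]|] //= _ [il]; have := ltn_ord i; rewrite il ltnNge lx.
apply: leq_trans (leq_imset_card (fun s => Some (Ordinal lx, f s)) _).
apply/subset_leq_card/fintype.subsetP => -[[i u]|]; rewrite inE // => /[dup] xy.
move/rdag_edge_level => [il]; have -> : Ordinal lx = i by apply: val_inj.
case/rdag_edgeP: xy => s sA [sx su]; apply/imsetP; exists s; last by rewrite su.
by rewrite inE sx eqxx -il sA.
Qed.

Lemma card_outs (m n d : nat) (f : outcome m n d) x :
  (#|outs f x| <= d - indeg f x)%N.
Proof.
have [xv|xv] := boolP (x \in rdag_vertices f).
  by rewrite -card_slots // card_outs_slots.
rewrite (_ : outs f x = finset.set0) ?cards0 //; apply/setP => y; rewrite !inE.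
by apply: contraNF xv => /rdag_edge_vertices/andP[].
Qed.

Lemma sum_indegree (m n d : nat) (f : outcome m n d) (A : {set node m n * 'I_d}) :
  (\sum_(u in f @: A) indegree f A u)%N = #|A|.
Proof.
rewrite -sum1_card (partition_big_imset f) /=; apply: eq_bigr => u _.
by rewrite /indegree -sum1_card; apply: eq_bigl => s; rewrite inE.
Qed.

Lemma indegree_gt0 (m n d : nat) (f : outcome m n d) (A : {set node m n * 'I_d}) u :
  (0 < indegree f A u)%N = (u \in f @: A).
Proof.
apply/card_gt0P/imsetP => [[s]|[s sA ->]]; last by exists s; rewrite inE sA /=.
by rewrite inE => /andP[sA /eqP <-]; exists s.
Qed.

Lemma card_generatedS (m n d : nat) (f : outcome m n d) k : (k < m)%N ->
  #|generated f k.+1| =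
  (\sum_(u in f @: generated f k) (d - indegree f (generated f k) u))%N.
Proof.
move=> km; pose x u : node m n := Some (Ordinal km, u).
have xv u : (x u \in rdag_vertices f) = (u \in f @: generated f k).
  by rewrite inE /= indegree_gt0.
rewrite -sum1_card.
rewrite (partition_big (fun s => if s.1 is Some (_, u) then u else f s)
   (fun u => u \in f @: generated f k)) /=; last first.
  by move=> [[[i u]|] e]; rewrite inE //= => /and3P[_]; rewrite indegree_gt0.
apply: eq_bigr => u; rewrite -xv => xuv; rewrite -[RHS](card_slots xuv) -sum1_card.
have xE i v : (Some (i, v) == x u) = (i == k :> nat) && (v == u).
  by rewrite -[LHS]/((i, v) == (Ordinal km, u)) xpair_eqE.
apply: eq_bigl => -[[[i v]|] e]; rewrite [RHS]finset.in_set [level _]/= finset.in_set //=.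
by rewrite xE; case: (i == k :> nat) => //=; rewrite ?andbF // andbC.
Qed.

Lemma card_generatedS_le (m n d : nat) (f : outcome m n d) k :
  (#|generated f k.+1| <= d.-1 * #|f @: generated f k|)%N.
Proof.
have [km|mk] := ltnP k m; last by rewrite generated_oversize ?cards0.
rewrite card_generatedS // mulnC -sum_nat_const; apply: leq_sum => u.
by rewrite -indegree_gt0; lia.
Qed.

(** Each endpoint that is hit satisfies (d - indegree) + indegree >= d, truncated subtraction
    included; summing turns a lower bound on the image of a level into one on the next level. *)
Lemma card_generatedS_ge (m n d : nat) (f : outcome m n d) k : (k < m)%N ->
  (d * #|f @: generated f k| <= #|generated f k.+1| + #|generated f k|)%N.
Proof.
move=> km; rewrite card_generatedS // -[X in (_ + X)%N](sum_indegree f).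
by rewrite -big_split /= mulnC -sum_nat_const; apply: leq_sum => u _; lia.
Qed.

Lemma card_generated_le (m n d : nat) (f : outcome m n d) k :
  (#|generated f k| <= d * d.-1 ^ k)%N.
Proof.
elim: k => [|k IHk].
  rewrite expn0 muln1 (_ : generated f 0 = slots f None).
    by rewrite card_slots ?inE ?subn0.
  by apply/setP => -[[[i u]|] e]; rewrite !inE.
apply: (leq_trans (card_generatedS_le f k)).
rewrite expnS mulnCA leq_mul2l (leq_trans (leq_imset_card _ _)) ?orbT //.
Qed.

Lemma card_generated_tree (m n d : nat) (f : outcome m n d) k : (k <= m)%N ->
  (forall i, (i < k)%N -> {in generated f i &, injective f}) ->
  #|generated f k| = (d * d.-1 ^ k)%N.
Proof.
elim: k => [|k IHk] km inj.
  rewrite expn0 muln1 (_ : generated f 0 = slots f None).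
    by rewrite card_slots ?inE ?subn0.
  by apply/setP => -[[[i u]|] e]; rewrite !inE.
apply/eqP; rewrite eqn_leq card_generated_le /=.
have := card_generatedS_ge f km; rewrite card_in_imset; last exact: inj.
rewrite IHk ?(ltnW km) // => [|i ik]; last by apply: inj; rewrite ltnW.
by case: d f inj {IHk} => [|d'] f _; rewrite ?mul0n //= expnS; nia.
Qed.

(** Here [i] is the level of [x] and [k] the number of levels down to the sinks, so the next move of
    the greens has quota [q i.+1]. Only protection of children of the current position is counted
    and earlier protected nodes are forgotten, so this is a sufficient condition for the greens. *)
Fixpoint wins (T : finType) (e : rel T) (q : nat -> nat) (k i : nat) (x : T) :
    bool :=
  if k is k'.+1 then
    (#|[set y | e x y && ~~ wins e q k' i.+1 y]| <= q i.+1)%N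
  else false.

Lemma winsE (T : finType) (e : rel T) (q : nat -> nat) k i x :
  wins e q k.+1 i x = (#|[set y | e x y && ~~ wins e q k i.+1 y]| <= q i.+1)%N.
Proof. by []. Qed.

Lemma winsS (T : finType) (e : rel T) (q : nat -> nat) k i x :
  wins e q k i x -> wins e q k.+1 i x.
Proof.
elim: k i x => // k IHk i x; rewrite 2!winsE => /(leq_trans _); apply.
apply/subset_leq_card/fintype.subsetP => y; rewrite !inE => /andP[-> /=].
exact/contra/IHk.
Qed.

Lemma wins_leq (T : finType) (e : rel T) (q : nat -> nat) k k' i x :
  (k <= k')%N -> wins e q k i x -> wins e q k' i x.
Proof. by move/subnK <-; elim: (k' - k)%N => // l IHl /IHl/winsS. Qed.

(** * From positions to the green number *)

Lemma walk_level (m n d : nat) (f : outcome m n d) i x y :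
  walk (rdag f) i x y -> level y = (level x + i)%N.
Proof.
case/existsP => p /andP[]; case: p => p /= /eqP <-.
elim: p x => [|z p IHp] x /=; first by move=> _ /eqP ->; rewrite addn0.
by case/andP => /rdag_edge_level lz /IHp H /H ->; rewrite lz addSnnS.
Qed.

Lemma walkS (m n d : nat) (f : outcome m n d) i x y z :
  walk (rdag f) i x y -> rdag_edge f y z -> walk (rdag f) i.+1 x z.
Proof.
case/existsP => p /andP[px /eqP py] yz; apply/existsP.
by exists [tuple of rcons p z]; rewrite /= rcons_path px py yz last_rcons /=.
Qed.

Lemma vertex_walk (m n d : nat) (f : outcome m n d) x :
  x \in rdag_vertices f -> walk (rdag f) (level x) None x.
Proof.
move: {2}(level x) (erefl (level x)) => k; elim: k x => [|k IHk] [[i u]|] //=.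
  by move=> _ _; apply/existsP; exists [tuple]; rewrite /= eqxx.
move=> [ik] iv; have : (0 < indegree f (generated f i) u)%N by rewrite inE in iv.
rewrite indegree_gt0 => /imsetP[s sA us]; have [sv sl] := generated_level sA.
have := IHk s.1; rewrite sl => /(_ ik sv) /walkS; apply.
by apply/rdag_edgeP; exists s; rewrite // sl.
Qed.

Lemma in_layer (m n d : nat) (f : outcome m n d) j x :
  (x \in layer (rdag f) None j) = (x \in rdag_vertices f) && (level x == j).
Proof.
rewrite finset.in_set -[vertices _]/(rdag_vertices f); have [xv|//] := boolP (x \in _).
rewrite /=; apply/andP/eqP => [[/walk_level ->] //|<-]; split; first exact: vertex_walk.
apply/forallP => k; apply/negP => /walk_level; rewrite add0n => lk.
by have := ltn_ord k; rewrite -lk ltnn.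
Qed.

Lemma subset_card_between (T : finType) (B A : {set T}) k : B \subset A ->
  (#|B| <= k <= #|A|)%N -> exists Q : {set T}, [/\ B \subset Q, Q \subset A & #|Q| = k].
Proof.
move=> BA /andP[]; elim: k => [|k IHk] Bk kA.
  exists B; split; rewrite ?fintype.subxx //.
  by apply/eqP; rewrite eqn_leq Bk.
have [Bk'|Bk'] := leqP #|B| k; last first.
  by exists B; split; rewrite ?fintype.subxx //; apply/eqP; rewrite eqn_leq Bk.
have [Q [BQ QA Qk]] := IHk Bk' (ltnW kA).
have /fintype.subsetPn[x xA xQ] : ~~ (A \subset Q).
  by apply/negP => /subset_leq_card; rewrite Qk leqNgt kA.
exists (x |: Q); split; rewrite ?cardsU1 ?xQ ?Qk //.
  by rewrite (fintype.subset_trans BQ) // finset.subsetUr.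
by rewrite finset.subUset finset.sub1set xA QA.
Qed.

(** The greens protect the losing children that are still unprotected and pad the move to the exact
    quota demanded by the rules. These children are available because contaminated nodes lie at
    levels at most [i]. *)
Lemma wins_greens (R : realType) (m n d : nat) (f : outcome m n d) j (r : R) k i
    (C P : {set node m n}) x :
  (i + k)%N = j -> level x = i -> (forall c, c \in C -> (level c <= i)%N) ->
  wins (rdag_edge f) (quota r) k i x ->
  greens_win_from (rdag f) None j r i.+1 C P x.
Proof.
elim: k i C P x => // k IHk i C P x ikj lx lC wx.
pose S := [set y | rdag_edge f x y && ~~ wins (rdag_edge f) (quota r) k i.+1 y] :\: P.
have SA : S \subset available (rdag f) C P.
  apply/fintype.subsetP => y; rewrite finset.in_setD finset.in_set => /andP[yP /andP[xy _]].
  rewrite finset.in_setD finset.in_setU negb_or yP -[vertices _]/(rdag_vertices f).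
  have [_ -> ] := andP (rdag_edge_vertices xy); rewrite !andbT.
  by apply/negP => /lC; rewrite (rdag_edge_level xy) lx ltnn.
have [|Q [SQ QA cQ]] := subset_card_between (k := minn (quota r i.+1) #|available (rdag f) C P|) SA.
  rewrite geq_minr andbT leq_min (subset_leq_card SA) andbT.
  by apply: leq_trans wx; apply/subset_leq_card; rewrite finset.subsetDl.
apply: (GreensWinFrom _ QA cQ).
  by rewrite in_layer lx negb_and orbC -ikj (_ : (i == _) = false) //; lia.
move=> y xy yPQ; apply: IHk => //.
- by rewrite addSnnS.
- by rewrite (rdag_edge_level xy) lx.
- by move=> c; rewrite !inE => /predU1P[->|/lC/leqW //]; rewrite (rdag_edge_level xy) lx.
apply: contraNT yPQ => ny; rewrite inE; have [//|yP] := boolP (y \in P).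
by apply: (fintype.subsetP SQ); rewrite !inE yP ny andbT.
Qed.

Lemma green_number_le (R : realType) (m n d : nat) (f : outcome m n d) j (r : R) :
  0 < r -> wins (rdag_edge f) (quota r) j 0 None ->
  rdag_green_number R f j <= r.
Proof.
move=> r0 w; apply: ge_inf; first by exists 0 => x [/ltW].
split=> //; apply: (wins_greens (k := j)) => //.
by move=> c; rewrite inE => /eqP ->.
Qed.

Lemma green_number_ge (R : realType) (m n d : nat) (f : outcome m n d) j (c : R) :
  (0 < j)%N -> (0 < d)%N ->
  (forall r, 0 < r -> r < c -> ~ greens_win (rdag f) None j r) ->
  c <= rdag_green_number R f j.
Proof.
move=> j0 d0 H; apply: lb_le_inf; last first.
  by move=> r [r0 w]; rewrite leNgt; apply/negP => /(H r r0).
(* The infimum needs a nonempty set: at rate d the greens protect all out-neighbours of the source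
   at time 1. *)
exists d%:R; split; first by rewrite ltr0n.
apply: (wins_greens (k := j)) => //; first by move=> x; rewrite inE => /eqP ->.
apply: (@wins_leq _ _ _ 1) => //=; rewrite /quota mulr1 mulr0 floor0 subr0.
rewrite [Num.floor _](Num.Theory.intrKfloor d%:Z) absz_nat.
have := card_outs f None; rewrite subn0 => /(leq_trans _); apply.
by apply/subset_leq_card/fintype.subsetP => y; rewrite !inE => /andP[].
Qed.

(** * Strategies of the sludge *)

Definition good_edge (m n d : nat) (f : outcome m n d) : rel (node m n) :=
  fun x y => rdag_edge f x y && (indeg f y == 1%N).

(** Every node after [x] on the way down has to be good, but [x] itself is unrestricted; this lets
    the source, of in-degree 0, be a root. *)
Fixpoint desc (m n d : nat) (f : outcome m n d) (x : node m n) (h : nat) :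
    {set node m n} :=
  if h is h'.+1 then [set y | [exists z in desc f x h', good_edge f z y]]
  else [set x].

Definition dead (m n d : nat) (f : outcome m n d) (s : node m n * 'I_d) : bool :=
  (s \in generated f (level s.1)) &&
  (indegree f (generated f (level s.1)) (f s) != 1%N).

Definition dead_below (m n d : nat) (f : outcome m n d) (x : node m n) (a b : nat) :
    {set node m n * 'I_d} :=
  [set s | dead f s &
     [&& (a <= level s.1)%N, (level s.1 < b)%N
       & s.1 \in desc f x (level s.1 - level x)]].

Lemma good_edge_inj (m n d : nat) (f : outcome m n d) x x' y :
  good_edge f x y -> good_edge f x' y -> x = x'.
Proof.
case: y => [[i u]|] /andP[] // /rdag_edgeP[s sA [<- su]] /cards1P[t Et].
case/andP=> /rdag_edgeP[s' sA' [<- su']] _.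
have : s \in [set t] by rewrite -Et inE sA su eqxx.
have : s' \in [set t] by rewrite -Et inE sA' su' eqxx.
by rewrite !inE => /eqP -> /eqP ->.
Qed.

Lemma good_edge_level (m n d : nat) (f : outcome m n d) x y :
  good_edge f x y -> level y = (level x).+1.
Proof. by case/andP => /rdag_edge_level. Qed.

Lemma descS (m n d : nat) (f : outcome m n d) x h y :
  reflect (exists2 z, z \in desc f x h & good_edge f z y) (y \in desc f x h.+1).
Proof. by rewrite inE; exact: (iffP exists_inP). Qed.

Lemma desc_level (m n d : nat) (f : outcome m n d) x h y :
  y \in desc f x h -> level y = (level x + h)%N.
Proof.
elim: h y => [|h IHh] y; first by rewrite inE addn0 => /eqP ->.
by case/descS => z /IHh lz /good_edge_level ->; rewrite lz addnS.
Qed.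

Lemma desc_child (m n d : nat) (f : outcome m n d) x c h y :
  good_edge f x c -> y \in desc f c h -> y \in desc f x h.+1.
Proof.
move=> xc; elim: h y => [|h IHh] y.
  by rewrite inE => /eqP ->; apply/descS; exists x; rewrite ?inE.
by case/descS => z /IHh zD zy; apply/descS; exists z.
Qed.

Lemma desc_inj (m n d : nat) (f : outcome m n d) c c' h y :
  y \in desc f c h -> y \in desc f c' h -> c = c'.
Proof.
elim: h y => [|h IHh] y; first by rewrite !inE => /eqP <- /eqP.
move=> /descS[z zc zy] /descS[z' zc' zy']; move: zc'.
by rewrite -(good_edge_inj zy zy'); exact: IHh.
Qed.

Lemma good_edge_vertex (m n d : nat) (f : outcome m n d) x c :
  good_edge f x c -> c \in rdag_vertices f.
Proof. by case/andP => /rdag_edge_vertices/andP[]. Qed.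

(* Each protected node lies below at most one good child of the sludge's
   position, since good nodes have a unique parent. *)
Lemma sludge_wins (R : realType) (m n d : nat) (f : outcome m n d) j (r : R)
    (Inv : nat -> node m n -> Prop) :
  Inv 0 None ->
  (forall i x (Z : {set node m n}), (i < j)%N -> Inv i x -> level x = i ->
     x \in rdag_vertices f -> (#|Z| <= quota r i.+1)%N ->
     exists c, [/\ good_edge f x c, c \notin Z & Inv i.+1 c]) ->
  ~ greens_win (rdag f) None j r.
Proof.
move=> Inv0 step.
(* For y above level i the truncated difference is 0, and [desc] is then {x}, which does not contain
   y; so the condition concerns only nodes at or below the level of x. *)
suff main k i (C P : {set node m n}) x : (i + k)%N = j -> Inv i x -> level x = i ->
    x \in rdag_vertices f -> (forall y, y \in P -> y \notin desc f x (level y - i)) ->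
    ~ greens_win_from (rdag f) None j r i.+1 C P x.
  by apply: (main j) => //; [rewrite inE|move=> y; rewrite inE].
elim: k i C P x => [|k IHk] i C P x ikj Invx lx xv clean [Q xL _ cQ nextw].
  by move: xL; rewrite in_layer xv lx -ikj addn0 eqxx.
pose hit c y := (y \in Q) && (y \in desc f c (level y - i.+1)).
pose Z := [set c | good_edge f x c && [exists y, hit c y]].
have ZQ : (#|Z| <= quota r i.+1)%N.
  apply: (@leq_trans #|Q|); last by rewrite cQ geq_minl.
  pose g c := odflt x [pick y | hit c y].
  have gP c : c \in Z -> hit c (g c).
    rewrite inE => /andP[_ /existsP[y cy]]; rewrite /g.
    by case: pickP => [//|/(_ y)]; rewrite cy.
  rewrite -(card_in_imset (f := g)); last first.
    move=> c c' /gP/andP[_ gc] /gP/andP[_ gc'] gcc.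
    by apply: desc_inj gc _; rewrite gcc.
  apply/subset_leq_card/fintype.subsetP => _ /imsetP[c cZ ->].
  by have /andP[] := gP c cZ.
have [|c [xc cZ Invc]] := step i x Z _ Invx lx xv ZQ; first by rewrite -ikj; lia.
have lc : level c = i.+1 by rewrite (good_edge_level xc) lx.
have nhit y : y \in Q -> y \notin desc f c (level y - i.+1).
  move=> yQ; apply: contra cZ => yc; rewrite inE xc; apply/existsP; exists y.
  by rewrite /hit yQ.
have cP y : y \in P -> y \notin desc f c (level y - i.+1).
  move=> yP; apply: contra (clean y yP) => yc.
  have := desc_child xc yc; have := desc_level yc; rewrite lc => ly.
  by rewrite ly addKn addSn -addnS addKn.
have cPQ : c \notin P :|: Q.
  have cc : c \in desc f c (level c - i.+1) by rewrite lc subnn inE.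
  rewrite finset.in_setU negb_or; apply/andP; split.
    by apply/negP => /cP; rewrite cc.
  by apply/negP => /nhit; rewrite cc.
apply: (IHk i.+1 (c |: C) (P :|: Q) c) => //.
- by rewrite addSnnS.
- exact: good_edge_vertex xc.
- by move=> y; rewrite finset.in_setU => /orP[/cP|/nhit].
- by apply: nextw cPQ; case/andP: xc.
Qed.

Lemma dead_below_child (m n d : nat) (f : outcome m n d) x c a b a' b' :
  good_edge f x c -> (level x < a)%N -> (a' <= a)%N -> (b <= b')%N ->
  dead_below f c a b \subset dead_below f x a' b'.
Proof.
move=> xc xa a'a bb'; apply/fintype.subsetP => s; rewrite !inE => /andP[-> /=].
case/and3P => sa sb /(desc_child xc).
rewrite (good_edge_level xc) => H; rewrite (leq_trans a'a sa) (leq_trans sb bb') /=.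
by move: H; rewrite subnSK // (leq_trans xa sa).
Qed.

Lemma dead_below_disjoint (m n d : nat) (f : outcome m n d) c c' a b :
  c != c' -> level c = level c' ->
  dead_below f c a b :&: dead_below f c' a b = finset.set0.
Proof.
move=> cc' lc; apply/setP => s; rewrite !inE; apply/negP.
case/andP => /andP[_ /and3P[_ _ sc]] /andP[_ /and3P[_ _]]; rewrite -lc => sc'.
by move: cc'; rewrite (desc_inj sc sc') eqxx.
Qed.

Lemma dead_below_empty (m n d : nat) (f : outcome m n d) x a b :
  (b <= a)%N -> dead_below f x a b = finset.set0.
Proof.
move=> ba; apply/setP => s; rewrite !inE; apply/negP => /and4P[_ sa sb _].
by move: (leq_trans (leq_trans sb ba) sa); rewrite ltnn.
Qed.

(** Without dead slots at [x], each slot leads to a node of in-degree 1, so distinct slots have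
    distinct endpoints and all of them are good children. *)
Lemma card_good_children (m n d : nat) (f : outcome m n d) x :
  x \in rdag_vertices f -> (level x < m)%N ->
  dead_below f x (level x) (level x).+1 = finset.set0 ->
  (d - indeg f x <= #|[set c | good_edge f x c]|)%N.
Proof.
move=> xv xm dead0; rewrite -(card_slots xv).
pose g s : node m n := Some (Ordinal xm, f s).
have sP s : s \in slots f x -> s \in generated f (level x) /\
    indegree f (generated f (level x)) (f s) = 1%N.
  rewrite inE => /andP[sA /eqP sx]; split=> //; apply/eqP.
  have : s \notin dead_below f x (level x) (level x).+1 by rewrite dead0 inE.
  by rewrite inE /dead sx sA leqnn ltnSn subnn inE eqxx !andbT negbK.
rewrite -(card_in_imset (f := g)) => [|s s' /sP[sA /eqP/cards1P[t Et]] /sP[sA' _] []].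
  apply/subset_leq_card/fintype.subsetP => _ /imsetP[s sS ->].
  have [sA s1] := sP s sS; rewrite inE /good_edge /= s1 eqxx andbT.
  move: sS; rewrite inE => /andP[_ /eqP sx].
  by apply/(@rdag_edgeP _ _ _ f x (Ordinal xm)); exists s.
move=> fss; have : s \in [set t] by rewrite -Et inE sA eqxx.
have : s' \in [set t] by rewrite -Et inE sA' fss eqxx.
by rewrite !inE => /eqP -> /eqP ->.
Qed.

(** The least multiple of h strictly above i: a node at a multiple of h opens a new block rather
    than closing the previous one. *)
Definition block_end (h i : nat) : nat := ((i %/ h).+1 * h)%N.

(* The number of sludge moves at times i+1, ..., block_end h i at which the
   sludge can choose between two clean subtrees. *)
Definition choices_left (q : nat -> nat) (d h i : nat) : nat :=
  (\sum_(i.+1 <= t < (block_end h i).+1) (q t <= d - 3))%N.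

(* The sludge stands at the root of a clean tree with no dead slot up to the
   end of the current block, and halves, at each of its choices, the number of
   dead slots below it in the next block. *)
Lemma sludge_blocks (R : realType) (m n d : nat) (f : outcome m n d) j (r : R) h :
  (0 < h)%N -> (j <= m)%N -> (3 <= d)%N ->
  (forall t, (0 < t)%N -> (t <= j)%N -> (quota r t <= d - 2)%N) ->
  dead_below f None 0 (minn h.*2 j) = finset.set0 ->
  (forall x, x \in rdag_vertices f -> indeg f x = 1%N -> (0 < level x < j)%N ->
     (h %| level x)%N ->
     (#|dead_below f x (level x + h) (minn (level x + h.*2) j)| <
        2 ^ choices_left (quota r) d h (level x))%N) ->
  ~ greens_win (rdag f) None j r.
Proof.
move=> h0 jm d3 qd2 root_ok node_ok.
pose B := block_end h.
pose F := choices_left (quota r) d h.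
pose Inv i x := [/\ (indeg f x <= 1)%N, dead_below f x i (minn (B i) j) = finset.set0
  & (#|dead_below f x (B i) (minn (B i + h) j)| < 2 ^ F i)%N].
apply: (@sludge_wins _ _ _ _ _ _ _ Inv).
  have B0 : B 0%N = h by rewrite /B /block_end div0n mul1n.
  have sub a b : (b <= minn h.*2 j)%N -> dead_below f None a b = finset.set0.
    move=> bj; apply/eqP; rewrite -finset.subset0 -root_ok.
    apply/fintype.subsetP => s; rewrite !inE => /and4P[-> _ sb ->].
    by rewrite (leq_trans sb bj).
  by split; rewrite // B0 sub ?cards0 ?expn_gt0 //; lia.
move=> i x Z ij [x1 x0 xF] lx xv cZ.
pose G := [set c | good_edge f x c].
have iB : (i < B i)%N by rewrite /B /block_end mulSn addnC {1}(divn_eq i h) ltn_add2l ltn_pmod.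
have cG : (d - 1 <= #|G|)%N.
  apply: leq_trans (card_good_children xv _ _); rewrite ?leq_sub2l ?lx //.
    exact: leq_trans ij jm.
  apply/eqP; rewrite -finset.subset0 -x0; apply/fintype.subsetP => s; rewrite !inE.
  case/and4P => -> -> si ->; rewrite /= (leq_trans si) // leq_min iB ij //.
have cGZ : (#|G| - #|Z| <= #|G :\: Z|)%N.
  by rewrite cardsD leq_sub2l // subset_leq_card // finset.subsetIr.
have q2 := qd2 i.+1 isT ij.
pose F' := (\sum_(i.+2 <= t < (B i).+1) (quota r t <= d - 3))%N.
have FE : F i = ((quota r i.+1 <= d - 3)%N + F')%N.
  by rewrite /F /choices_left big_ltn // ltnS.
have [c cGZ' cF] : exists2 c, c \in G :\: Z &
    (#|dead_below f c (B i) (minn (B i + h) j)| < 2 ^ F')%N.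
  pose W c := dead_below f c (B i) (minn (B i + h) j).
  have WS c : c \in G -> W c \subset W x.
    by rewrite inE => xc; apply: (dead_below_child xc); rewrite ?lx.
  have [q3|q3] := leqP (quota r i.+1) (d - 3); last first.
    have /card_gt0P[c cGZ'] : (0 < #|G :\: Z|)%N by lia.
    exists c => //; apply: leq_ltn_trans (subset_leq_card (WS c _)) _.
      by case/setDP: cGZ'.
    by move: xF; rewrite FE (leqNgt (quota r i.+1)) q3.
  (* At most d - 3 of at least d - 1 good children are spoilt. The dead sets below the two that
     remain are disjoint, so one of them has less than half of the bound. *)
  have /card_gt1P[c [c' [cGZ' cGZ'' cc']]] : (1 < #|G :\: Z|)%N by lia.
  have [cGc [cGc' lcc']] : c \in G /\ (c' \in G /\ level c = level c').
    case/setDP: cGZ' => + _; case/setDP: cGZ'' => + _; rewrite !inE => xc' xc.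
    by rewrite xc xc' (good_edge_level xc) (good_edge_level xc').
  have : (#|W c| + #|W c'| < 2 ^ F' + 2 ^ F')%N.
    apply: (@leq_ltn_trans #|W x|).
      rewrite -cardsUI dead_below_disjoint // cards0 addn0.
      by apply: subset_leq_card; rewrite finset.subUset !WS.
    by move: xF; rewrite FE q3 expnD addnn -mul2n.
  have [cF _|cF] := ltnP #|W c| (2 ^ F')%N; first by exists c.
  by move=> H; exists c' => //; rewrite -/(W c'); move: H cF; move: (2 ^ F')%N; lia.
case/setDP: cGZ'; rewrite inE => xc cnZ; exists c; split=> //.
have c1 : indeg f c = 1%N by case/andP: xc => _ /eqP.
have lc : level c = i.+1 by rewrite (good_edge_level xc) lx.
have [iB1|Bi1] := ltnP i.+1 (B i).
  have BS : B i.+1 = B i.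
    rewrite /B /block_end; congr (_.+1 * _)%N; apply/eqP; rewrite eqn_leq.
    rewrite (leq_div2r h (leqnSn i)) andbT -ltnS ltn_divLR //.
  split; rewrite ?c1 ?BS // /F /choices_left -/(B i.+1) ?BS //.
  apply/eqP; rewrite -finset.subset0 -x0; apply: (dead_below_child xc) => //.
  by rewrite lx.
(* At the end of a block no choice is left, so fewer than 2^0 dead slots remain below [c]: the block
   that starts at [c] is clean, and [node_ok] restarts the count for the one after it. *)
have {Bi1} Bi1 : B i = i.+1 by apply/eqP; rewrite eqn_leq Bi1.
have F'0 : F' = 0%N by rewrite /F' Bi1 big_geq.
have hi : (h %| i.+1)%N by rewrite -Bi1 dvdn_mull.
have BS : B i.+1 = (i.+1 + h)%N.
  by rewrite {1}/B /block_end mulSn divnK // addnC.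
move: cF; rewrite F'0 ltnS leqn0 cards_eq0 Bi1 => /eqP cF.
split; rewrite ?c1 ?BS //.
have [ij1|ij1] := ltnP i.+1 j.
  have := node_ok c (good_edge_vertex xc) c1; rewrite lc => /(_ ij1 hi).
  by rewrite -addnn addnA.
rewrite dead_below_empty ?cards0 ?expn_gt0 //; lia.
Qed.

(** * Resampling one level *)

Definition resample (m n d : nat) (k : nat) (f g : outcome m n d) : outcome m n d :=
  mix (fun s => level s.1 == k) f g.

Lemma resample_low (m n d : nat) k (f g : outcome m n d) s :
  (level s.1 < k)%N -> resample k f g s = f s.
Proof. by move=> lk; rewrite ffunE ltn_eqF. Qed.

Lemma resample_at (m n d : nat) k (f g : outcome m n d) s :
  s \in generated f k -> resample k f g s = g s.
Proof. by move=> /generated_level[_ lk]; rewrite ffunE lk eqxx. Qed.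

Lemma generated_resample (m n d : nat) k (f g : outcome m n d) :
  generated (resample k f g) k = generated f k.
Proof. by apply: (generated_agree (k := k)) => // s; exact: resample_low. Qed.

Lemma card_outcome_gt0 (m n d : nat) : (0 < n)%N -> (0 < #|outcome m n d|)%N.
Proof. by move=> n0; apply: card_ffun_gt0; rewrite card_ord. Qed.

Lemma upr_resample (R : realType) (m n d : nat) k (E : outcome m n d -> Prop)
    (eps : R) : (0 < n)%N ->
  (forall f, uniform_pr R (fun g => E (resample k f g)) <= eps) ->
  uniform_pr R E <= eps.
Proof. by move=> n0; apply: upr_mix; exact: card_outcome_gt0. Qed.

Lemma upr_level_collision (R : realType) (m n d : nat) k : (0 < n)%N ->
  uniform_pr R (fun f : outcome m n d => ~ {in generated f k &, injective f}) <=
  (d * d.-1 ^ k)%:R ^+ 2 / n%:R.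
Proof.
move=> n0; apply: (upr_resample (k := k)) => // f.
apply: (@le_trans _ _ (#|generated f k|%:R ^+ 2 / n%:R)); last first.
  by rewrite ler_wpM2r ?invr_ge0 // -!natrX ler_nat leq_sqr card_generated_le.
have n0' : (0 < #|'I_n|)%N by rewrite card_ord.
have := upr_collision R (generated f k) n0'; rewrite card_ord; apply: le_trans.
apply: upr_le => g; apply: contra_not => inj s t.
by rewrite generated_resample => sA tA; rewrite !resample_at //; exact: inj.
Qed.

Lemma upr_tree (R : realType) (m n d : nat) k : (0 < n)%N -> (1 < d)%N ->
  uniform_pr R (fun f : outcome m n d =>
     ~ (forall i, (i < k)%N -> {in generated f i &, injective f})) <=
  k%:R * ((d * d.-1 ^ k)%:R ^+ 2 / n%:R).
Proof.
move=> n0 d1; apply: (@le_trans _ _ (\sum_(i < k) ((d * d.-1 ^ k)%:R ^+ 2 / n%:R))); last first.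
  by rewrite sumr_const card_ord -[X in X <= _]mulr_natl.
pose E (i : 'I_k) (f : outcome m n d) := ~ {in generated f i &, injective f}.
apply: (@le_trans _ _ (\sum_(i < k) uniform_pr R (E i))).
  apply: le_trans (upr_ex _ _); apply: upr_le => f; apply: contra_notP => nE i ik.
  by apply: contra_notP nE => ninj; exists (Ordinal ik).
apply: ler_sum => i _; apply: le_trans (upr_level_collision _ _ _ _ _) _ => //.
rewrite ler_wpM2r ?invr_ge0 // -!natrX ler_nat leq_sqr leq_mul2l leq_pexp2l ?orbT //.
  by case: d d1 {E} => [|[]].
by rewrite ltnW.
Qed.

(** The size of the level is random but fixed by the lower levels, so the deviation [lam] may depend
    on it; [Pd] restricts to the sizes for which the second moment bound is at most [eps]. *)
Lemma upr_image_generated (R : realType) (m n d : nat) k (Pd : nat -> Prop)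
    (lam : nat -> R) (eps : R) : (1 < n)%N -> 0 <= eps ->
  (forall E, Pd E -> 0 < lam E /\ E%:R / lam E ^+ 2 <= eps) ->
  uniform_pr R (fun f : outcome m n d => Pd #|generated f k| /\
    #|f @: generated f k|%:R <=
      n%:R * (1 - (1 - n%:R^-1) ^+ #|generated f k|) - lam #|generated f k|) <= eps.
Proof.
move=> n1 eps0 H; apply: (upr_resample (k := k)); first exact: ltnW.
move=> f; have [PE|nPE] := pselect (Pd #|generated f k|); last first.
  by rewrite upr0 // => g []; rewrite generated_resample.
have [lam0 le_eps] := H _ PE; apply: le_trans le_eps.
have n1' : (1 < #|'I_n|)%N by rewrite card_ord.
apply: le_trans (upr_image_small (generated f k) n1' lam0).
apply: upr_le => g [_]; rewrite !generated_resample card_ord.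
by rewrite (eq_in_imset (g := g)) // => s; exact: resample_at.
Qed.

Lemma desc_agree (m n d : nat) (f f' : outcome m n d) k x h :
  (forall s, (level s.1 < k)%N -> f s = f' s) -> (level x + h <= k)%N ->
  desc f x h = desc f' x h.
Proof.
move=> ff'; elim: h => [//|h IHh] hk; apply/setP => y.
apply/descS/descS => -[z zD zy].
  exists z; first by rewrite -IHh //; lia.
  have ly : level y = (level x + h.+1)%N.
    by rewrite (good_edge_level zy) (desc_level zD) addnS.
  move: zy; rewrite /good_edge (rdag_edge_agree _ ff') ?ly //.
  case: y ly => [[i u]|] //=; rewrite addnS => -[li].
  by rewrite (indegree_agree ff') // li; lia.
have ly : level y = (level x + h.+1)%N.
  by rewrite (good_edge_level zy) (desc_level zD) addnS.
exists z; first by rewrite IHh //; lia.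
move: zy; rewrite /good_edge -(rdag_edge_agree _ ff') ?ly //.
case: y ly => [[i u]|] //=; rewrite addnS => -[li].
by rewrite (indegree_agree ff') // li; lia.
Qed.

Lemma card_outs_le (m n d : nat) (f : outcome m n d) x :
  (0 < level x)%N -> (#|outs f x| <= d.-1)%N.
Proof.
move=> lx; have [xv|xv] := boolP (x \in rdag_vertices f).
  by apply: leq_trans (card_outs f x) _; have := indeg_gt0 xv lx; lia.
rewrite (_ : outs f x = finset.set0) ?cards0 //; apply/setP => y; rewrite !inE.
by apply: contraNF xv => /rdag_edge_vertices/andP[].
Qed.

Lemma card_slots_le (m n d : nat) (f : outcome m n d) x :
  (0 < level x)%N -> (#|slots f x| <= d.-1)%N.
Proof.
move=> lx; have [xv|xv] := boolP (x \in rdag_vertices f).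
  by rewrite card_slots //; have := indeg_gt0 xv lx; lia.
rewrite (_ : slots f x = finset.set0) ?cards0 //; apply/setP => s; rewrite !inE.
apply: contraNF xv => /andP[/generated_level[sv _] /eqP <-] //.
Qed.

Lemma card_bigcup_le (I T : finType) (H : {set I}) (F : I -> {set T}) c :
  (forall x, x \in H -> (#|F x| <= c)%N) ->
  (#|\bigcup_(x in H) F x| <= c * #|H|)%N.
Proof.
move=> Fc; rewrite mulnC -sum_nat_const.
elim/big_rec2: _ => [|x k A xH IH]; first by rewrite cards0.
by rewrite (leq_trans (leq_card_setU _ _)) // leq_add ?Fc.
Qed.

Lemma card_desc (m n d : nat) (f : outcome m n d) x h :
  (0 < level x)%N -> (#|desc f x h| <= d.-1 ^ h)%N.
Proof.
move=> lx; elim: h => [|h IHh]; first by rewrite cards1.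
apply: (@leq_trans #|\bigcup_(z in desc f x h) outs f z|).
  apply/subset_leq_card/fintype.subsetP => y /descS[z zD /andP[zy _]].
  by apply/bigcupP; exists z; rewrite ?inE.
apply: leq_trans (card_bigcup_le (c := d.-1) _) _; last by rewrite expnS leq_mul2l IHh orbT.
by move=> z /desc_level lz; rewrite card_outs_le // lz addn_gt0 lx.
Qed.

(** The slots [B] of level k below [x] are revealed after the other slots [A] of that level. A dead
    slot shares its endpoint with another slot, so 2 M dead slots require M hits, and Markov's
    inequality is applied to 2^hits. *)
Lemma upr_dead_below (R : realType) (m n d : nat) (x : node m n) k M :
  (0 < n)%N -> (0 < level x <= k)%N ->
  uniform_pr R (fun f : outcome m n d => (M.*2 <= #|dead_below f x k k.+1|)%N) <=
  expR ((d.-1 ^ (k - level x).+1)%:R * (d * d.-1 ^ k)%:R / n%:R) / 2 ^+ M.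
Proof.
move=> n0 /andP[lx xk]; apply: (upr_resample (k := k)) => // f.
set h := (k - level x)%N.
pose B := [set s in generated f k | s.1 \in desc f x h].
pose A := generated f k :\: B.
have n0' : (0 < #|'I_n|)%N by rewrite card_ord.
have cB : (#|B| <= d.-1 ^ h.+1)%N.
  apply: (@leq_trans #|\bigcup_(z in desc f x h) slots f z|).
    apply/subset_leq_card/fintype.subsetP => s; rewrite inE => /andP[sA sD].
    apply/bigcupP; exists s.1 => //; rewrite inE eqxx andbT.
    by have [_ ->] := generated_level sA.
  apply: leq_trans (card_bigcup_le (c := d.-1) _) _.
    by move=> z /desc_level lz; rewrite card_slots_le // lz addn_gt0 lx.
  by rewrite expnS leq_mul2l card_desc ?orbT.
have cAB : (#|A| + #|B| = #|generated f k|)%N.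
  rewrite -[RHS](cardsID B) addnC; congr (_ + _)%N; apply: eq_card => s.
  by rewrite finset.in_setI !inE; case: (s \in generated f k); rewrite ?andbT.
have dis : {in enum B, forall b, b \notin A}.
  by move=> b; rewrite mem_enum finset.in_setD => ->.
have [hits [_ Hd Hm]] := mean_hits R n0' (enum_uniq (mem B)) dis.
apply: (@le_trans _ _ (uniform_pr R (fun g : outcome m n d => 2 ^+ M <= 2 ^+ hits g :> R))).
  apply: upr_le => g leM; rewrite ler_eXn2l ?ltr1n // -leq_double.
  apply: leq_trans leM _; apply: leq_trans (Hd g).
  apply/subset_leq_card/fintype.subsetP => s; rewrite inE /dead.
  case/andP => /andP[sA sdeg] /and3P[ks sk sD].
  have ls : level s.1 = k by apply/eqP; rewrite eqn_leq -ltnS sk ks.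
  move: sA sdeg sD; rewrite ls generated_resample => sA.
  rewrite -(@desc_agree _ _ _ f _ k) ?subnKC // => [sdeg sD|s' ls']; last first.
    by rewrite resample_low.
  rewrite inE mem_enum inE sA sD /=; apply/existsP; apply/not_existsP => nos.
  case/negP: sdeg; apply/cards1P; exists s; apply/setP => s'; rewrite !inE.
  apply/andP/eqP => [[s'A /eqP]|->]; last by rewrite sA.
  rewrite !resample_at // => gss; apply/eqP/negPn/negP => ss.
  apply: (nos s'); rewrite mem_enum ss gss eqxx.
  by rewrite finset.in_setD s'A andbT orNb.
have pow_ge0 (g : outcome m n d) : 0 <= 2 ^+ hits g :> R by rewrite exprn_ge0.
apply: le_trans (markov_upr (exprn_gt0 M (ltr0Sn R 1)) pow_ge0) _.
rewrite ler_wpM2r ?invr_ge0 ?exprn_ge0 //; apply: le_trans Hm _.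
rewrite -cardE cAB card_ord.
apply: (@le_trans _ _ (expR ((#|generated f k|%:R / n%:R)) ^+ #|B|)).
  by rewrite lerXn2r ?nnegrE ?expR_ge0 ?addr_ge0 ?divr_ge0 // expR_ge1Dx.
rewrite -expRM_natl ler_expR mulrA ler_wpM2r ?invr_ge0 //.
by rewrite ler_pM // ler_nat // card_generated_le.
Qed.

(** The family is determined below level k, so a union bound over it is legitimate. In-degree 1 at
    all endpoints of [B] says that [B] is injective and that no other slot of the level hits its
    values. *)
Lemma upr_isolated_family (R : realType) (m n d : nat) k
    (Fam : outcome m n d -> seq {set node m n * 'I_d})
    (Pd : nat -> Prop) (eps : R) : (0 < n)%N -> 0 <= eps ->
  (forall f g, Fam (resample k f g) = Fam f) ->
  (forall f B, B \in Fam f -> B \subset generated f k) ->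
  (forall f, Pd #|generated f k| ->
    \sum_(B <- Fam f) expR (- ((#|generated f k| - #|B|)%N%:R * (#|B|%:R / n%:R))) <= eps) ->
  uniform_pr R (fun f : outcome m n d => Pd #|generated f k| /\
    exists2 B, B \in Fam f &
      forall s, s \in B -> indegree f (generated f k) (f s) = 1%N) <= eps.
Proof.
move=> n0 eps0 FamE Famk le_eps; apply: (upr_resample (k := k)) => // f.
have [PE|nPE] := pselect (Pd #|generated f k|); last first.
  by rewrite upr0 // => g []; rewrite generated_resample.
apply: le_trans (le_eps f PE).
pose E (B : {set node m n * 'I_d}) (g : outcome m n d) :=
  {in B &, injective g} /\ forall a b, a \in generated f k :\: B -> b \in B -> g a != g b.
apply: (@le_trans _ _ (\sum_(B <- Fam f) uniform_pr R (E B))).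
  apply: le_trans (upr_seq _ _ _); apply: upr_le => g [_ [B]].
  rewrite FamE => BF; rewrite generated_resample => iso; exists B => //.
  have BA s : s \in B -> s \in generated f k by apply/fintype.subsetP/Famk.
  have one s t : s \in B -> t \in generated f k -> g s = g t -> s = t.
    move=> sB tA gst; have := iso s sB => /eqP/cards1P[z Ez].
    have : s \in [set z] by rewrite -Ez inE BA ?eqxx.
    have : t \in [set z].
      by rewrite -Ez inE tA /= (resample_at g tA) (resample_at g (BA s sB)) gst.
    by rewrite !inE => /eqP -> /eqP ->.
  split; first by move=> s t sB /BA tA; exact: one.
  move=> a b /setDP[aA aB] bB; apply: contraNneq aB => gab.
  by rewrite -(one b a bB aA).
rewrite big_seq [X in _ <= X]big_seq; apply: ler_sum => B BF.
have n0' : (0 < #|'I_n|)%N by rewrite card_ord.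
have dis : [disjoint generated f k :\: B & B].
  by rewrite -setI_eq0 finset.setDE -finset.setIA [~: B :&: B]finset.setIC finset.setICr finset.setI0.
apply: le_trans (upr_isolated R n0' dis) _.
by rewrite cardsD (finset.setIidPr (Famk f B BF)) card_ord.
Qed.

(** * Losing positions of the greens *)

Definition succs (m n d : nat) (f : outcome m n d) (H : {set node m n}) :
  {set node m n} := [set y | [exists x in H, rdag_edge f x y]].

Definition slots_of (m n d : nat) (f : outcome m n d) k (H : {set node m n}) :
  {set node m n * 'I_d} := [set s in generated f k | s.1 \in H].

Lemma succsP (m n d : nat) (f : outcome m n d) (H : {set node m n}) y :
  reflect (exists2 x, x \in H & rdag_edge f x y) (y \in succs f H).
Proof. by rewrite inE; exact: exists_inP. Qed.

Lemma losers_sub (m n d : nat) (f : outcome m n d) q k i x :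
  ([set y | rdag_edge f x y && ~~ wins (rdag_edge f) q k i y] \subset outs f x).
Proof. by apply/fintype.subsetP => y; rewrite !inE => /andP[]. Qed.

(** A squeeze: more than d - 2 losing children among at most d - indeg <= d - 1 out-neighbours
    forces equality everywhere. *)
Lemma loses_full (m n d : nat) (f : outcome m n d) q k i x : (1 < d)%N ->
  x \in rdag_vertices f -> (0 < level x)%N -> (d - 2 <= q i.+1)%N ->
  ~~ wins (rdag_edge f) q k.+1 i x ->
  [/\ indeg f x = 1%N, #|outs f x| = d.-1
    & forall y, rdag_edge f x y -> ~~ wins (rdag_edge f) q k i.+1 y].
Proof.
move=> d1 xv lx qd; rewrite winsE -ltnNge => lt_q.
pose L : {set node m n} := [set y | rdag_edge f x y && ~~ wins (rdag_edge f) q k i.+1 y].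
have {}lt_q : (q i.+1 < #|L|)%N by exact: lt_q.
have sub : L \subset outs f x := losers_sub f q k i.+1 x.
have dg := indeg_gt0 xv lx; have cL := subset_leq_card sub.
have cO := card_outs f x.
have L1 : (d.-1 <= #|L|)%N.
  by lia.
have LO : L = outs f x.
  by apply/eqP; rewrite eqEcard sub /=; apply: leq_trans cO (leq_trans _ L1); lia.
have {}cO := leq_trans L1 (leq_trans cL cO).
split; [by lia|by apply/eqP; rewrite -LO eqn_leq L1 (leq_trans cL) // (leq_trans (card_outs f x)) //; lia|move=> y xy].
have : y \in L by rewrite LO inE.
by rewrite inE xy.
Qed.

(** More than d - 3 losing children among at most d - indeg out-neighbours leaves room for in-degree
    2, but no more. *)
Lemma loses_some (m n d : nat) (f : outcome m n d) q k i x : (2 < d)%N ->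
  (d - 3 <= q i.+1)%N -> ~~ wins (rdag_edge f) q k.+1 i x ->
  (indeg f x <= 2)%N /\
  exists2 y, rdag_edge f x y & ~~ wins (rdag_edge f) q k i.+1 y.
Proof.
move=> d2 qd; rewrite winsE -ltnNge => lt_q.
have cL := subset_leq_card (losers_sub f q k i.+1 x).
have cO := card_outs f x; split; first by move: lt_q cL cO; lia.
have /card_gt0P[y] := leq_ltn_trans (leq0n _) lt_q.
by rewrite inE => /andP[xy yL]; exists y.
Qed.

Definition losing (m n d : nat) (f : outcome m n d) q j i (H : {set node m n}) :=
  forall x, x \in H ->
    [/\ x \in rdag_vertices f, level x = i & ~~ wins (rdag_edge f) q (j - i) i x].

Lemma card_parents (m n d : nat) (f : outcome m n d) y :
  (#|[set x | rdag_edge f x y]| <= indeg f y)%N.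
Proof.
case: y => [[i u]|]; last first.
  by rewrite leqn0 cards_eq0; apply/eqP/setP => x; rewrite !inE.
apply: leq_trans (leq_imset_card (fun s => s.1) _).
apply/subset_leq_card/fintype.subsetP => x; rewrite finset.in_set.
case/rdag_edgeP => s sA [sx su].
by apply/imsetP; exists s; rewrite ?sx // inE sA su eqxx.
Qed.

(** Double counting of the edges between [H] and its successors. *)
Lemma card_succs_ge (m n d : nat) (f : outcome m n d) (H : {set node m n}) c1 c2 :
  (forall x, x \in H -> (c1 <= #|outs f x|)%N) ->
  (forall y, y \in succs f H -> (indeg f y <= c2)%N) ->
  (c1 * #|H| <= c2 * #|succs f H|)%N.
Proof.
move=> H1 H2; apply: (@leq_trans (\sum_(x in H) \sum_(y in succs f H) rdag_edge f x y)).
  rewrite mulnC -sum_nat_const; apply: leq_sum => x xH; apply: leq_trans (H1 x xH) _.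
  rewrite -sum1_card big_mkcond [X in (_ <= X)%N]big_mkcond /=; apply: leq_sum => y _.
  rewrite inE; case: ifP => // xy.
  by rewrite (_ : y \in succs f H) //; apply/succsP; exists x.
rewrite exchange_big /= mulnC -sum_nat_const; apply: leq_sum => y yS.
apply: leq_trans (H2 y yS); apply: leq_trans (card_parents f y).
rewrite -sum1_card big_mkcond [X in (_ <= X)%N]big_mkcond /=; apply: leq_sum => x _.
by rewrite inE; case: (x \in H); case: (rdag_edge f x y).
Qed.

Lemma card_succs_le (m n d : nat) (f : outcome m n d) (H : {set node m n}) :
  (forall x, x \in H -> (0 < level x)%N) -> (#|succs f H| <= d.-1 * #|H|)%N.
Proof.
move=> lH; apply: (@leq_trans #|\bigcup_(x in H) outs f x|).
  apply/subset_leq_card/fintype.subsetP => y /succsP[x xH xy].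
  by apply/bigcupP; exists x; rewrite ?inE.
by apply: card_bigcup_le => x /lH; exact: card_outs_le.
Qed.

Lemma losing_succs (m n d : nat) (f : outcome m n d) q j i H :
  (1 < d)%N -> (0 < i < j)%N -> (d - 2 <= q i.+1)%N -> losing f q j i H ->
  losing f q j i.+1 (succs f H) /\
  forall x, x \in H -> indeg f x = 1%N /\ #|outs f x| = d.-1.
Proof.
move=> d1 /andP[i0 ij] qd LH.
have H' x : x \in H -> [/\ indeg f x = 1%N, #|outs f x| = d.-1
    & forall y, rdag_edge f x y -> ~~ wins (rdag_edge f) q (j - i.+1) i.+1 y].
  move=> /LH[xv lx nx]; apply: loses_full => //; first by rewrite lx.
  by rewrite -subSn.
split; last by move=> x /H'[].
move=> y /succsP[x xH xy]; have [_ _ /(_ y xy) ny] := H' x xH.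
have [_ lx _] := LH x xH; split=> //; last by rewrite (rdag_edge_level xy) lx.
by have /andP[] := rdag_edge_vertices xy.
Qed.

(** The first full quota makes all children losing, the second gives these children in-degree 1, so
    that distinct parents share none of them. This is why two consecutive quotas occur. *)
Lemma card_losing_succs (m n d : nat) (f : outcome m n d) q j i H :
  (1 < d)%N -> (0 < i)%N -> (i.+1 < j)%N -> (d - 2 <= q i.+1)%N ->
  (d - 2 <= q i.+2)%N -> losing f q j i H -> #|succs f H| = (d.-1 * #|H|)%N.
Proof.
move=> d1 i0 ij qd qd' LH; have ij' : (0 < i < j)%N by rewrite i0 ltnW.
have [LS Hd] := losing_succs d1 ij' qd LH; have [_ Sd] := losing_succs d1 (ij : (0 < i.+1 < j)%N) qd' LS.
apply/eqP; rewrite eqn_leq card_succs_le => [|x /LH[_ -> _] //].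
rewrite -[X in (_ <= X)%N]mul1n; apply: card_succs_ge => [x /Hd[_ ->] //|y /Sd[-> //]].
Qed.

Lemma losing_slots (m n d : nat) (f : outcome m n d) q j i H :
  (1 < d)%N -> (j <= m)%N -> (0 < i)%N -> (i.+1 < j)%N -> (d - 2 <= q i.+1)%N ->
  (d - 2 <= q i.+2)%N -> losing f q j i H ->
  #|slots_of f i H| = (d.-1 * #|H|)%N /\
  forall s, s \in slots_of f i H -> indegree f (generated f i) (f s) = 1%N.
Proof.
move=> d1 jm i0 ij qd qd' LH; have ij' : (0 < i < j)%N by rewrite i0 ltnW.
have [LS Hd] := losing_succs d1 ij' qd LH; have [_ Sd] := losing_succs d1 (ij : (0 < i.+1 < j)%N) qd' LS.
have im : (i < m)%N by lia.
split; last first.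
  move=> s; rewrite inE => /andP[sA sH].
  have /Sd[] // : Some (Ordinal im, f s) \in succs f H.
  by apply/succsP; exists s.1 => //; apply/rdag_edgeP; exists s.
rewrite -sum1_card (partition_big (fun s => s.1) (mem H)) /=; last first.
  by move=> s; rewrite inE => /andP[].
rewrite mulnC -sum_nat_const; apply: eq_bigr => x xH.
have [xv lx _] := LH x xH; have [dx _] := Hd x xH.
rewrite -subn1 -[X in (_ - X)%N]dx -card_slots // -sum1_card; apply: eq_bigl => s.
rewrite !inE lx; case: eqP => [->|]; rewrite ?andbF //.
by rewrite (_ : x \in H) ?andbT.
Qed.

Lemma succs_agree (m n d : nat) (f f' : outcome m n d) k (H : {set node m n}) :
  (forall s, (level s.1 < k)%N -> f s = f' s) ->
  (forall x, x \in H -> (level x < k)%N) -> succs f H = succs f' H.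
Proof.
move=> ff' lH; apply/setP => y; apply/succsP/succsP => -[x xH xy]; exists x => //.
  by rewrite -(rdag_edge_agree _ ff') // (rdag_edge_level xy) lH.
by rewrite (rdag_edge_agree _ ff') // (rdag_edge_level xy) lH.
Qed.

Lemma succs_level (m n d : nat) (f : outcome m n d) (H : {set node m n}) i :
  (forall x, x \in H -> level x = i) -> forall y, y \in succs f H -> level y = i.+1.
Proof. by move=> lH y /succsP[x /lH lx /rdag_edge_level ->]; rewrite lx. Qed.

Lemma iter_succs_agree (m n d : nat) (f f' : outcome m n d) k
    (H : {set node m n}) i h :
  (forall s, (level s.1 < k)%N -> f s = f' s) -> (i + h <= k)%N ->
  (forall x, x \in H -> level x = i) ->
  iter h (succs f) H = iter h (succs f') H /\
  forall x, x \in iter h (succs f) H -> level x = (i + h)%N.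
Proof.
move=> ff' + lH; elim: h => [|h IHh] hk /=; first by rewrite addn0.
have [|eqH lh] := IHh; first by lia.
split; last by rewrite addnS; apply: succs_level.
rewrite -eqH; apply: (succs_agree ff') => x /lh ->; lia.
Qed.

Lemma outs_agree (m n d : nat) (f f' : outcome m n d) k x :
  (forall s, (level s.1 < k)%N -> f s = f' s) -> (level x < k)%N ->
  outs f x = outs f' x.
Proof.
move=> ff' lx; apply/setP => y; rewrite !inE; apply/idP/idP => xy.
  by rewrite -(rdag_edge_agree _ ff') // (rdag_edge_level xy).
by rewrite (rdag_edge_agree _ ff') // (rdag_edge_level xy).
Qed.

(** One losing child [y] of the source is followed, and below it the tree is full. The distinctness
    of the endpoints at level k + 2 comes from the losing nodes there, hence [k.+2 < j]. *)
Lemma loses_tree (m n d : nat) (f : outcome m n d) q j k : (2 < d)%N -> (j <= m)%N ->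
  (forall t, d - 2 <= q t)%N -> (k.+2 < j)%N ->
  ~~ wins (rdag_edge f) q j 0 None ->
  exists2 y, y \in outs f None &
    #|slots_of f k.+1 (iter k (succs f) [set y])| = (d.-1 ^ k.+1)%N /\
    {in slots_of f k.+1 (iter k (succs f) [set y]) &, injective f}.
Proof.
move=> d2 jm qd kj root; have d1 : (1 < d)%N by rewrite ltnW.
have q1 : (d - 3 <= q 1)%N by apply: leq_trans (qd 1%N); lia.
have jE : j = j.-1.+1 by lia.
rewrite jE in root; have [_ [y y0 ny]] := loses_some d2 q1 root.
exists y; first by rewrite inE.
have ly := rdag_edge_level y0.
have LH h : (h < j.-1)%N -> losing f q j h.+1 (iter h (succs f) [set y]).
  elim: h => [|h IHh] hj.
    move=> x; rewrite inE => /eqP ->; split=> //; last by rewrite subn1.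
    by have /andP[] := rdag_edge_vertices y0.
  have hj' : (0 < h.+1 < j)%N by lia.
  by have [|//] := losing_succs d1 hj' (qd _) (IHh _); lia.
have cH h : (h.+1 < j.-1)%N -> #|iter h (succs f) [set y]| = (d.-1 ^ h)%N.
  elim: h => [|h IHh] hj; first by rewrite cards1.
  rewrite /= (@card_losing_succs _ _ _ _ q j h.+1) ?IHh ?expnS //; try lia.
  by apply: LH; lia.
have [|cS iS] := losing_slots d1 jm (ltn0Sn k) kj (qd _) (qd _) (LH k _); first lia.
rewrite cS cH; last lia.
split; first by rewrite expnS.
move=> s t sS tS fst; have /eqP/cards1P[z Ez] := iS s sS.
have : s \in [set z] by rewrite -Ez inE eqxx andbT; move: sS; rewrite inE => /andP[].
have : t \in [set z] by rewrite -Ez inE fst eqxx andbT; move: tS; rewrite inE => /andP[].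
by rewrite !inE => /eqP -> /eqP ->.
Qed.

(** There are at most d choices of [y], and the slots of its tree at level k + 1 are known before
    that level is resampled; one half of them must avoid the endpoints of the other half. *)
Lemma upr_loses_tree (R : realType) (m n d : nat) q j k : (0 < n)%N -> (2 < d)%N ->
  (j <= m)%N -> (forall t, d - 2 <= q t)%N -> (k.+2 < j)%N ->
  uniform_pr R (fun f : outcome m n d => ~~ wins (rdag_edge f) q j 0 None) <=
  d%:R * expR (- ((d.-1 ^ k.+1)./2%:R ^+ 2 / n%:R)).
Proof.
move=> n0 d2 jm qd kj.
pose B (f : outcome m n d) y := slots_of f k.+1 (iter k (succs f) [set y]).
apply: (@le_trans _ _ (uniform_pr R (fun f => exists2 y, y \in outs f None &
   #|B f y| = (d.-1 ^ k.+1)%N /\ {in B f y &, injective f}))).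
  by apply: upr_le => f /(loses_tree d2 jm qd kj).
apply: (upr_resample (k := k.+1)) => // f.
pose E y (g : outcome m n d) := #|B f y| = (d.-1 ^ k.+1)%N /\ {in B f y &, injective g}.
apply: (@le_trans _ _ (\sum_(y <- enum (outs f None)) uniform_pr R (E y))).
  apply: le_trans (upr_seq _ _ _); apply: upr_le => g [y].
  have low s : (level s.1 < k.+1)%N -> resample k.+1 f g s = f s by exact: resample_low.
  rewrite (outs_agree low) // => y0 Ey; exists y; first by rewrite mem_enum.
  have ly : level y = 1%N by move: y0; rewrite inE => /rdag_edge_level.
  have BE : B (resample k.+1 f g) y = B f y.
    rewrite /B /slots_of generated_resample.
    have [||-> _ //] := iter_succs_agree (H := [set y]) (i := 1) (h := k) low; first by lia.
    by move=> x; rewrite inE => /eqP ->.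
  move: Ey; rewrite BE => -[cB inj]; split=> // s t sB tB gst.
  have sA u : u \in B f y -> u \in generated f k.+1 by rewrite inE => /andP[].
  by apply: inj => //; rewrite !resample_at ?sA.
apply: (@le_trans _ _ (\sum_(y <- enum (outs f None))
   expR (- ((d.-1 ^ k.+1)./2%:R ^+ 2 / n%:R)))).
  apply: ler_sum => y _.
  have [cB|cB] := eqVneq #|B f y| (d.-1 ^ k.+1)%N; last first.
    by rewrite upr0 ?expR_ge0 // => g [/eqP]; rewrite (negPf cB).
  have n0' : (0 < #|'I_n|)%N by rewrite card_ord.
  have le_half : ((d.-1 ^ k.+1)./2.*2 <= #|B f y|)%N by rewrite cB; lia.
  have := upr_injective R n0' le_half; rewrite card_ord; apply: le_trans.
  by apply: upr_le => g [].
rewrite big_const_seq iter_addr addr0 -[X in X <= _]mulr_natl ler_wpM2r ?expR_ge0 //.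
rewrite ler_nat count_predT -cardE; apply: leq_trans (card_outs f None) _.
exact: leq_subr.
Qed.

(** * Forced sets of losing positions *)

(** Sequences rather than sets make the weighted sum over all choices factor over the entries of
    [l]. *)
Fixpoint child_choices (m n d : nat) (f : outcome m n d) (l : seq (node m n)) :
    seq (seq (node m n)) :=
  if l is x :: l' then
    [seq y :: c | y <- enum (outs f x), c <- child_choices f l']
  else [:: [::]].

Definition succs3 (m n d : nat) (f : outcome m n d) (c : seq (node m n)) :
  seq (node m n) := enum (succs f (succs f (succs f [set x in c]))).

(* The candidates for the set of losing positions at the level 4 D + 1 that the
   sludge can force: one child is chosen below each node of the level 4 D. *)
Fixpoint choice_sets (m n d : nat) (f : outcome m n d) (D : nat) :
    seq (seq (node m n)) :=
  if D is D'.+1 then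
    flatten [seq (if (4 * size c <= size (succs3 f c))%N
                  then child_choices f (succs3 f c) else [::]) | c <- choice_sets f D']
  else child_choices f [:: None].

Lemma child_choicesP (m n d : nat) (f : outcome m n d) l c :
  c \in child_choices f l -> size c = size l /\
  forall y, y \in c -> exists2 x, x \in l & y \in outs f x.
Proof.
elim: l c => [|x l IHl] c /=; first by rewrite inE => /eqP ->.
case/allpairsP => -[y c'] /= [yx /IHl[sc' Hc'] ->]; split; first by rewrite /= sc'.
move=> z; rewrite inE => /predU1P[->|/Hc'[x' x'l zx']].
  by exists x; [rewrite inE eqxx|move: yx; rewrite mem_enum].
by exists x'; rewrite // inE x'l orbT.
Qed.

Lemma map_child_choices (m n d : nat) (f : outcome m n d) l (g : node m n -> node m n) :
  (forall x, x \in l -> g x \in outs f x) -> [seq g x | x <- l] \in child_choices f l.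
Proof.
elim: l => [|x l IHl] gl /=; first by rewrite inE.
apply/allpairsP; exists (g x, [seq g x | x <- l]); split=> //=.
  by rewrite mem_enum gl ?inE ?eqxx.
by apply: IHl => y yl; apply: gl; rewrite inE yl orbT.
Qed.

Lemma succs3_level (m n d : nat) (f : outcome m n d) c i :
  (forall x, x \in c -> level x = i) -> forall y, y \in succs3 f c -> level y = i.+3.
Proof.
move=> lc y; rewrite mem_enum; do 3 apply: succs_level.
by move=> x; rewrite inE; exact: lc.
Qed.

Lemma choice_setsP (m n d : nat) (f : outcome m n d) D c :
  c \in choice_sets f D -> (size c <= d.-1 ^ (3 * D))%N /\
  forall y, y \in c -> level y = (4 * D).+1.
Proof.
elim: D c => [|D IHD] c.
  rewrite -[choice_sets f 0]/(child_choices f [:: None]) => /child_choicesP[-> H]; split=> // y /H[x].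
  by rewrite inE => /eqP ->; rewrite inE => /rdag_edge_level ->.
rewrite /= => /flatten_mapP[c' /IHD[sc' lc']]; case: ifP => // _ /child_choicesP[sc H].
split; last first.
  move=> y /H[x /(succs3_level lc') lx]; rewrite inE => /rdag_edge_level ->.
  by rewrite lx; lia.
pose H1 : {set node m n} := [set x in c'].
have l1 x : x \in H1 -> level x = (4 * D).+1 by rewrite inE => /lc'.
have l2 := succs_level (f := f) l1; have l3 := succs_level (f := f) l2.
have cH1 : (#|H1| <= size c')%N by rewrite cardsE card_size.
have s3 : size (succs3 f c') = #|succs f (succs f (succs f H1))| by rewrite /succs3 -cardE.
have c2 : (#|succs f H1| <= d.-1 * #|H1|)%N.
  by apply: card_succs_le => x /l1 ->.
have c3 : (#|succs f (succs f H1)| <= d.-1 * #|succs f H1|)%N.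
  by apply: card_succs_le => x /l2 ->.
have c4 : (#|succs f (succs f (succs f H1))| <= d.-1 * #|succs f (succs f H1)|)%N.
  by apply: card_succs_le => x /l3 ->.
rewrite sc s3 mulnS expnD !expnSr expn0 mul1n -!mulnA; apply: leq_trans c4 _.
rewrite leq_mul2l; apply/orP; right; apply: leq_trans c3 _.
rewrite leq_mul2l; apply/orP; right; apply: leq_trans c2 _.
by rewrite leq_mul2l (leq_trans cH1 sc') orbT.
Qed.

Lemma child_choices_agree (m n d : nat) (f f' : outcome m n d) k l :
  (forall s, (level s.1 < k)%N -> f s = f' s) ->
  (forall x, x \in l -> (level x < k)%N) ->
  child_choices f l = child_choices f' l.
Proof.
move=> ff'; elim: l => [//|x l IHl] ll /=.
rewrite (outs_agree ff') ?IHl // => [y yl|]; last by rewrite ll ?inE ?eqxx.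
by rewrite ll // inE yl orbT.
Qed.

Lemma choice_sets_agree (m n d : nat) (f f' : outcome m n d) k D :
  (forall s, (level s.1 < k)%N -> f s = f' s) -> (4 * D < k)%N ->
  choice_sets f D = choice_sets f' D.
Proof.
move=> ff'; elim: D => [|D IHD] Dk.
  by apply: (child_choices_agree ff') => x; rewrite inE => /eqP ->.
rewrite /= -IHD; last by lia.
congr flatten; apply/eq_in_map => c /choice_setsP[_ lc].
have l1 x : x \in [set x in c] -> level x = (4 * D).+1 by rewrite inE => /lc.
have [|eq3 _] := iter_succs_agree (h := 3) ff' _ l1; first lia.
have -> : succs3 f' c = succs3 f c by rewrite /succs3 -[RHS]/(enum (iter 3 (succs f) _)) eq3.
rewrite (child_choices_agree ff') // => x /(succs3_level lc) ->; lia.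
Qed.

Lemma sum_child_choices (R : realType) (m n d : nat) (f : outcome m n d) l (w : R) :
  0 <= w -> (forall x, x \in l -> (0 < level x)%N) ->
  \sum_(c <- child_choices f l) w ^+ size c <= (d.-1%:R * w) ^+ size l.
Proof.
move=> w0; elim: l => [|x l IHl] ll /=; first by rewrite big_seq1.
rewrite big_allpairs_dep /= (eq_bigr (fun=> w * \sum_(c <- child_choices f l) w ^+ size c)).
  rewrite big_const_seq iter_addr addr0 -[X in X <= _]mulr_natl exprS mulrA.
  rewrite ler_pM ?mulr_ge0 ?sumr_ge0 // => [c _||]; first exact: exprn_ge0.
    rewrite ler_wpM2r // ler_nat count_predT -cardE card_outs_le // ll //.
    by rewrite inE eqxx.
  by apply: IHl => y yl; rewrite ll // inE yl orbT.
by move=> y _; rewrite mulr_sumr; apply: eq_bigr => c _; rewrite exprS.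
Qed.

(** With x = d - 1, a candidate of size N is extended by at most x choices at each of at least 4 N
    nodes; the test in [choice_sets] supplies the 4 N. Its weight w^N thus becomes at most (x w)^(4
    N) <= w^N, so the sum does not grow with [D]. *)
Lemma sum_choice_sets (R : realType) (m n d : nat) (f : outcome m n d) D (w : R) :
  0 <= w -> d.-1%:R * w <= 1 -> (d.-1%:R * w) ^+ 4 <= w ->
  \sum_(c <- choice_sets f D) w ^+ size c <= d%:R * w.
Proof.
move=> w0 xw1 xw4; elim: D => [|D IHD].
  rewrite /= big_flatten big_map (eq_bigr (fun=> w)) => [|y _]; last by rewrite big_seq1 expr1.
  rewrite big_const_seq iter_addr addr0 -[X in X <= _]mulr_natl ler_wpM2r //.
  by rewrite ler_nat count_predT -cardE (leq_trans (card_outs f None)) ?leq_subr.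
rewrite /= big_flatten /= big_map; apply: le_trans IHD.
rewrite big_seq [X in _ <= X]big_seq; apply: ler_sum => c /choice_setsP[_ lc].
have xw0 : 0 <= d.-1%:R * w by rewrite mulr_ge0.
case: ifP => [c4|_]; last by rewrite big_nil exprn_ge0.
apply: le_trans (sum_child_choices _ w0 _) _ => [x /(succs3_level lc) -> //|].
apply: (@le_trans _ _ ((d.-1%:R * w) ^+ (4 * size c))).
  by apply: ler_wiXn2l => //; rewrite xw0 xw1.
by rewrite exprM lerXn2r ?nnegrE ?exprn_ge0.
Qed.

(** The quota may drop to d - 3 only at times t = 1 mod 4, when the sludge leaves a level 4 D. So
    the passage from level 4 D + 1 to 4 D + 5 has three full levels followed by one step in which a
    single losing child is kept. *)
Lemma loses_choice (m n d : nat) (f : outcome m n d) q j D : (2 < d)%N ->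
  (forall t, d - 3 <= q t)%N -> (forall t, t %% 4 != 1 -> d - 2 <= q t)%N ->
  (4 * D + 2 < j)%N -> ~~ wins (rdag_edge f) q j 0 None ->
  exists2 c, c \in choice_sets f D &
    [/\ uniq c, (4 ^ D <= size c)%N & losing f q j (4 * D).+1 [set x in c]].
Proof.
move=> d2 q3 q2 + root; have d1 : (1 < d)%N by rewrite ltnW.
elim: D => [|D IHD] Dj.
  have jE : j = j.-1.+1 by lia.
  rewrite jE in root; have [_ [y y0 ny]] := loses_some d2 (q3 1%N) root.
  exists [:: y].
    by apply/flatten_mapP; exists y; [rewrite mem_enum inE|rewrite inE].
  split=> // x xH; have -> : x = y by apply/eqP; move: xH; rewrite !inE.
  split.
  - by have /andP[] := rdag_edge_vertices y0.
  - exact: rdag_edge_level y0.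
  - by rewrite subn1.
have [|c cF [uc c4 L1]] := IHD; first lia.
set H := [set x in c] in L1; have cH : #|H| = size c by rewrite cardsE; apply/card_uniqP.
have nf2 : (d - 2 <= q (4 * D).+2)%N by apply: q2; lia.
have nf3 : (d - 2 <= q (4 * D).+3)%N by apply: q2; lia.
have nf4 : (d - 2 <= q (4 * D).+4)%N by apply: q2; lia.
have [|L2 _] := losing_succs d1 _ nf2 L1; first lia.
have [|L3 Hd3] := losing_succs d1 _ nf3 L2; first lia.
have [|L4 Hd4] := losing_succs d1 _ nf4 L3; first lia.
have c2 : #|succs f H| = (d.-1 * #|H|)%N by apply: card_losing_succs L1 => //; lia.
have c3 : #|succs f (succs f H)| = (d.-1 * #|succs f H|)%N.
  by apply: card_losing_succs L2 => //; lia.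
set H4 := succs f (succs f (succs f H)) in L4.
have free x : x \in H4 -> (indeg f x <= 2)%N /\ exists2 y, rdag_edge f x y
    & ~~ wins (rdag_edge f) q (j - (4 * D.+1).+1) (4 * D.+1).+1 y.
  move=> /L4[_ lx nx]; rewrite (_ : (4 * D.+1)%N = (4 * D).+4); last by lia.
  apply: loses_some => //.
  by rewrite -subSn ?subSS //; lia.
(* The size is multiplied by d - 1 twice and then by at least (d - 1) / 2, the nodes of level 4 D +
   4 having in-degree at most 2; and (d - 1)^3 >= 8. *)
have c4' : (4 * size c <= size (succs3 f c))%N.
  rewrite /succs3 -cardE -/H -/H4.
  have : (d.-1 * #|succs f (succs f H)| <= 2 * #|H4|)%N.
    by apply: card_succs_ge => [x /Hd4[_ -> //]|y /free[]].
  rewrite c3 c2 cH; move: d2 {c2 c3 Hd3 Hd4 free}; clear; move: (size c) #|H4| => a b d2.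
  have [e ->] : exists e, d = e.+3 by exists (d - 3)%N; lia.
  rewrite /= => ?; suff : (8 * a <= e.+2 * (e.+2 * (e.+2 * a)))%N by lia.
  by rewrite !mulnA leq_mul2r; apply/orP; right; nia.
pose g x := odflt x [pick y | rdag_edge f x y && ~~ wins (rdag_edge f) q (j - (4 * D.+1).+1) (4 * D.+1).+1 y].
have gP x : x \in H4 -> rdag_edge f x (g x) /\
    ~~ wins (rdag_edge f) q (j - (4 * D.+1).+1) (4 * D.+1).+1 (g x).
  move=> /free[_ [y xy ny]]; rewrite /g; case: pickP => [z /andP[] //|/(_ y)].
  by rewrite xy ny.
exists [seq g x | x <- succs3 f c].
  apply/flatten_mapP; exists c => //; rewrite c4'.
  by apply: map_child_choices => x; rewrite mem_enum => /gP[xgx _]; rewrite inE.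
have L5 : losing f q j (4 * D.+1).+1 [set x in [seq g x | x <- succs3 f c]].
  move=> y; rewrite inE => /mapP[x]; rewrite mem_enum => xH4 ->.
  have [xgx ngx] := gP x xH4; have [_ lx _] := L4 x xH4; split=> //.
    by have /andP[] := rdag_edge_vertices xgx.
  by rewrite (rdag_edge_level xgx) lx; lia.
split=> //; last by rewrite size_map expnS (leq_trans _ c4') // leq_mul2l c4 orbT.
(* The quota at the next time, 2 mod 4, is full again, so the chosen children have in-degree 1 and
   distinct parents have chosen distinct children. *)
have [||_ Hd5] := losing_succs d1 _ _ L5; [lia|by apply: q2; lia|].
rewrite map_inj_in_uniq ?enum_uniq // => x x' xS xS' gxx.
have inH4 z : z \in succs3 f c -> z \in H4 by rewrite mem_enum.
have [xg _] := gP x (inH4 x xS); have [xg' _] := gP x' (inH4 x' xS').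
have [|dg _] := Hd5 (g x); first by rewrite inE map_f.
apply: (good_edge_inj (f := f) (y := g x)); rewrite /good_edge ?dg ?eqxx ?andbT //.
by rewrite gxx.
Qed.

(** Level 4 D + 2 is resampled: the (d - 1)^2 |c| slots of the successors of a candidate [c] must be
    isolated, with probability at most (w delta)^|c|. The factor w pays for the number of candidates
    and delta^|c| <= delta^(4^D) is the gain. *)
Lemma upr_loses_choice (R : realType) (m n d : nat) q j D (w delta : R) (Pd : nat -> Prop) :
  (0 < n)%N -> (2 < d)%N -> (j <= m)%N ->
  (forall t, d - 3 <= q t)%N -> (forall t, t %% 4 != 1 -> d - 2 <= q t)%N ->
  (4 * D + 3 < j)%N ->
  0 <= w -> d.-1%:R * w <= 1 -> (d.-1%:R * w) ^+ 4 <= w -> 0 <= delta <= 1 ->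
  (forall E N, Pd E -> (N <= d.-1 ^ (3 * D + 2))%N ->
     expR (- ((E - N)%N%:R * (d.-1 ^ 2)%:R / n%:R)) <= w * delta) ->
  uniform_pr R (fun f : outcome m n d => Pd #|generated f (4 * D + 2)| /\
     ~~ wins (rdag_edge f) q j 0 None) <= delta ^+ (4 ^ D) * (d%:R * w).
Proof.
move=> n0 d2 jm q3 q2 Dj w0 xw1 xw4 /andP[dl0 dl1] HE.
have d1 : (1 < d)%N by rewrite ltnW.
pose K := (4 * D + 2)%N.
pose B (f : outcome m n d) (c : seq (node m n)) := slots_of f K (succs f [set x in c]).
pose rel f (c : seq (node m n)) := (4 ^ D <= size c)%N && (#|B f c| == d.-1 ^ 2 * size c)%N.
pose Fam f := [seq B f c | c <- choice_sets f D & rel f c].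
apply: (@le_trans _ _ (uniform_pr R (fun f => Pd #|generated f K| /\
   exists2 b, b \in Fam f & forall s, s \in b -> indegree f (generated f K) (f s) = 1%N))).
  apply: upr_le => f [PE root]; split=> //.
  have [|c cF [uc c4 L1]] := loses_choice d2 q3 q2 _ root (D := D); first lia.
  have cH : #|[set x in c]| = size c by rewrite cardsE; apply/card_uniqP.
  have nf2 : (d - 2 <= q (4 * D).+2)%N by apply: q2; lia.
  have nf3 : (d - 2 <= q (4 * D).+3)%N by apply: q2; lia.
  have nf4 : (d - 2 <= q (4 * D).+4)%N by apply: q2; lia.
  have [|L2 _] := losing_succs d1 _ nf2 L1; first lia.
  have [||cB iB] := losing_slots d1 jm _ _ nf3 nf4 L2; [lia|lia|].
  have KE : K = (4 * D).+2 by rewrite /K addn2.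
  exists (B f c); last by rewrite /B KE.
  apply: map_f; rewrite mem_filter cF /rel c4 /B KE cB andbT /=.
  by rewrite (@card_losing_succs _ _ _ _ q j (4 * D).+1) ?cH ?mulnA //; lia.
have FamE f g : Fam (resample K f g) = Fam f.
  have low s : (level s.1 < K)%N -> resample K f g s = f s by exact: resample_low.
  rewrite /Fam (choice_sets_agree low); last by rewrite /K; lia.
  have BE c : c \in choice_sets f D -> B (resample K f g) c = B f c.
    move=> /choice_setsP[_ lc]; rewrite /B /slots_of generated_resample.
    by rewrite (succs_agree low) // => x; rewrite inE => /lc ->; rewrite /K; lia.
  rewrite (_ : [seq c <- _ | rel (resample K f g) c] = [seq c <- choice_sets f D | rel f c]).
    by apply/eq_in_map => c; rewrite mem_filter => /andP[_ /BE].
  by apply: eq_in_filter => c /BE; rewrite /rel => ->.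
apply: upr_isolated_family => // [|f b /mapP[c _ ->]|f PE].
- by rewrite !mulr_ge0 ?exprn_ge0.
- by apply/fintype.subsetP => s; rewrite inE => /andP[].
apply: (@le_trans _ _ (delta ^+ (4 ^ D) * \sum_(c <- choice_sets f D) w ^+ size c)); last first.
  by rewrite ler_wpM2l ?exprn_ge0 // sum_choice_sets.
rewrite /Fam big_map big_filter mulr_sumr big_mkcond big_seq [X in _ <= X]big_seq.
apply: ler_sum => c /choice_setsP[sc _]; case: ifP => [/andP[c4 /eqP cB]|_]; last first.
  by rewrite mulr_ge0 ?exprn_ge0.
have cB' : (#|B f c| <= d.-1 ^ (3 * D + 2))%N.
  by rewrite cB expnD mulnC leq_mul2r sc orbT.
apply: (@le_trans _ _ ((w * delta) ^+ size c)); last first.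
  rewrite exprMn mulrC ler_wpM2r ?exprn_ge0 //.
  by apply: ler_wiXn2l => //; rewrite dl0 dl1.
apply: le_trans (lerXn2r _ _ _ (HE _ _ PE cB')); rewrite ?nnegrE ?expR_ge0 ?mulr_ge0 //.
rewrite -expRM_natl ler_expR mulrN lerN2; set e := (_ - _)%N; rewrite cB natrM.
by rewrite le_eqVlt; apply/orP; left; apply/eqP; field; rewrite pnatr_eq0 -lt0n.
Qed.

(** * Growth of the levels *)

(** The series bound exp z >= z^(k+1) / (k+1)! with z = u ln a has one power of u to spare, and this
    power absorbs the constant once u >= [K]. *)
Lemma exp_dominates (R : realType) (a C : R) k : 1 < a ->
  exists U : nat, forall u, (U <= u)%N -> C * u%:R ^+ k <= a ^+ u.
Proof.
move=> a1; have la : 0 < ln a by rewrite ln_gt0.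
pose K := `|C| * (k.+1)`!%:R / ln a ^+ k.+1.
exists (Num.trunc K).+1 => u Uu.
have u0 : 0 < u%:R :> R by rewrite ltr0n (leq_trans _ Uu).
have Ku : K <= u%:R.
  apply: (@le_trans _ _ (Num.trunc K).+1%:R); last by rewrite ler_nat.
  exact/ltW/truncnS_gt.
have -> : a ^+ u = expR (u%:R * ln a) by rewrite expRM_natl lnK ?posrE // (lt_trans ltr01).
apply: (@le_trans _ _ ((u%:R * ln a) ^+ k.+1 / (k.+1)`!%:R)); last first.
  apply: le_trans (expR_ge1Dxn k _); last by rewrite mulr_ge0 // ltW.
  by rewrite lerDr.
rewrite exprMn exprS -mulrA -mulrA mulrC -mulrA.
have f0 : 0 < ((k.+1)`!%:R : R) by rewrite ltr0n fact_gt0.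
have l0 : 0 < ln a ^+ k.+1 by rewrite exprn_gt0.
rewrite mulrCA ler_wpM2l ?exprn_ge0 //.
move: Ku; rewrite /K ler_pdivrMr // => Ku.
by rewrite mulrA ler_pdivlMr // (le_trans _ Ku) // ler_wpM2r ?(ltW f0) // ler_norm.
Qed.

(** A polynomial stand-in for (1 - t)^E <= exp(- E t), which keeps the density estimates inside
    ordered-field arithmetic. *)
Lemma expr_1B_le (R : realFieldType) (t : R) E : 0 <= t <= 1 ->
  (1 - t) ^+ E * (1 + E%:R * t + (E%:R * t) ^+ 2 / 2) <= 1.
Proof.
move=> /andP[t0 t1]; elim: E => [|E IHE].
  by rewrite expr0 !mul0r expr0n /= mul0r !addr0 mulr1.
rewrite exprSr -mulrA; apply: le_trans IHE; rewrite ler_wpM2l ?exprn_ge0 ?subr_ge0 //.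
have : 0 <= E%:R * t by rewrite mulr_ge0.
rewrite -[E.+1%:R]natr1 [(E%:R + 1) * t]mulrDl mul1r; move: (E%:R * t) => a a0.
have h1 : 0 <= t * (a + t) ^+ 2 by rewrite mulr_ge0 ?sqr_ge0.
have h2 : 0 <= t * t by rewrite mulr_ge0.
rewrite -subr_ge0 [X in 0 <= X](_ : _ = (t * t + t * (a + t) ^+ 2) / 2); last by field.
by rewrite divr_ge0 ?addr_ge0.
Qed.

(* y is the density of the edges entering a layer; the next density is at least
   d (1 - p) - y, where p is the fraction of missed nodes. *)
Lemma density_small (R : realFieldType) (d y p : R) : 0 <= y -> 0 <= d ->
  p * (1 + y + y ^+ 2 / 2) <= 1 -> d * (y - y ^+ 2 / 2) <= d * (1 - p).
Proof.
move=> y0 d0 py; rewrite ler_wpM2l //; have q0 : 0 < 1 + y + y ^+ 2 / 2.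
  by have := sqr_ge0 y; lra.
rewrite -(ler_pM2r q0) [X in _ <= X]mulrBl mul1r.
have : 0 <= y ^+ 2 * y ^+ 2 by rewrite mulr_ge0 ?sqr_ge0.
move: py; move: (p * _) => P; rewrite !expr2; nra.
Qed.

(** Of the margin 33/100, the part 3/100 is reserved for the random fluctuation, so a density of at
    least 3/10 stays so. For y <= 2 the bound d >= 3 is enough; beyond, d >= y + 1 is used. *)
Lemma density_large (R : realFieldType) (d y p : R) : 3 <= d -> 3/10 <= y <= d - 1 ->
  p * (1 + y + y ^+ 2 / 2) <= 1 -> 33/100 + y <= d * (1 - p).
Proof.
move=> d3 /andP[y0 yd] py; have q0 : 0 < 1 + y + y ^+ 2 / 2.
  by have := sqr_ge0 y; lra.
rewrite -(ler_pM2r q0) -[X in _ <= X]mulrA [(1 - p) * _]mulrBl mul1r.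
apply: (@le_trans _ _ (d * (y + y ^+ 2 / 2))); last by rewrite ler_wpM2l; lra.
have yy : 0 <= y + y ^+ 2 / 2 by have := sqr_ge0 y; lra.
have [y2|y2] := leP y 2.
  apply: (@le_trans _ _ (3 * (y + y ^+ 2 / 2))); last by rewrite ler_wpM2r.
  rewrite !expr2; have : 0 <= (y - 3/10) * (2 - y) by rewrite mulr_ge0; lra.
  have : 0 <= (y - 3/10) * (2 - y) * y by rewrite !mulr_ge0; lra.
  nra.
apply: (@le_trans _ _ ((y + 1) * (y + y ^+ 2 / 2))); last by rewrite ler_wpM2r //; lra.
rewrite !expr2; nra.
Qed.

(** This reduces one level of growth to a deterministic inequality: the image has more than n (1 -
    p) - lam elements outside a rare event, and the next level has at least d times the image minus
    [E] slots. After the source, E <= (d - 1) n because at most n nodes generate the level. *)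
Lemma upr_step (R : realType) (m n d k : nat) (lo lo' : R) (lam : nat -> R) (eps : R) :
  (1 < n)%N -> (k < m)%N -> 0 <= eps ->
  (forall E : nat, lo <= E%:R -> (E <= d * d.-1 ^ k)%N -> ((0 < k)%N -> (E <= d.-1 * n)%N) ->
     [/\ 0 < lam E, E%:R / lam E ^+ 2 <= eps & forall p : R, 0 <= p ->
        p * (1 + E%:R / n%:R + (E%:R / n%:R) ^+ 2 / 2) <= 1 ->
        lo' <= d%:R * (n%:R * (1 - p) - lam E) - E%:R]) ->
  uniform_pr R (fun f : outcome m n d =>
    lo <= #|generated f k|%:R /\ ~ (lo' <= #|generated f k.+1|%:R)) <= eps.
Proof.
move=> n1 km eps0 H.
pose Pd E := lo <= E%:R /\ (E <= d * d.-1 ^ k)%N /\ ((0 < k)%N -> (E <= d.-1 * n)%N).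
apply: le_trans (@upr_image_generated R m n d k Pd lam eps n1 eps0 _); last first.
  by move=> E [loE [Ek En]]; have [] := H E loE Ek En.
apply: upr_le => f [loE nlo'].
have Ek := card_generated_le f k.
have En : (0 < k)%N -> (#|generated f k| <= d.-1 * n)%N.
  case: k {km H Pd loE nlo' Ek} => // k _; apply: leq_trans (card_generatedS_le f k) _.
  by rewrite leq_mul2l -[X in (_ <= X)%N](card_ord n) max_card orbT.
split=> //; rewrite leNgt; apply/negP => im.
have [lam0 _ /(_ ((1 - n%:R^-1) ^+ #|generated f k|))] := H _ loE Ek En.
have n0 : 0 < n%:R :> R by rewrite ltr0n ltnW.
have inv01 : 0 <= (n%:R^-1 : R) <= 1.
  by rewrite invr_ge0 ltW //= invf_le1 // ler1n ltnW.
have p0 : 0 <= (1 - n%:R^-1 : R) ^+ #|generated f k|.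
  by rewrite exprn_ge0 // subr_ge0; case/andP: inv01.
move/(_ p0 (expr_1B_le _ inv01)) => lo'E; apply: nlo'; apply: le_trans lo'E _.
rewrite lerBlDr -natrD; apply: (@le_trans _ _ (d * #|f @: generated f k|)%:R); last first.
  by rewrite ler_nat card_generatedS_ge.
by rewrite natrM ler_wpM2l // ltW.
Qed.

Lemma upr_chain (R : realType) (m n d : nat) (lo : nat -> R) (eps eps0 : R) a c :
  uniform_pr R (fun f : outcome m n d => ~ (lo a <= #|generated f a|%:R)) <= eps0 ->
  (forall i, (i < c)%N -> uniform_pr R (fun f : outcome m n d =>
     lo (a + i)%N <= #|generated f (a + i)|%:R /\
     ~ (lo (a + i).+1 <= #|generated f (a + i).+1|%:R)) <= eps) ->
  uniform_pr R (fun f : outcome m n d =>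
     ~ (lo (a + c)%N <= #|generated f (a + c)|%:R)) <= eps0 + c%:R * eps.
Proof.
move=> start; elim: c => [|c IHc] step; first by rewrite addn0 mul0r addr0.
rewrite -natr1 mulrDl mul1r addrA.
apply: le_trans (lerD (IHc _) (step c (ltnSn c))); last by move=> i ic; apply: step; rewrite ltnW.
apply: le_trans (upr_or _ _ _); apply: upr_le => f; rewrite addnS => nlo.
by have [lo1|lo1] := pselect (lo (a + c)%N <= #|generated f (a + c)|%:R); [right|left].
Qed.

(* Up to level u the DAG is a tree.  Afterwards the relative losses are summable,
   because the densities e k grow geometrically. *)
Lemma upr_growth_early (R : realType) (m n d u : nat) :
  (2 < d)%N -> (0 < u)%N -> (4 * u <= m)%N -> (16 * d * d.-1 ^ (4 * u) <= n)%N ->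
  uniform_pr R (fun f : outcome m n d =>
    ~ ((d * d.-1 ^ (4 * u))%:R / 2 <= (#|generated f (4 * u)|%:R : R))) <=
  u%:R * ((d * d.-1 ^ u)%:R ^+ 2 / n%:R) +
  (3 * u)%:R * (2 * (32 * u%:R) ^+ 2 / (d * d.-1 ^ u)%:R).
Proof.
move=> d2 u0 um nbig; set x := d.-1 in nbig *; have x2 : (2 <= x)%N by rewrite /x; lia.
have n1 : (1 < n)%N.
  by apply: leq_trans nbig; have := expn_gt0 x (4 * u); rewrite (ltnW x2) => ?; nia.
have n0 : 0 < n%:R :> R by rewrite ltr0n ltnW.
have u0' : 0 < u%:R :> R by rewrite ltr0n.
(* Fluctuations cost a fraction 2 [th] on each of 3 u levels, 3/16 in all. The collision loss e k is
   at most e k.+1 - e k, so it telescopes and stays below e (4 u) <= 1/16. Hence [rho] never falls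
   below 1/2. *)
pose th : R := (32 * u%:R)^-1.
have th0 : 0 < th by rewrite invr_gt0 mulr_gt0.
have thu : th * u%:R = 1 / 32 by rewrite /th; field; rewrite gt_eqF.
pose e k : R := (d * x ^ k)%:R / n%:R.
have e0 k : 0 <= e k by rewrite divr_ge0.
have eS k : 2 * e k <= e k.+1.
  rewrite /e expnS mulnCA [X in _ <= X / _]natrM -[X in _ <= X]mulrA; by rewrite ler_wpM2r ?ler_nat.
pose rho k : R := 1 - e k - 2 * th * (k - u)%N%:R.
pose lo k : R := (d * x ^ k)%:R * rho k.
have le_e k k' : (k <= k')%N -> e k <= e k'.
  move=> kk; rewrite /e ler_wpM2r ?invr_ge0 ?ler_nat ?leq_mul2l ?leq_pexp2l ?orbT //.
  exact: ltnW.
have e4u : e (4 * u)%N <= 1 / 16.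
  have : (16 * (d * x ^ (4 * u)))%:R <= n%:R :> R by rewrite ler_nat mulnA.
  by rewrite natrM /e ler_pdivrMr //; lra.
have rho_half k : (k <= 4 * u)%N -> 1 / 2 <= rho k.
  move=> k4; have := le_e _ _ k4; rewrite /rho.
  have : th * (k - u)%N%:R <= th * (3 * u)%N%:R.
    by rewrite ler_wpM2l ?(ltW th0) // ler_nat; lia.
  rewrite natrM mulrCA thu; lra.
have rho_le1 k : rho k <= 1.
  have : 0 <= th * (k - u)%N%:R by rewrite mulr_ge0 ?(ltW th0).
  by have := e0 k; rewrite /rho; lra.
have eq4u : (u + 3 * u = 4 * u)%N by lia.
apply: (@le_trans _ _ (uniform_pr R (fun f : outcome m n d =>
   ~ (lo (u + 3 * u)%N <= #|generated f (u + 3 * u)|%:R)))).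
  apply: upr_le => f; rewrite eq4u; apply: contra_not; apply: le_trans.
  by rewrite ler_wpM2l // -[2^-1]mul1r rho_half.
apply: upr_chain => [|i iu].
  apply: le_trans (upr_tree R m u (ltnW n1) (ltnW d2)); apply: upr_le => f.
  apply: contra_not => /(card_generated_tree (leq_trans (leq_pmull u _) um)) -> //.
  by rewrite ler_piMr.
set k := (u + i)%N; have k4 : (k < 4 * u)%N by rewrite /k; lia.
have xk0 : (0 < d * x ^ k)%N by rewrite muln_gt0 expn_gt0 (ltnW x2) (ltn_trans _ d2).
have km : (k < m)%N := leq_trans k4 um.
have eps0 : 0 <= 2 * (32 * u%:R) ^+ 2 / (d * x ^ u)%:R :> R.
  by rewrite divr_ge0 ?mulr_ge0 ?exprn_ge0.
(* A deviation proportional to [E] gives an error (32 u)^2 / E, which is largest at the smallest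
   level, u. *)
apply: (@upr_step R m n d k (lo k) (lo k.+1) (fun E => th * E%:R) _ n1 km eps0).
move=> E loE Ek _.
have E_half : (d * x ^ k)%:R / 2 <= E%:R :> R.
  apply: le_trans loE; rewrite ler_wpM2l // -[2^-1]mul1r rho_half //; exact: ltnW.
have E0 : 0 < E%:R :> R.
  by apply: lt_le_trans E_half; rewrite divr_gt0 // ltr0n.
split; first by rewrite mulr_gt0.
- have xu0 : 0 < (d * x ^ u)%:R :> R.
    by rewrite ltr0n muln_gt0 expn_gt0 (ltnW x2) (ltn_trans _ d2).
  have xu : (d * x ^ u)%:R <= 2 * E%:R :> R.
    have : (d * x ^ u)%:R <= (d * x ^ k)%:R :> R.
      by rewrite ler_nat leq_mul2l leq_pexp2l ?orbT ?leq_addr // ltnW.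
    by move: E_half; lra.
  have -> : E%:R / (th * E%:R) ^+ 2 = (32 * u%:R) ^+ 2 / E%:R.
    by rewrite /th; field; rewrite !gt_eqF.
  rewrite ler_pdivrMr // mulrAC ler_pdivlMr //.
  rewrite [X in _ <= X](_ : _ = (32 * u%:R) ^+ 2 * (2 * E%:R)); last by ring.
  by rewrite ler_wpM2l // exprn_ge0.
move=> p p0 pE; set y := E%:R / n%:R in pE *.
have Ey : E%:R = n%:R * y by rewrite /y mulrCA mulfV ?mulr1 // gt_eqF.
have y0 : 0 <= y by rewrite divr_ge0.
have ye : y <= e k by rewrite /y /e ler_wpM2r ?invr_ge0 // ler_nat.
have small := density_small y0 (ler0n R d) pE.
have dx : d%:R = x%:R + 1 :> R by rewrite natr1 /x prednK // (ltn_trans _ d2).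
have x2' : 2 <= x%:R :> R by rewrite ler_nat.
have grow : x%:R * E%:R * (1 - (e k + 2 * th)) <= d%:R * (n%:R * (1 - p) - th * E%:R) - E%:R.
  apply: (@le_trans _ _ (n%:R * (d%:R * (y - y ^+ 2 / 2)) - d%:R * th * E%:R - E%:R)).
    rewrite Ey; rewrite dx expr2; move: (n%:R : R) n0 (x%:R : R) x2' => N N0 X X2.
    rewrite -subr_ge0 [X in 0 <= X](_ : _ = N * y * (X * (e k - y / 2) - y / 2 + th * (X - 1))); last by field.
    rewrite mulr_ge0 ?mulr_ge0 ?(ltW N0) // addr_ge0 //; last by rewrite mulr_ge0 ?(ltW th0) //; lra.
    by have := e0 k; nra.
  rewrite -subr_ge0 [X in 0 <= X](_ : _ = n%:R * (d%:R * (1 - p)) -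
    n%:R * (d%:R * (y - y ^+ 2 / 2))); last by ring.
  by rewrite subr_ge0 ler_wpM2l // ltW.
apply: le_trans grow.
apply: (@le_trans _ _ (x%:R * (d * x ^ k)%:R * (rho k * (1 - (e k + 2 * th))))); last first.
  rewrite mulrA ler_wpM2r //.
    have := le_e k (4 * u)%N (ltnW k4).
    have : th * 1 <= th * u%:R by rewrite ler_wpM2l ?(ltW th0) // ler1n.
    by rewrite thu; lra.
  by rewrite -mulrA ler_wpM2l.
rewrite -natrM mulnCA -expnS /lo ler_wpM2l //.
have -> : rho k.+1 = rho k - (e k.+1 - e k) - 2 * th.
  by rewrite /rho subSn ?leq_addr // -natr1; ring.
have := eS k; have := rho_le1 k; have := rho_half k (ltnW k4); have := e0 k.
by move: th0; nra.
Qed.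

(** For a density y <= 3/10, d (1 - p) >= 3 (y - y^2 / 2) >= 2.55 y; after subtracting y and a
    fluctuation of at most y / 10, a factor above 6/5 remains. Once 3/10 is reached it is kept,
    whence the minimum. *)
Lemma upr_growth_late (R : realType) (m n d a c : nat) (c0 : R) :
  (2 < d)%N -> (1 < n)%N -> (0 < a)%N -> (a + c <= m)%N -> 0 < c0 <= 3 / 10 ->
  uniform_pr R (fun f : outcome m n d =>
    ~ (n%:R * Num.min (3 / 10) (c0 * (6 / 5) ^+ c) <= (#|generated f (a + c)|%:R : R))) <=
  uniform_pr R (fun f : outcome m n d => ~ (n%:R * c0 <= (#|generated f a|%:R : R))) +
  c%:R * (100 * d%:R ^+ 3 / (c0 ^+ 2 * n%:R)).
Proof.
move=> d2 n1 a0 acm /andP[c00 c03].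
have n0 : 0 < n%:R :> R by rewrite ltr0n ltnW.
have d3 : 3 <= d%:R :> R by rewrite ler_nat.
pose lo k : R := n%:R * Num.min (3 / 10) (c0 * (6 / 5) ^+ (k - a)).
have loE c' : n%:R * Num.min (3 / 10) (c0 * (6 / 5) ^+ c') = lo (a + c')%N.
  by rewrite /lo addKn.
rewrite loE (_ : n%:R * c0 = lo a); last first.
  by rewrite /lo subnn expr0 mulr1 min_r.
apply: upr_chain => // i ic; set k := (a + i)%N.
have km : (k < m)%N by rewrite /k; lia.
have k0 : (0 < k)%N by rewrite /k addn_gt0 a0.
have q0 : 0 < c0 ^+ 2 * n%:R by rewrite mulr_gt0 // exprn_gt0.
have eps0 : 0 <= 100 * d%:R ^+ 3 / (c0 ^+ 2 * n%:R).
  by rewrite divr_ge0 ?(ltW q0) // mulr_ge0 ?exprn_ge0.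
(* Multiplied by d in the recursion, this deviation costs c0 / 10 in density, at most a tenth of the
   current one. *)
pose lam : R := n%:R * c0 / (10 * d%:R).
have lam0 : 0 < lam by rewrite divr_gt0 ?mulr_gt0 //; lra.
apply: (@upr_step R m n d k (lo k) (lo k.+1) (fun=> lam) _ n1 km eps0).
move=> E loE' _ /(_ k0) En; split=> //.
  have -> : E%:R / lam ^+ 2 = E%:R * (100 * d%:R ^+ 2 / n%:R) / (c0 ^+ 2 * n%:R).
    by rewrite /lam; field; rewrite !gt_eqF //; lra.
  rewrite ler_wpM2r ?invr_ge0 ?(ltW q0) //.
  have {}En : E%:R <= d%:R * n%:R :> R.
    by rewrite -natrM ler_nat (leq_trans En) // leq_mul2r leq_pred orbT.
  apply: (@le_trans _ _ (d%:R * n%:R * (100 * d%:R ^+ 2 / n%:R))).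
    by rewrite ler_wpM2r // divr_ge0 // mulr_ge0 ?exprn_ge0.
  by rewrite le_eqVlt; apply/orP; left; apply/eqP; field; rewrite gt_eqF.
move=> p p0 pE; set y := E%:R / n%:R in pE.
have Ey : E%:R = n%:R * y by rewrite /y mulrCA mulfV ?mulr1 // gt_eqF.
have pow1 l : 1 <= (6 / 5 : R) ^+ l by rewrite exprn_ege1 //; lra.
have y_lo : Num.min (3 / 10) (c0 * (6 / 5) ^+ (k - a)) <= y.
  by rewrite -(ler_pM2l n0) -Ey.
have yc : c0 <= y.
  apply: le_trans y_lo; rewrite le_min c03 /=.
  by rewrite -[X in X <= _]mulr1 ler_wpM2l // ltW.
have yd : y <= d%:R - 1.
  rewrite /y ler_pdivrMr // (_ : d%:R - 1 = d.-1%:R); last first.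
    by rewrite -subn1 natrB // ltnW // ltnW.
  by rewrite -natrM ler_nat.
rewrite Ey (_ : d%:R * _ - _ = n%:R * (d%:R * (1 - p) - c0 / 10 - y)); last first.
  by rewrite /lam; field; lra.
rewrite /lo ler_wpM2l ?(ltW n0) //.
have [y3|y3] := leP y (3 / 10); last first.
  rewrite ge_min; apply/orP; left.
  have y3d : 3 / 10 <= y <= d%:R - 1 by rewrite (ltW y3).
  by have := density_large d3 y3d pE; lra.
have y0 : 0 <= y by rewrite (le_trans _ yc) // ltW.
have d0 : 0 <= d%:R :> R by [].
have sm := density_small y0 d0 pE.
have : 3 * (y - y ^+ 2 / 2) <= d%:R * (y - y ^+ 2 / 2).
  by rewrite ler_wpM2r // expr2; nra.
have yy : y ^+ 2 <= 3 / 10 * y by rewrite expr2 ler_wpM2r.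
move=> d3y; apply: (@le_trans _ _ (6 / 5 * y)); last by lra.
apply: (@le_trans _ _ (6 / 5 * Num.min (3 / 10) (c0 * (6 / 5) ^+ (k - a)))); last first.
  by rewrite ler_wpM2l //; lra.
rewrite minr_pMr ?le_min; last by lra.
have kS : (k.+1 - a)%N = (k - a).+1 by exact: subSn (leq_addr i a).
rewrite kS exprS mulrCA !ge_min lexx orbT andbT; apply/orP; left; lra.
Qed.

(** The value 21/100 is three quarters of the exponent 28/100 of the weight w used later: (x w)^4 <=
    w amounts to (x exp(- 0.21 x^2))^4 <= 1. *)
Lemma x_le_expR (R : realType) (x c : R) : 21 / 100 <= c -> 2 <= x ->
  x * expR (- (c * x ^+ 2)) <= 1.
Proof.
move=> c21 x2; rewrite expRN ler_pdivrMr ?expR_gt0 // mul1r.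
apply: (@le_trans _ _ (expR (21 / 200 * x ^+ 2) ^+ 2)); last first.
  rewrite -expRM_natl ler_expR mulrA ler_wpM2r ?sqr_ge0 //; lra.
have h : 1 + 21 / 200 * x ^+ 2 <= expR (21 / 200 * x ^+ 2) := expR_ge1Dx _.
have x0 : 0 <= x ^+ 2 := sqr_ge0 x.
apply: (@le_trans _ _ ((1 + 21 / 200 * x ^+ 2) ^+ 2)); last first.
  by rewrite lerXn2r ?nnegrE ?expR_ge0 //; lra.
have x4 : 4 <= x ^+ 2 by rewrite expr2; nra.
have : 4 * x ^+ 2 <= x ^+ 2 * x ^+ 2 by rewrite ler_wpM2r.
have := sqr_ge0 (x - 2); rewrite sqrrB; move: (x ^+ 2) x0 x4 => z z0 z4.
rewrite [(1 + _) ^+ 2]expr2; nra.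
Qed.

Lemma upr_loses_dense (R : realType) (n m d j D : nat) (q : nat -> nat) :
  (2 < d)%N -> (0 < n)%N -> (100 * d.-1 ^ (3 * D + 2) <= n)%N ->
  (4 * D + 3 < j)%N -> (j <= m)%N ->
  (forall t, d - 3 <= q t)%N -> (forall t, t %% 4 != 1 -> d - 2 <= q t)%N ->
  uniform_pr R (fun f : outcome m n d =>
     3 / 10 * n%:R <= (#|generated f (4 * D + 2)|%:R : R) /\
     ~~ wins (rdag_edge f) q j 0 None) <= 100 * d%:R / 4 ^+ D.
Proof.
move=> d2 n0' n100 Dj jm q3 q2; pose x := d.-1.
have x2' : 2 <= x%:R :> R by rewrite ler_nat -ltnS prednK // (ltn_trans _ d2).
have n0 : 0 < n%:R :> R by rewrite ltr0n.
(* The level has at least 0.3 n slots and a candidate occupies at most 0.01 n of them, which leaves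
   0.29 n: 0.28 goes into [w] and 0.01 into [delta]. *)
pose w : R := expR (- (28 / 100 * x%:R ^+ 2)).
pose delta : R := expR (- (1 / 100 * x%:R ^+ 2)).
have w0 : 0 <= w by exact: expR_ge0.
have xw1 : d.-1%:R * w <= 1 by apply: x_le_expR => //; lra.
have xw4 : (d.-1%:R * w) ^+ 4 <= w.
  rewrite -/x exprMn (_ : w ^+ 4 = w * expR (- (21 / 100 * x%:R ^+ 2)) ^+ 4); last first.
    rewrite -!expRM_natl -expRD; congr expR; lra.
  rewrite mulrCA -exprMn -[X in _ <= X]mulr1 ler_wpM2l // exprn_ile1 //.
  by apply: x_le_expR => //; lra.
have dl01 : 0 <= delta <= 1.
  rewrite expR_ge0 -[X in _ <= X]expR0 ler_expR oppr_le0 mulr_ge0 ?sqr_ge0 //; lra.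
pose Pd E := 3 / 10 * n%:R <= E%:R :> R.
apply: le_trans (upr_loses_choice n0' d2 jm q3 q2 Dj w0 xw1 xw4 dl01 (Pd := Pd) _) _.
  move=> E N PE xN.
  have N100 : 100 * N%:R <= n%:R :> R.
    by rewrite -natrM ler_nat; apply: leq_trans n100; rewrite leq_mul2l xN orbT.
  rewrite -expRD ler_expR natrX -/x.
  have EN : 29 / 100 * n%:R <= (E - N)%N%:R :> R.
    have : E%:R <= N%:R + (E - N)%N%:R :> R by rewrite -natrD ler_nat -leq_subLR.
    by move: PE N100; rewrite /Pd; lra.
  have : 29 / 100 * x%:R ^+ 2 <= (E - N)%N%:R * x%:R ^+ 2 / n%:R :> R.
    by rewrite ler_pdivlMr // mulrAC ler_wpM2r ?sqr_ge0.
  lra.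
have wd : d%:R * w <= d%:R.
  rewrite -[X in _ <= X]mulr1 ler_wpM2l // -[X in _ <= X]expR0 ler_expR oppr_le0.
  by rewrite mulr_ge0 ?sqr_ge0 //; lra.
have dl : delta ^+ (4 ^ D) <= 100 / 4 ^+ D.
  rewrite -expRM_natl mulrN expRN natrX.
  have q0 : 0 < 4 ^+ D :> R by rewrite exprn_gt0.
  rewrite invf_ple ?posrE ?expR_gt0 ?divr_gt0 // invf_div.
  apply: le_trans (expR_ge1Dx _).
  have X1 : 1 <= x%:R ^+ 2 :> R by rewrite exprn_ege1 //; lra.
  move: (x%:R ^+ 2) (4 ^+ D : R) q0 X1 => X F F0 X1.
  have : F * 1 <= F * X by rewrite ler_wpM2l // ltW.
  clear; lra.
rewrite mulrAC; apply: ler_pM => //; rewrite ?exprn_ge0 ?expR_ge0 //.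
by rewrite mulr_ge0 ?expR_ge0.
Qed.

(** Early growth leaves at least d (d - 1)^(4 u) / 2 slots at level 4 u. By the upper bound on [n]
    this is a density of at least 1 / (32 (d - 1)^4), a constant, so boundedly many further levels
    reach 3/10. *)
Lemma upr_sparse (R : realType) (n m d u c : nat) :
  (2 < d)%N -> (0 < u)%N -> (16 * d * d.-1 ^ (4 * u) <= n)%N ->
  (n < 16 * d * d.-1 ^ (4 * u + 4))%N -> (4 * u + c <= m)%N ->
  3 / 10 * (32 * d.-1%:R ^+ 4) <= (6 / 5) ^+ c :> R ->
  uniform_pr R (fun f : outcome m n d =>
    ~ (3 / 10 * n%:R <= (#|generated f (4 * u + c)|%:R : R))) <=
  u%:R * ((d * d.-1 ^ u)%:R ^+ 2 / n%:R) +
  (3 * u)%:R * (2 * (32 * u%:R) ^+ 2 / (d * d.-1 ^ u)%:R) +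
  c%:R * (100 * d%:R ^+ 3 * (32 * d.-1%:R ^+ 4) ^+ 2 / n%:R).
Proof.
move=> d2 u0 n_lo n_hi um big; pose x := d.-1.
have x2 : (2 <= x)%N by rewrite -ltnS prednK // (ltn_trans _ d2).
have x2' : 2 <= x%:R :> R by rewrite ler_nat.
pose c0 : R := (32 * x%:R ^+ 4)^-1.
have x4 : 1 <= x%:R ^+ 4 :> R by rewrite exprn_ege1 //; lra.
have c00 : 0 < c0 by rewrite invr_gt0; lra.
have c03 : c0 <= 3 / 10 by rewrite /c0 invf_ple ?posrE //; lra.
have n1 : (1 < n)%N.
  apply: leq_trans n_lo; have z0 : (0 < d.-1 ^ (4 * u))%N by rewrite expn_gt0 (ltnW x2).
  exact: leq_trans (leq_trans (ltnW d2) (@leq_pmull d 16 isT)) (leq_pmulr _ z0).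
have n0 : 0 < n%:R :> R by rewrite ltr0n ltnW.
have c0b : 0 < c0 <= 3 / 10 by rewrite c00.
have u40 : (0 < 4 * u)%N by rewrite muln_gt0.
have um4 : (4 * u <= m)%N := leq_trans (leq_addr _ _) um.
have late := upr_growth_late d2 n1 u40 um c0b.
have bigc : 3 / 10 <= c0 * (6 / 5) ^+ c.
  by rewrite /c0 [X in _ <= X]mulrC ler_pdivlMr // mulr_gt0 //; lra.
have start : uniform_pr R (fun f : outcome m n d => ~ n%:R * c0 <= (#|generated f (4 * u)|%:R : R)) <=
   uniform_pr R (fun f : outcome m n d => ~ (d * d.-1 ^ (4 * u))%:R / 2 <= (#|generated f (4 * u)|%:R : R)).
  apply: upr_le => f; apply: contra_not; apply: le_trans.
  rewrite /c0 ler_pdivrMr; last by lra.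
  have : n%:R <= (16 * d * d.-1 ^ (4 * u + 4))%:R :> R by rewrite ler_nat ltnW.
  have -> : (16 * d * d.-1 ^ (4 * u + 4))%:R = 16 * (d * d.-1 ^ (4 * u))%:R * x%:R ^+ 4 :> R.
    by rewrite expnD !natrM !natrX -/x; ring.
  lra.
apply: (@le_trans _ _ (uniform_pr R (fun f : outcome m n d =>
    ~ (n%:R * Num.min (3 / 10) (c0 * (6 / 5) ^+ c) <= (#|generated f (4 * u + c)|%:R : R))))).
  by apply: upr_le => f; rewrite min_l // mulrC.
apply: le_trans late _; apply: lerD.
  exact: le_trans start (upr_growth_early R d2 u0 um4 n_lo).
by rewrite /c0 exprVn invfM invrK -[X in _ <= _ * X]mulrA.
Qed.

Lemma loses_v_arith (R : realFieldType) (eps d u n X F C3 : R) :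
  0 < eps -> 0 <= u -> 1 <= d -> 1 <= X -> 0 < F ->
  d * u <= X * eps -> 24 * 32 ^+ 2 * u ^+ 3 <= X * eps -> 4 * C3 <= X * eps ->
  400 * d <= F * eps -> 16 * d * X ^+ 4 <= n ->
  u * ((d * X) ^+ 2 / n) + 3 * u * (2 * (32 * u) ^+ 2 / (d * X)) + C3 / n +
    100 * d / F <= eps.
Proof.
move=> eps0 u0 d1 X1 F0 H1 H2 H3 H4 n_lo.
have d0 : 0 < d by lra.
have X0 : 0 < X by lra.
have X14 : X <= X ^+ 4 by rewrite -[X in X <= _]expr1 ler_weXn2l.
have nX : X * (d * X ^+ 2) <= n.
  apply: le_trans n_lo; rewrite -mulrA (_ : X * _ = d * X ^+ 3); last by ring.
  have : d * X ^+ 3 <= d * X ^+ 4 by rewrite ler_wpM2l ?(ltW d0) // ler_weXn2l.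
  have : 0 <= d * X ^+ 4 by rewrite mulr_ge0 ?exprn_ge0 // ltW.
  lra.
have n16 : 16 * (X * (d * X ^+ 2)) <= n.
  apply: le_trans n_lo; rewrite -mulrA ler_wpM2l // (_ : X * _ = d * X ^+ 3); last by ring.
  by rewrite ler_wpM2l ?(ltW d0) // ler_weXn2l.
have dX0 : 0 <= d * X ^+ 2 by rewrite mulr_ge0 ?exprn_ge0 // ltW.
have n0 : 0 < n by apply: lt_le_trans nX; rewrite !mulr_gt0 ?exprn_gt0.
have nX' : X <= n.
  apply: le_trans nX; rewrite ler_peMr // ?(ltW X0) //.
  have : 1 <= X ^+ 2 by rewrite exprn_ege1.
  by move: (X ^+ 2) => Y; nra.
have T1 : u * ((d * X) ^+ 2 / n) <= eps / 4.
  rewrite mulrA ler_pdivrMr //.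
  have : d * u * (d * X ^+ 2) <= X * eps * (d * X ^+ 2) by rewrite ler_wpM2r.
  have -> : d * u * (d * X ^+ 2) = u * (d * X) ^+ 2 by ring.
  have e1 : eps * (16 * (X * (d * X ^+ 2))) <= eps * n by rewrite ler_wpM2l // ltW.
  have e3 : 0 <= eps * (X * (d * X ^+ 2)) by rewrite !mulr_ge0 // ltW.
  have -> : X * eps * (d * X ^+ 2) = eps * (X * (d * X ^+ 2)) by ring.
  move: e1; rewrite mulrCA; move: e3; move: (eps * (X * _)) => A A0 e1 e2.
  lra.
have T2 : 3 * u * (2 * (32 * u) ^+ 2 / (d * X)) <= eps / 4.
  rewrite mulrA ler_pdivrMr ?mulr_gt0 //.
  have -> : 3 * u * (2 * (32 * u) ^+ 2) = 24 * 32 ^+ 2 * u ^+ 3 / 4 by field.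
  have : X * eps <= d * X * eps by rewrite ler_wpM2r ?(ltW eps0) // ler_peMl // ltW.
  lra.
have T3 : C3 / n <= eps / 4.
  rewrite ler_pdivrMr //.
  have : X * eps <= n * eps by rewrite ler_wpM2r // ltW.
  lra.
have T4 : 100 * d / F <= eps / 4 by rewrite ler_pdivrMr //; lra.
by lra.
Qed.

Lemma upr_loses_v (R : realType) (d : nat) : (2 < d)%N -> exists D3 : nat,
  forall eps : R, 0 < eps -> exists U : nat, forall u, (U <= u)%N ->
  forall (n m j : nat) (q : nat -> nat),
  (16 * d * d.-1 ^ (4 * u) <= n)%N -> (n < 16 * d * d.-1 ^ (4 * u + 4))%N ->
  (4 * (u + D3) + 3 < j)%N -> (j <= m)%N ->
  (forall t, d - 3 <= q t)%N -> (forall t, t %% 4 != 1 -> d - 2 <= q t)%N ->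
  uniform_pr R (fun f : outcome m n d => ~~ wins (rdag_edge f) q j 0 None) <= eps.
Proof.
move=> d2; pose x := d.-1.
have x2 : (2 <= x)%N by rewrite -ltnS prednK // (ltn_trans _ d2).
have x2' : 2 <= x%:R :> R by rewrite ler_nat.
have x1' : 1 < x%:R :> R by lra.
have a65 : 1 < 6 / 5 :> R by lra.
(* [D3] depends on d alone, being fixed before eps: the levels added after level 4 u must stay
   O(1). *)
have [D3 HD3] := exp_dominates (3 / 10 * (32 * x%:R ^+ 4)) 0 a65.
exists D3 => eps eps0; pose c := (4 * D3 + 2)%N.
pose C3 : R := c%:R * (100 * d%:R ^+ 3 * (32 * x%:R ^+ 4) ^+ 2).
have [U1 H1] := exp_dominates (d%:R / eps) 1 x1'.
have [U2 H2] := exp_dominates (24 * 32 ^+ 2 / eps) 3 x1'.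
have [U3 H3] := exp_dominates (4 * C3 / eps) 0 x1'.
have [U4 H4] := exp_dominates (400 * d%:R / eps) 0 (ltr1n R 4).
(* The summand 3 D3 + 4 ensures 3 (u + D3) + 4 <= 4 u, so the candidates occupy at most n / 100
   slots. *)
exists (U1 + U2 + U3 + U4 + (3 * D3 + 4))%N => u uU n m j q n_lo n_hi Dj jm q3 q2.
have [[u0 u1 u2] [u3 u4 u5]] : [/\ 0 < u, U1 <= u & U2 <= u]%N /\
  [/\ U3 <= u, U4 <= u & 3 * D3 + 4 <= u]%N by clear -uU; split; split; lia.
pose D := (u + D3)%N.
have Kc : (4 * D + 2 = 4 * u + c)%N by rewrite /D /c; clear; lia.
have um : (4 * u + c <= m)%N by rewrite -Kc /D; clear -Dj jm; lia.
have n0' : (0 < n)%N.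
  by apply: leq_trans n_lo; rewrite !muln_gt0 expn_gt0 (ltnW x2) (ltn_trans _ d2).
have n100 : (100 * d.-1 ^ (3 * D + 2) <= n)%N.
  apply: leq_trans n_lo.
  have -> : (4 * u = (3 * D + 2) + (2 + (u - (3 * D3 + 4))))%N.
    by rewrite /D; clear -u5; lia.
  rewrite [(d.-1 ^ (_ + (2 + _)))%N]expnD mulnCA mulnC leq_mul2l; apply/orP; right.
  have z0 : (0 < x ^ (u - (3 * D3 + 4)))%N by rewrite expn_gt0 (ltnW x2).
  have s4 : (2 ^ 2 <= x ^ 2)%N by rewrite leq_exp2r.
  rewrite expnD mulnA; apply: leq_trans (leq_pmulr _ z0).
  by apply: (@leq_trans (16 * 3 * 2 ^ 2)) => //; rewrite leq_mul // leq_mul.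
have big : 3 / 10 * (32 * x%:R ^+ 4) <= (6 / 5) ^+ c :> R.
  by have := HD3 c; rewrite expr0 mulr1; apply; rewrite /c; clear; lia.
pose Pd (f : outcome m n d) := 3 / 10 * n%:R <= (#|generated f (4 * D + 2)|%:R : R).
apply: (@le_trans _ _ (uniform_pr R (fun f => ~ Pd f) +
   uniform_pr R (fun f => Pd f /\ ~~ wins (rdag_edge f) q j 0 None))).
  apply: le_trans (upr_or _ _ _); apply: upr_le => f Lf.
  by have [PK|nPK] := pselect (Pd f); [right|left].
apply: le_trans (lerD _ (upr_loses_dense R d2 n0' n100 Dj jm q3 q2)) _.
  rewrite /Pd Kc; exact: upr_sparse d2 u0 n_lo n_hi um big.
have d1 : 1 <= d%:R :> R by rewrite ler1n ltnW // ltnW.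
have X1 : 1 <= x%:R ^+ u :> R by rewrite exprn_ege1 // ltW.
have {}H1 : d%:R * u%:R <= x%:R ^+ u * eps :> R.
  by have := H1 u u1; rewrite expr1 mulrAC ler_pdivrMr.
have {}H2 : 24 * 32 ^+ 2 * u%:R ^+ 3 <= x%:R ^+ u * eps :> R.
  by have := H2 u u2; rewrite mulrAC ler_pdivrMr.
have {}H3 : 4 * C3 <= x%:R ^+ u * eps.
  by have := H3 u u3; rewrite expr0 mulr1 ler_pdivrMr.
have {}H4 : 400 * d%:R <= 4 ^+ D * eps.
  have := H4 D (leq_trans u4 (leq_addr _ _)); rewrite expr0 mulr1 ler_pdivrMr //.
have n_lo' : 16 * d%:R * (x%:R ^+ u) ^+ 4 <= n%:R :> R.
  by rewrite -exprM -natrX -!natrM ler_nat mulnC [(u * 4)%N]mulnC mulnC.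
rewrite natrM natrX [(3 * u)%N%:R]natrM -/x -/C3.
have := @loses_v_arith R eps d%:R u%:R n%:R (x%:R ^+ u) (4 ^+ D) C3 eps0 (ler0n R u) d1 X1
  (exprn_gt0 D (ltr0Sn R 3)) H1 H2 H3 H4 n_lo'.
by rewrite /C3 -[X in _ + X + _]mulrA.
Qed.

(** * Quotas and the lower bound *)

Lemma quotaZ (R : realType) (r : R) t : 0 <= r ->
  (quota r t)%:Z = Num.floor (r * t%:R) - Num.floor (r * t.-1%:R).
Proof.
move=> r0; rewrite /quota gez0_abs // subr_ge0 le_floor // ler_wpM2l // ler_nat.
exact: leq_pred.
Qed.

Lemma floor_eqP (R : realType) (z : R) (a : int) : a%:~R <= z < a%:~R + 1 ->
  Num.floor z = a.
Proof. by move=> za; apply: floor_def; rewrite intrD. Qed.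

Lemma quota_nat (R : realType) (k t : nat) : (0 < t)%N -> quota (k%:R : R) t = k.
Proof.
move=> t0; have flE l : Num.floor ((k%:R : R) * l%:R) = (k * l)%N%:Z.
  by rewrite -natrM; exact: (Num.Theory.intrKfloor (k * l)%N%:Z).
rewrite /quota !flE; case: t t0 => // t _; rewrite mulnS PoszD /= addrK.
exact: absz_nat.
Qed.

Lemma quota_le (R : realType) (r : R) (a t : nat) : (0 < t)%N -> 0 <= r <= a%:R ->
  (quota r t <= a)%N.
Proof.
move=> t0 /andP[r0 ra]; rewrite -lez_nat quotaZ // lerBlDl.
rewrite -ltzD1 floor_lt_int !intrD /=.
have : r * t.-1%:R < (Num.floor (r * t.-1%:R))%:~R + 1.
  by have := floorD1_gt (r * t.-1%:R); rewrite intrD.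
have -> : t%:R = t.-1%:R + 1 :> R by rewrite natr1 prednK.
rewrite mulrDr mulr1 -[(Posz a)%:~R]/(a%:R : R); lra.
Qed.

(** When r >= a, the product r l is less than a l + 1 for l <= j: no surplus node accumulates up to
    time j. *)
Lemma quota_le_small (R : realType) (r : R) (a j t : nat) :
  (0 < t <= j)%N -> 0 <= r -> r < a%:R + j%:R^-1 -> (quota r t <= a)%N.
Proof.
move=> /andP[t0 tj] r0 rj; have [ra|ra] := leP r a%:R.
  by apply: quota_le; rewrite ?r0.
have j0 : 0 < j%:R :> R by rewrite ltr0n (leq_trans t0).
have flE l : (l <= j)%N -> Num.floor (r * l%:R) = (a * l)%N%:Z.
  move=> lj; apply: floor_eqP; rewrite -[(Posz _)%:~R]/((a * l)%N%:R : R) natrM.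
  rewrite ler_wpM2r ?(ltW ra) //=.
  have [->|l0] := posnP l; first by rewrite !mulr0 add0r.
  apply: (@lt_le_trans _ _ ((a%:R + j%:R^-1) * l%:R)); first by rewrite ltr_pM2r ?ltr0n.
  by rewrite mulrDl lerD2l mulrC ler_pdivrMr // mul1r ler_nat.
rewrite -lez_nat quotaZ // !flE ?(leq_trans (leq_pred _)) //.
by rewrite lerBlDl -PoszD lez_nat -mulnSr prednK.
Qed.

(** At rate a + 1/j the surplus reaches a whole node exactly at time j. *)
Lemma quota_last (R : realType) (a j : nat) : (0 < j)%N ->
  quota (a%:R + j%:R^-1 : R) j = a.+1.
Proof.
move=> j0; have j0' : 0 < j%:R :> R by rewrite ltr0n.
apply/eqP; rewrite -eqz_nat quotaZ ?addr_ge0 ?invr_ge0 //.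
rewrite (@floor_eqP _ _ (a * j).+1) ?(@floor_eqP _ _ (a * j.-1)%N); last 2 first.
- rewrite -[(Posz _)%:~R]/((a * j.-1)%N%:R : R) natrM mulrDl lerDl ltrD2l.
  rewrite mulr_ge0 ?invr_ge0 //= mulrC ltr_pdivrMr // mul1r ltr_nat.
  by rewrite prednK.
- rewrite -[(Posz _)%:~R]/((a * j).+1%:R : R) -natr1 natrM mulrDl mulVf ?gt_eqF //.
  by rewrite lexx /= ltrDl.
rewrite -[X in _ == X]/((1 + a)%N%:Z) subr_eq -PoszD eqz_nat -{1}(prednK j0) mulnS.
by rewrite -addn1; apply/eqP; lia.
Qed.

(** The rate is (d - 3) + 3/4, and the floor of 3 l / 4 fails to increase exactly at the steps l = 1
    mod 4. *)
Lemma quota_quarter (R : realType) (d t : nat) : (2 < d)%N -> (0 < t)%N ->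
  (quota (d%:R - 2 - 1 / 4 : R) t = d - 2 - (t %% 4 == 1))%N.
Proof.
move=> d2 t0; have [a aE] : exists a, (d = a + 3)%N by exists (d - 3)%N; lia.
have rE : d%:R - 2 - 1 / 4 = a%:R + 3 / 4 :> R by rewrite aE natrD; lra.
have flE l : Num.floor ((a%:R + 3 / 4 : R) * l%:R) = (a * l + (3 * l) %/ 4)%N%:Z.
  apply: floor_eqP; rewrite -[(Posz _)%:~R]/((a * l + (3 * l) %/ 4)%N%:R : R).
  rewrite natrD natrM mulrDl -addrA lerD2l ltrD2l.
  have h1 : ((3 * l) %/ 4)%N%:R * 4 <= 3 * l%:R :> R.
    by rewrite -!natrM ler_nat; lia.
  have h2 : 3 * l%:R < ((3 * l) %/ 4)%N%:R * 4 + 4 :> R.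
    by rewrite -!natrM -natrD ltr_nat; lia.
  by apply/andP; split; lra.
rewrite rE; apply/eqP; rewrite -eqz_nat quotaZ; last by rewrite addr_ge0 //; lra.
rewrite !flE subr_eq -PoszD eqz_nat; case: t t0 => // t _; rewrite aE [t.+1.-1]/= mulnS.
clear; lia.
Qed.

Lemma wins_eq_quota (T : finType) (e : rel T) (q q' : nat -> nat) k i x :
  (forall t, (0 < t)%N -> q t = q' t) -> wins e q k i x = wins e q' k i x.
Proof.
move=> qq'; elim: k i x => // k IHk i x; rewrite !winsE qq' //.
by congr (_ <= _)%N; apply: eq_card => y; rewrite !inE IHk.
Qed.

Lemma quota_window (R : realType) (r : R) (a s T : nat) : (0 < s)%N -> 0 <= r ->
  r < a%:R - 1 / s%:R ->
  exists2 t, (T < t <= T + s)%N & (quota r t < a)%N.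
Proof.
move=> s0 r0 ra; apply/not_exists2P => Ha.
have s0' : 0 < s%:R :> R by rewrite ltr0n.
have step l : (l <= s)%N -> Num.floor (r * T%:R) + (a * l)%N%:Z <= Num.floor (r * (T + l)%N%:R).
  elim: l => [|l IHl] ls; first by rewrite muln0 addn0 addr0.
  have aq : (a <= quota r (T + l).+1)%N.
    by have [|/negP] := Ha (T + l).+1; [lia|rewrite -leqNgt].
  have := quotaZ (T + l).+1 r0; have := IHl (ltnW ls); rewrite addnS [_.+1.-1]/= mulnS.
  move: (quota _ _) aq (Num.floor _) (Num.floor _) (Num.floor _) => q aq F0 F1 F2.
  clear -aq; lia.
have := step s (leqnn s); rewrite leNgt => /negP; apply.
rewrite floor_lt_int intrD natrD mulrDr.
have : r * T%:R < (Num.floor (r * T%:R))%:~R + 1.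
  by have := floorD1_gt (r * T%:R); rewrite intrD.
have : r * s%:R < a%:R * s%:R - 1.
  have : r * s%:R < (a%:R - 1 / s%:R) * s%:R by rewrite ltr_pM2r.
  by rewrite mulrBl div1r mulVf // gt_eqF.
rewrite -[(Posz _)%:~R]/((a * s)%N%:R : R) natrM; lra.
Qed.

(** * The sludge's lower bound on the green number *)

Lemma choices_left_ge (q : nat -> nat) (d h s b i : nat) : (2 < d)%N ->
  (0 < s)%N -> h = (s * b)%N -> (0 < b)%N -> (h %| i)%N ->
  (forall T, exists2 t, (T < t <= T + s)%N & (q t < d - 2)%N) ->
  (b <= choices_left q d h i)%N.
Proof.
move=> d2 s0 hE b0 hi win.
have -> : choices_left q d h i = (\sum_(i.+1 <= t < (i + h).+1) (q t <= d - 3))%N.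
  by rewrite /choices_left /block_end mulSn divnK // addnC.
rewrite hE; clear hE b0; elim: b => [//|b IHb].
have le1 : ((i + s * b).+1 <= (i + s * b.+1).+1)%N by rewrite ltnS leq_add2l leq_mul2l leqnSn orbT.
rewrite (@big_cat_nat _ _ _ (i + s * b).+1) //=; last by rewrite ltnS leq_addr.
rewrite -addn1 leq_add //; have [t /andP[t1 t2] qt] := win (i + s * b)%N.
rewrite (bigD1_seq t) /= ?iota_uniq //; last by rewrite mem_index_iota; lia.
by rewrite (_ : (q t <= d - 3)%N = true) //; lia.
Qed.

(** Two failures are possible: the first two blocks are not a tree, or some node has 2 M dead slots
    on one level of the block after its own. The union bound runs over potential nodes, j n of them,
    so that its index set is deterministic. Without failure a node has fewer than 2 M h <= 2^b such
    slots. *)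
Lemma upr_sludge (R : realType) (n m d s b M j : nat) :
  (2 < d)%N -> (0 < n)%N -> (0 < s)%N -> (0 < b)%N -> (0 < M)%N -> (0 < j <= m)%N ->
  (s * b * M.*2 <= 2 ^ b)%N ->
  uniform_pr R (fun f : outcome m n d =>
    ~ (d%:R - 2 - 1 / s%:R <= rdag_green_number R f j)) <=
  (s * b).*2%:R * ((d * d.-1 ^ (s * b).*2)%:R ^+ 2 / n%:R) +
  (j * n * (s * b))%:R *
    (expR ((d.-1 ^ (s * b).*2)%:R * (d * d.-1 ^ j)%:R / n%:R) / 2 ^+ M).
Proof.
move=> d2 n0 s0 b0 M0 /andP[j0 jm] Mb; set h := (s * b)%N in Mb *.
have h0 : (0 < h)%N by rewrite muln_gt0 s0.
have d1 : (1 < d)%N by rewrite ltnW.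
have x0 : (0 < d.-1)%N by rewrite -ltnS prednK // ltnW.
pose node_at (i : 'I_j) (u : 'I_n) : node m n := Some (widen_ord jm i, u).
pose Bad (iul : 'I_j * 'I_n * 'I_h) (f : outcome m n d) :=
  (M.*2 <= #|dead_below f (node_at iul.1.1 iul.1.2) (iul.1.1.+1 + h + iul.2)
     (iul.1.1.+1 + h + iul.2).+1|)%N /\ (iul.1.1.+1 + h + iul.2 < j)%N.
pose NTree (f : outcome m n d) :=
  ~ (forall i, (i < h.*2)%N -> {in generated f i &, injective f}).
apply: (@le_trans _ _ (uniform_pr R NTree + uniform_pr R (fun f => exists iul, Bad iul f))).
  apply: le_trans (upr_or _ _ _); apply: upr_le => f; apply: contra_notP.
  move=> /not_orP[/contrapT tree noBad]; apply: green_number_ge => //; first exact: ltnW.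
  move=> r r0 rlt; apply: (sludge_blocks h0 jm d2).
  - move=> t t0 _; apply: quota_le => //; rewrite (ltW r0) /=.
    rewrite natrB ?(ltnW d2) //; apply: (le_trans (ltW rlt)).
    by rewrite lerBlDr lerDl divr_ge0.
  - apply/setP => s'; rewrite !inE; apply/negP => /andP[/andP[sA sdeg] /and3P[_ sk _]].
    case/negP: sdeg; apply/cards1P; exists (s'); apply/setP => t; rewrite !inE.
    apply/andP/eqP => [[tA /eqP ft]|->]; last by rewrite sA.
    apply: tree tA sA ft; move: sk; rewrite leq_min => /andP[-> //].
  move=> [[i u]|] // xv xd /andP[_ lj] hl; set x := Some (i, u) in xv xd lj hl *.
  have ij : (i < j)%N by exact: ltnW.
  have xE : x = node_at (Ordinal ij) u.
    by rewrite /node_at /x; congr (Some (_, _)); apply: val_inj.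
  have small (l : 'I_h) : (level x + h + l < j)%N ->
      (#|dead_below f x (level x + h + l) (level x + h + l).+1| < M.*2)%N.
    move=> lj'; rewrite ltnNge; apply/negP => big; apply: noBad.
    by exists (Ordinal ij, u, l); rewrite /Bad /= -xE.
  have winq T : exists2 t, (T < t <= T + s)%N & (quota r t < d - 2)%N.
    by apply: quota_window s0 (ltW r0) _; rewrite natrB // ltnW.
  have := choices_left_ge d2 s0 (erefl h) b0 hl winq.
  rewrite -(@leq_exp2l 2) // => /(leq_trans Mb); apply: leq_trans.
  apply: (@leq_ltn_trans (M.*2.-1 * h)); last first.
    by rewrite mulnC ltn_pmul2l // prednK // double_gt0.
  apply: (@leq_trans #|\bigcup_(l in [set: 'I_h])
     (dead_below f x (level x + h + l) (level x + h + l).+1 :&: [set s' | (level s'.1 < j)%N])|).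
    apply/subset_leq_card/fintype.subsetP => s'; rewrite inE => /andP[sd /and3P[s1 s2 s3]].
    move: s2; rewrite leq_min => /andP[s2 s2'].
    have lh : (level s'.1 - (level x + h) < h)%N.
      by rewrite ltn_subLR // -addnA addnn.
    by apply/bigcupP; exists (Ordinal lh); rewrite ?inE // sd s3 /= subnKC // leqnn ltnSn /=.
  apply: leq_trans (card_bigcup_le (c := M.*2.-1) _) _; last by rewrite cardsT card_ord.
  move=> l _; have [lj'|lj'] := ltnP (level x + h + l) j.
    apply: leq_trans (subset_leq_card (finset.subsetIl _ _)) _.
    by rewrite -ltnS prednK ?double_gt0 // small.
  rewrite (_ : _ :&: _ = finset.set0) ?cards0 //; apply/setP => s'; rewrite !inE.
  apply/negP => /andP[/andP[_ /and3P[a1 a2 _]] a3].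
  by move: (leq_ltn_trans (leq_trans lj' a1) a3); rewrite ltnn.
apply: lerD.
  exact: upr_tree.
apply: le_trans (upr_ex _ _) _.
rewrite -[(j * n * h)%N](_ : #|{: 'I_j * 'I_n * 'I_h}| = _); last first.
  by rewrite !card_prod !card_ord.
rewrite mulr_natl -sumr_const; apply: ler_sum => -[[i u] l] _.
rewrite /Bad /=; have [lj|lj] := ltnP (i.+1 + h + l) j; last first.
  by rewrite upr0 ?divr_ge0 ?expR_ge0 ?exprn_ge0 // => f [].
apply: (@le_trans _ _ (uniform_pr R (fun f : outcome m n d =>
   (M.*2 <= #|dead_below f (node_at i u) (i.+1 + h + l) (i.+1 + h + l).+1|)%N))).
  by apply: upr_le => f [].
apply: le_trans (upr_dead_below R _ _ n0 _) _; first by rewrite /= -addnA leq_addr.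
rewrite ler_wpM2r ?invr_ge0 ?exprn_ge0 // ler_expR ler_wpM2r ?invr_ge0 //.
rewrite -!natrM ler_nat leq_mul //.
  rewrite leq_pexp2l // /= -addnA addKn -addnn -addnS leq_add2l //.
by rewrite leq_mul2l leq_pexp2l ?orbT // ltnW.
Qed.

Lemma expr_expR_ln (R : realType) (a : R) k : 0 < a -> a ^+ k = expR (k%:R * ln a).
Proof. by move=> a0; rewrite expRM_natl lnK. Qed.

(* The witness is b = floor (5/4 log_2 y). *)
Lemma block_length (R : realType) (C7 C8 : R) (B : nat) : 0 <= C7 -> 0 <= C8 ->
  exists Y0 : R, forall y : R, Y0 <= y -> exists b : nat,
    [/\ (0 < b)%N, (B <= b)%N, b%:R <= 5 / 4 * logb 2 y,
      C7 * b%:R <= y & C8 * y * b%:R <= 2 ^+ b].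
Proof.
move=> C70 C80; have l2 : 0 < ln 2 :> R by rewrite ln_gt0 // ltr1n.
have [U7 H7] := exp_dominates (C7 ^+ 5) 5 (ltr1n R 16).
have [U8 H8] := exp_dominates (C8 ^+ 5 * 16) 5 (ltr1n R 2).
pose B0 := (U7 + U8 + B + 1)%N; exists (2 ^+ B0) => y yB.
have y1 : 1 <= y by apply: le_trans yB; rewrite exprn_ege1 // ler1n.
have y0 : 0 < y by apply: lt_le_trans y1.
have ly0 : 0 <= ln y by rewrite ln_ge0.
pose v := 5 / 4 * logb 2 y; have v0 : 0 <= v.
  by rewrite mulr_ge0 ?divr_ge0 // ltW.
have [b [Bb bv vb]] : exists b : nat, [/\ (B0 <= b)%N, b%:R <= v & v < b.+1%:R].
  exists (Num.trunc v); rewrite truncn_le v0 truncnS_gt truncn_ge_nat //; split=> //.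
  have : B0%:R * ln 2 <= ln y.
    by rewrite -ler_expR -expr_expR_ln // lnK.
  rewrite -ler_pdivlMr // -/(logb 2 y) /v.
  by have : 0 <= (B0%:R : R) by []; lra.
have e16 : 16 = 2 ^+ 4 :> R by rewrite -natrX.
(* Taking fifth powers clears the factor 5/4: the choice of b says that y^5 lies between 16^b and
   16^(b+1). The last claim then compares 32^b with 16^b times a polynomial in b. *)
have y5lo : 16 ^+ b <= y ^+ 5.
  rewrite (expr_expR_ln 5 y0) e16 -exprM (expr_expR_ln _ (ltr0Sn R 1)).
  rewrite ler_expR natrM; move: bv; rewrite /v /logb.
  rewrite mulrA ler_pdivlMr // => bv'; lra.
have y5hi : y ^+ 5 <= 16 ^+ b.+1.
  rewrite (expr_expR_ln 5 y0) e16 -exprM (expr_expR_ln _ (ltr0Sn R 1)).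
  rewrite ler_expR natrM; move: vb; rewrite /v /logb.
  rewrite mulrA ltr_pdivrMr // => vb'; lra.
have [b0 [bU7 [bU8 bB]]] : (0 < b)%N /\ ((U7 <= b)%N /\ ((U8 <= b)%N /\ (B <= b)%N)).
  by move: Bb; rewrite /B0; clear; lia.
exists b; split=> //.
- rewrite -(@ler_pXn2r _ 5) ?nnegrE ?mulr_ge0 ?(ltW y0) //.
  by rewrite exprMn; apply: le_trans y5lo; exact: H7.
- rewrite -(@ler_pXn2r _ 5) ?nnegrE ?mulr_ge0 ?(ltW y0) ?exprn_ge0 //.
  rewrite !exprMn -exprM.
  have p5 : 0 <= C8 ^+ 5 * b%:R ^+ 5 by rewrite mulr_ge0 ?exprn_ge0.
  apply: (@le_trans _ _ (C8 ^+ 5 * b%:R ^+ 5 * 16 ^+ b.+1)).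
    by rewrite mulrAC ler_wpM2l.
  rewrite (_ : C8 ^+ 5 * b%:R ^+ 5 * 16 ^+ b.+1 = C8 ^+ 5 * 16 * b%:R ^+ 5 * 16 ^+ b); last first.
    by rewrite [16 ^+ b.+1]exprS; ring.
  apply: le_trans (_ : _ <= 2 ^+ b * 16 ^+ b) _; first by rewrite ler_wpM2r ?exprn_ge0 // H8.
  rewrite -exprMn mulnC exprM (_ : 2 * 16 = 2 ^+ 5 :> R) //.
  by rewrite -natrX -natrM.
Qed.

(** With y = ln n and 2 h <= 5/2 s log_2 y, the hypothesis on [j] yields d (d - 1)^(j + 2 h) <= C1 n
    y, so the exponent in the bound on dead slots is at most C1 y. As 2^b exceeds a large multiple
    of y h, M exceeds a large multiple of y, and 2^M beats both exp(C1 y) and the at most C1 s n^4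
    terms of the union bound. *)
Lemma upr_sludge_asym (R : realType) (d s : nat) (K eps : R) :
  (2 < d)%N -> (0 < s)%N -> 0 < eps -> exists Y0 : R, forall n j m,
  (0 < n)%N -> Y0 <= ln (n%:R : R) -> (0 < j <= m)%N ->
  j%:R <= logb (d%:R - 1) (n%:R : R) - 5 / 2 * s%:R * logb 2 (ln n%:R)
            + logb (d%:R - 1) (ln n%:R) - K ->
  uniform_pr R (fun f : outcome m n d =>
    ~ (d%:R - 2 - 1 / s%:R <= rdag_green_number R f j)) <= eps.
Proof.
move=> d2 s0 eps0.
have xE : d%:R - 1 = d.-1%:R :> R by rewrite -subn1 natrB // ltnW // ltnW.
rewrite xE; pose x : R := d.-1%:R.
have x2 : 2 <= x by rewrite ler_nat -ltnS prednK // (ltn_trans _ d2).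
have x0 : 0 < x by lra.
have lx : 0 < ln x by rewrite ln_gt0 //; lra.
have s0' : 1 <= s%:R :> R by rewrite ler1n.
have s0'' : 0 < s%:R :> R by lra.
have d0 : 0 < d%:R :> R by rewrite ltr0n ltnW // ltnW.
pose C1 : R := d%:R * expR (- (K * ln x)).
have C10 : 0 < C1 by rewrite mulr_gt0 ?expR_gt0.
pose C4 : R := 2 * C1 * s%:R / eps.
have C40 : 0 < C4 by rewrite divr_gt0 // mulr_gt0 // mulr_gt0.
pose C5 : R := 4 * (4 + C1) + 4 * C4 + 4.
pose C6 : R := 4 * s%:R * d%:R ^+ 2 / eps.
have C60 : 0 < C6 by rewrite divr_gt0 // mulr_gt0 ?exprn_gt0 // mulr_gt0.
pose C7 : R := C6 + 1 + 4 * s%:R * ln x.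
have slx : 0 < s%:R * ln x by rewrite mulr_gt0 //; lra.
have C70 : 1 <= C7 by rewrite /C7; lra.
have C50 : 0 < C5 by rewrite /C5; lra.
have C80 : 0 <= C5 * s%:R by rewrite mulr_ge0 // ltW.
have [Y0 HY] := block_length 0 (le_trans ler01 C70) C80.
exists (Num.max 1 Y0) => n j m n0 + j0m jle.
set y := ln n%:R in jle *; rewrite ge_max => /andP[y1 yY].
have [b [b0 _ bv C7b C8b]] := HY y yY.
have nE : n%:R = expR y by rewrite lnK // posrE ltr0n.
have n0' : 0 < n%:R :> R by rewrite ltr0n.
have y0 : 0 < y by lra.
have yE : y = expR (ln y) by rewrite lnK.
have b1 : 1 <= b%:R :> R by rewrite ler1n.
have sb1 : 1 <= s%:R * b%:R :> R by nra.
pose h := (s * b)%N; pose M := (2 ^ b %/ h)./2.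
have hE : h%:R = s%:R * b%:R :> R by rewrite /h natrM.
have h0 : (0 < h)%N by rewrite muln_gt0 s0.
have M_lo : C5 * y / 2 - 1 <= M%:R.
  have : (2 ^ b < (M.*2 + 2) * h)%N.
    apply: leq_trans (ltn_ceil _ h0) _; rewrite leq_mul2r; apply/orP; right.
    by rewrite /M; clear; lia.
  move=> /ltnW; rewrite -(ler_nat R) natrX natrM natrD -muln2 natrM hE => hM.
  have : C5 * y * (s%:R * b%:R) <= (M%:R * 2 + 2) * (s%:R * b%:R).
    by apply: le_trans hM; move: C8b; lra.
  rewrite ler_pM2r; lra.
have Mb : (h * M.*2 <= 2 ^ b)%N.
  apply: leq_trans (leq_trunc_div (2 ^ b) h); rewrite mulnC leq_mul2r; apply/orP; right.
  by rewrite /M; clear; lia.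
have C5y : 2 * (4 + C1) * y + 2 * C4 + 1 <= M%:R.
  apply: le_trans M_lo; rewrite /C5.
  have : 0 <= C4 * (y - 1) by rewrite mulr_ge0 //; lra.
  lra.
have M0 : (0 < M)%N.
  rewrite -(ltr_nat R); apply: lt_le_trans C5y.
  have : 0 <= C1 * y by rewrite mulr_ge0 // ltW.
  lra.
apply: le_trans (upr_sludge R d2 n0 s0 b0 M0 j0m Mb) _; rewrite -/h.
have size_bound : x ^+ (j + h.*2) <= expR (y + ln y - K * ln x).
  rewrite (expr_expR_ln _ x0) ler_expR natrD -muln2 natrM hE.
  have jl : (j%:R + 5 / 2 * s%:R * logb 2 y + K) * ln x <= y + ln y.
    have : j%:R + 5 / 2 * s%:R * logb 2 y + K <= y / ln x + ln y / ln x.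
      by move: jle; rewrite /logb -/y -/x; lra.
    by rewrite -mulrDl ler_pdivlMr.
  have : (s%:R * b%:R * 2) * ln x <= 5 / 2 * s%:R * logb 2 y * ln x.
    rewrite ler_wpM2r ?(ltW lx) //.
    have : s%:R * b%:R <= s%:R * (5 / 4 * logb 2 y) by rewrite ler_wpM2l //; lra.
    lra.
  lra.
have sizeC : d%:R * x ^+ (j + h.*2) <= n%:R * (C1 * y).
  apply: le_trans (ler_wpM2l (ltW d0) size_bound) _.
  by rewrite expRB !expRD -yE -nE -expRN /C1 le_eqVlt; apply/orP; left; apply/eqP; ring.
have mu : (d.-1 ^ h.*2)%:R * (d * d.-1 ^ j)%:R / n%:R <= C1 * y.
  rewrite ler_pdivrMr // [X in _ <= X]mulrC; apply: le_trans sizeC.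
  by rewrite natrM !natrX exprD -/x le_eqVlt; apply/orP; left; apply/eqP; ring.
have by_ : b%:R <= y by apply: le_trans C7b; rewrite ler_peMl.
have yn : y <= n%:R.
  by rewrite nE; apply: le_trans (expR_ge1Dx y); lra.
have jn : j%:R <= n%:R * (C1 * y).
  apply: le_trans sizeC; apply: (@le_trans _ _ (x ^+ (j + h.*2))).
    apply: (@le_trans _ _ (2 ^+ j)).
      by rewrite -natrX ler_nat ltnW // ltn_expl.
    apply: (@le_trans _ _ (x ^+ j)); first by rewrite lerXn2r ?nnegrE // ltW.
    by rewrite ler_weXn2l ?leq_addr //; lra.
  by rewrite ler_peMl ?exprn_ge0 ?(ltW x0) // ler1n ltnW // ltnW.
have jnh : (j * n * h)%:R <= C1 * s%:R * expR (4 * y).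
  rewrite !natrM.
  have -> : expR (4 * y) = n%:R ^+ 4 by rewrite nE -expRM_natl.
  apply: (@le_trans _ _ (n%:R * (C1 * n%:R) * n%:R * (s%:R * n%:R))); last first.
    by rewrite le_eqVlt; apply/orP; left; apply/eqP; ring.
  have n00 := ltW n0'; have C1n : 0 <= C1 * n%:R by rewrite mulr_ge0 // ltW.
  apply: ler_pM => //; rewrite ?mulr_ge0 //; last by rewrite ler_wpM2l // (le_trans by_).
  rewrite ler_wpM2r //; apply: le_trans jn _.
  by rewrite ler_wpM2l // ler_wpM2l // ltW.
have P2 : (j * n * h)%:R * (expR ((d.-1 ^ h.*2)%:R * (d * d.-1 ^ j)%:R / n%:R) / 2 ^+ M) <= eps / 2.
  have two : expR (1 / 2) <= 2 :> R.
    rewrite -[2]invrK -[expR _]invrK -expRN lef_pV2 ?posrE ?expR_gt0 ?invr_gt0 //.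
    by apply: le_trans (expR_ge1Dx _); lra.
  have powM : expR ((4 + C1) * y + C4) <= 2 ^+ M.
    apply: (@le_trans _ _ (expR (1 / 2) ^+ M)); last first.
      by rewrite lerXn2r ?nnegrE ?expR_ge0.
    rewrite -expRM_natl ler_expR; lra.
  have pos2 : 0 < 2 ^+ M :> R by rewrite exprn_gt0.
  rewrite mulrA ler_pdivrMr //.
  apply: (@le_trans _ _ (C1 * s%:R * expR (4 * y) * expR (C1 * y))).
    by rewrite ler_pM ?expR_ge0 // ler_expR.
  rewrite -mulrA -expRD -mulrDl.
  apply: (@le_trans _ _ (eps / 2 * expR ((4 + C1) * y + C4))); last first.
    by rewrite ler_wpM2l // ?divr_ge0 // ltW.
  rewrite expRD [expR _ * expR C4]mulrC mulrA ler_wpM2r ?expR_ge0 //.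
  have : C4 <= expR C4 by apply: le_trans (expR_ge1Dx _); lra.
  rewrite /C4 ler_pdivrMr // -/C4; lra.
have P1 : h.*2%:R * ((d * d.-1 ^ h.*2)%:R ^+ 2 / n%:R) <= eps / 2.
  rewrite mulrA ler_pdivrMr // natrM natrX -/x exprMn -exprM.
  have -> : x ^+ (h.*2 * 2) = expR (4 * s%:R * ln x * b%:R).
    rewrite (expr_expR_ln _ x0) -muln2 !natrM; congr expR; ring.
  have bE : b%:R <= expR b%:R :> R by apply: le_trans (expR_ge1Dx _); lra.
  have CE : C6 <= expR (C6 * b%:R).
    apply: le_trans (expR_ge1Dx _).
    have : 0 <= C6 * (b%:R - 1) by rewrite mulr_ge0 ?(ltW C60) //; lra.
    lra.
  have nge : C6 * b%:R * expR (4 * s%:R * ln x * b%:R) <= n%:R.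
    rewrite nE; apply: (@le_trans _ _ (expR (C7 * b%:R))); last by rewrite ler_expR.
    have -> : C7 * b%:R = C6 * b%:R + b%:R + 4 * s%:R * ln x * b%:R by rewrite /C7; ring.
    rewrite [expR (_ + b%:R + _)]expRD [expR (_ + b%:R)]expRD.
    apply: ler_wpM2r; first exact: expR_ge0.
    by apply: ler_pM => //; exact: ltW.
  have : eps / 2 * (C6 * b%:R * expR (4 * s%:R * ln x * b%:R)) <= eps / 2 * n%:R.
    by rewrite ler_wpM2l // ?divr_ge0 // ltW.
  apply: le_trans; rewrite /C6 -muln2 !natrM le_eqVlt; apply/orP; left; apply/eqP.
  by field; rewrite gt_eqF.
by lra.
Qed.

(** * The five regimes *)

Lemma aas_greenI (R : realType) (d : nat) (j : nat -> nat) (E : nat -> R -> Prop) :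
  (forall eps : R, 0 < eps -> \forall n \near \oo%classic, forall m, (j n <= m)%N ->
     uniform_pr R (fun f : outcome m n d => ~ E n (rdag_green_number R f (j n))) <= eps) ->
  aas_green d j E.
Proof.
move=> H m jm; apply/cvgrPdist_le => eps eps0.
near=> n; have n0 : (0 < n)%N by near: n; exact: nbhs_infty_gt.
rewrite upr_compl ?card_outcome_gt0 // opprB addrC subrK.
rewrite ger0_norm ?upr_ge0 //.
by near: n; apply: filterS (H _ eps0) => n; apply.
Unshelve. all: by end_near. Qed.

Lemma near_ln (R : realType) (Y : R) :
  \forall n \near \oo%classic, (0 < n)%N /\ Y <= ln (n%:R : R).
Proof.
near=> n; have n0 : (0 < n)%N by near: n; exact: nbhs_infty_gt.
split=> //; rewrite -ler_expR lnK ?posrE ?ltr0n //.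
by near: n; exact: nbhs_infty_ger.
Unshelve. all: by end_near. Qed.

Lemma no_dead_below (m n d : nat) (f : outcome m n d) x a b :
  (forall i, (i < b)%N -> {in generated f i &, injective f}) ->
  dead_below f x a b = finset.set0.
Proof.
move=> tree; apply/setP => s; rewrite !inE; apply/negP.
move=> /andP[/andP[sA sdeg] /and3P[_ sb _]].
case/negP: sdeg; apply/cards1P; exists s; apply/setP => t; rewrite !inE.
apply/andP/eqP => [[tA /eqP ft]|->]; last by rewrite sA.
exact: tree sb _ _ tA sA ft.
Qed.

Lemma green_number_1 (R : realType) (m n d : nat) (f : outcome m n d) :
  (1 < d)%N -> (0 < m)%N -> {in generated f 0 &, injective f} ->
  rdag_green_number R f 1 = d%:R.
Proof.
move=> d1 m0 inj; have d0 : (0 < d)%N by exact: ltnW.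
apply/eqP; rewrite eq_le; apply/andP; split.
  apply: green_number_le; rewrite ?ltr0n // winsE quota_nat //.
  apply: leq_trans (subset_leq_card (losers_sub _ _ _ _ _)) _.
  by apply: leq_trans (card_outs f None) _; rewrite subn0.
apply: green_number_ge => // r r0 rd.
apply: (@sludge_wins _ _ _ _ _ _ _ (fun i x => i = 0%N -> x = None)) => //.
move=> i x Z; rewrite ltnS leqn0 => /eqP -> /(_ erefl) -> _ _ cZ.
have none0 : (None : node m n) \in rdag_vertices f by rewrite inE.
have cG : (d <= #|[set c | good_edge f None c]|)%N.
  have := card_good_children none0 m0; rewrite /= subn0; apply.
  by apply: no_dead_below => -[].
have qd : (quota r 1 <= d.-1)%N.
  apply: (@quota_le_small _ _ _ 1); rewrite ?(ltW r0) // invr1.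
  by rewrite natr1 prednK.
have /card_gt0P[c] : (0 < #|[set c | good_edge f None c] :\: Z|)%N.
  rewrite cardsD subn_gt0; apply: leq_ltn_trans (subset_leq_card (finset.subsetIr _ _)) _.
  by apply: leq_ltn_trans cZ (leq_ltn_trans qd (leq_trans _ cG)); rewrite prednK.
by rewrite !inE => /andP[cZ' xc]; exists c.
Qed.

(** The greens can wait: d - 1 nodes at time j protect all out-neighbours of a node of level j - 1,
    provided that it is not the source, which has no incoming edge. *)
Lemma wins_last (m n d : nat) (f : outcome m n d) q j k i x :
  (d.-1 <= q j)%N -> (i + k.+1)%N = j -> level x = i -> (0 < k)%N || (0 < i)%N ->
  wins (rdag_edge f) q k.+1 i x.
Proof.
move=> qj; elim: k i x => [|k IHk] i x ij lx ki; rewrite winsE.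
  apply: leq_trans (subset_leq_card (losers_sub _ _ _ _ _)) _.
  rewrite -addn1 ij; apply: leq_trans _ qj; apply: card_outs_le.
  by rewrite lx; case/orP: ki.
rewrite (_ : [set y | _] = finset.set0) ?cards0 //; apply/setP => y; rewrite !inE.
apply/negP => /andP[xy /negP]; apply; apply: IHk; rewrite ?orbT //.
  by rewrite addSnnS.
by rewrite (rdag_edge_level xy) lx.
Qed.

Lemma green_number_upper (R : realType) (m n d : nat) (f : outcome m n d) j :
  (2 < d)%N -> (2 <= j)%N -> rdag_green_number R f j <= d%:R - 2 + 1 / j%:R.
Proof.
move=> d2 j2; have j0 : (0 < j)%N by exact: ltnW.
rewrite -natrB ?(ltnW d2) // div1r; apply: green_number_le.
  by rewrite ltr_wpDr ?invr_ge0 // ltr0n subn_gt0.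
have jE : (j = j.-1.+1)%N by rewrite prednK.
rewrite {2}jE; apply: (@wins_last _ _ _ _ _ j) => //; last first.
  by rewrite orbF -ltnS prednK.
by rewrite quota_last //; lia.
Qed.

Lemma green_number_tree (R : realType) (m n d : nat) (f : outcome m n d) j :
  (2 < d)%N -> (2 <= j)%N -> (j <= m)%N ->
  (forall i, (i < j)%N -> {in generated f i &, injective f}) ->
  rdag_green_number R f j = d%:R - 2 + 1 / j%:R.
Proof.
move=> d2 j2 jm tree; have j0 : (0 < j)%N by exact: ltnW.
apply/eqP; rewrite eq_le green_number_upper //=.
apply: green_number_ge => // [|r r0 rlt]; first by rewrite (ltn_trans _ d2).
(* With block length j the whole game is a single block, and no later node has to satisfy a
   condition. *)
apply: (sludge_blocks j0 jm d2).
- move=> t t0 tj; apply: (@quota_le_small _ _ _ j); rewrite ?t0 ?(ltW r0) //.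
  by rewrite natrB ?(ltnW d2) // -div1r.
- by apply: no_dead_below => i; rewrite leq_min => /andP[_]; exact: tree.
- move=> x _ _ /andP[lx0 lxj] /(dvdn_leq lx0) jl.
  by move: (leq_trans lxj jl); rewrite ltnn.
Qed.

Lemma near_inv (R : realType) (C eps : R) : 0 < eps ->
  \forall n \near \oo%classic, (0 < n)%N /\ C / n%:R <= eps.
Proof.
move=> eps0; near=> n; have n0 : (0 < n)%N by near: n; exact: nbhs_infty_gt.
split=> //; rewrite ler_pdivrMr ?ltr0n // mulrC -ler_pdivrMr //.
by near: n; exact: nbhs_infty_ger.
Unshelve. all: by end_near. Qed.

Lemma aas_green_1 (R : realType) (d : nat) : (2 < d)%N ->
  aas_green d (fun _ : nat => 1%N) (fun (_ : nat) (g : R) => g = d%:R).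
Proof.
move=> d2; apply: aas_greenI => eps eps0.
apply: filterS (near_inv ((d * d.-1 ^ 0)%:R ^+ 2) eps0) => n [n0 le_eps] m m1.
apply: le_trans le_eps; apply: le_trans (upr_level_collision R m d 0 n0).
apply: upr_le => f; apply: contra_not => inj; apply: green_number_1 => //.
exact: ltnW.
Qed.

Lemma aas_green_bounded (R : realType) (d : nat) (j : nat -> nat) (K : nat) :
  (2 < d)%N -> (\forall n \near \oo%classic, (2 <= j n <= K)%N) ->
  aas_green d j (fun n (g : R) => g = d%:R - 2 + 1 / (j n)%:R).
Proof.
move=> d2 jK; apply: aas_greenI => eps eps0.
apply: filterS2 jK (near_inv (K%:R * (d * d.-1 ^ K)%:R ^+ 2) eps0).
move=> n /andP[j2 jK] [n0 le_eps] m jm.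
apply: le_trans le_eps; rewrite -mulrA.
apply: le_trans (upr_tree R m K n0 (ltnW d2)); apply: upr_le => f.
apply: contra_not => tree; apply: green_number_tree => // i ij.
by apply: tree; exact: leq_trans ij jK.
Qed.

(** The green number lies between d - 2 - 1/s and d - 2 + 1/j. Here s is arbitrary, because omega
    log log n eventually exceeds 5/2 s log_2 log n, and j tends to infinity with omega. *)
Lemma aas_green_middle (R : realType) (d : nat) (omega : nat -> R) (j : nat -> nat)
    (eta : R) : (2 < d)%N -> (omega @ \oo --> +oo)%classic ->
  (\forall n \near \oo%classic,
     omega n <= (j n)%:R <= logb (d%:R - 1) n%:R - omega n * ln (ln n%:R)) ->
  0 < eta -> aas_green d j (fun _ (g : R) => `|g - (d%:R - 2)| < eta).
Proof.
move=> d2 omega_oo jn eta0; apply: aas_greenI => eps eps0.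
pose s := (Num.trunc (eta^-1)).+1; have s0 : 0 < s%:R :> R by rewrite ltr0n.
have ieta : 1 / s%:R < eta.
  by rewrite div1r invf_plt ?posrE // truncnS_gt.
have l2 : 0 < ln 2 :> R by rewrite ln_gt0 // ltr1n.
have lx : 0 < ln (d%:R - 1) :> R.
  by rewrite ln_gt0 //; have : 3 <= d%:R :> R by [rewrite ler_nat]; lra.
have [Y0 HY] := upr_sludge_asym 0 d2 (ltn0Sn _ : (0 < s)%N) eps0.
near=> n => m jm.
have [n0 yn] : (0 < n)%N /\ Num.max Y0 1 <= ln (n%:R : R).
  by near: n; exact: near_ln.
move: yn; rewrite ge_max => /andP[yY y1].
have om : Num.max (Num.max 2 (eta^-1 + 1)) (5 / 2 * s%:R / ln 2) <= omega n.
  by near: n; move/cvgryPge: omega_oo; apply.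
move: om; rewrite !ge_max => /andP[/andP[om2 ometa] oms].
have /andP[jlo jhi] : omega n <= (j n)%:R <= logb (d%:R - 1) n%:R - omega n * ln (ln n%:R).
  by near: n.
have j2 : (2 <= j n)%N by rewrite -(ler_nat R) (le_trans om2).
have j0 : 0 < (j n)%:R :> R by rewrite ltr0n ltnW.
have ly : 0 <= ln (ln n%:R) :> R by rewrite ln_ge0.
have jm0 : (0 < j n <= m)%N by rewrite jm ltnW.
apply: le_trans (HY n (j n) m n0 yY jm0 _); last first.
  apply: le_trans jhi _; rewrite subr0 /logb.
  have : 5 / 2 * s%:R / ln 2 * ln (ln n%:R) <= omega n * ln (ln n%:R).
    by rewrite ler_wpM2r.
  have : 0 <= ln (ln n%:R) / ln (d%:R - 1) :> R by rewrite divr_ge0 // ltW.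
  have -> : 5 / 2 * s%:R * (ln (ln n%:R) / ln 2) = 5 / 2 * s%:R / ln 2 * ln (ln n%:R) :> R.
    by rewrite mulrA mulrAC.
  lra.
apply: upr_le => f; apply: contra_not => lo.
have up := green_number_upper R f d2 j2.
have ij : 1 / (j n)%:R < eta.
  by rewrite div1r invf_plt ?posrE //; lra.
by rewrite ltr_norml; apply/andP; split; lra.
Unshelve. all: by end_near. Qed.

(** The hypothesis says (d - 1)^j >= n^(3/4). Level j - 2 of the losing tree then has order (d -
    1)^j slots, well above sqrt n, and the collision exponent is at least a constant times ln n. *)
Lemma upr_green_late (R : realType) (n m d j : nat) :
  (2 < d)%N -> (0 < n)%N -> (2 < j <= m)%N ->
  3 / 4 * ln (n%:R : R) <= j%:R * ln d.-1%:R -> 0 < ln (n%:R : R) ->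
  uniform_pr R (fun f : outcome m n d => ~ (rdag_green_number R f j <= d%:R - 2)) <=
  32 * d%:R * d.-1%:R ^+ 4 / ln n%:R.
Proof.
move=> d2 n0 /andP[j2 jm] jlo y0; set y := ln n%:R in jlo y0 *.
have x2 : 2 <= d.-1%:R :> R by rewrite ler_nat -ltnS prednK // (ltn_trans _ d2).
have x0 : 0 < d.-1%:R :> R by lra.
have n0' : 0 < n%:R :> R by rewrite ltr0n.
have nE : n%:R = expR y by rewrite lnK.
apply: (@le_trans _ _ (uniform_pr R (fun f : outcome m n d =>
    ~~ wins (rdag_edge f) (fun=> (d - 2)%N) j 0 None))).
  apply: upr_le => f; apply: contra_notN => w.
  rewrite -natrB ?(ltnW d2) //; apply: green_number_le; first by rewrite ltr0n subn_gt0.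
  rewrite (@wins_eq_quota _ _ _ (fun=> (d - 2)%N)) // => t t0.
  exact: quota_nat.
have kj : ((j - 3).+2 < j)%N by move: j2; clear; lia.
apply: le_trans (upr_loses_tree R n0 d2 jm (fun=> leqnn _) kj) _.
have jE : ((j - 3).+1 + 2 = j)%N by move: j2; clear; lia.
set N := (d.-1 ^ (j - 3).+1)%N.
have N4 : d.-1%:R ^+ j <= 4 * N./2%:R * d.-1%:R ^+ 2 :> R.
  rewrite -{1}jE exprD ler_wpM2r ?sqr_ge0 // -natrX -/N -natrM ler_nat.
  have : (2 <= N)%N.
    have x1 : (1 < d.-1)%N by rewrite -(ler_nat R).
    by rewrite /N expnS (leq_trans x1) // leq_pmulr // expn_gt0 (ltnW x1).
  by clear; lia.
have big : n%:R * expR (y / 2) <= (d.-1%:R ^+ j) ^+ 2.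
  rewrite nE -expRD (expr_expR_ln j x0) -expRM_natl ler_expR; lra.
pose q : R := N./2%:R ^+ 2 / n%:R.
have q_lo : y / (32 * d.-1%:R ^+ 4) <= q.
  have x40 : 0 < d.-1%:R ^+ 4 :> R by rewrite exprn_gt0.
  rewrite ler_pdivrMr ?mulr_gt0 // /q mulrAC ler_pdivlMr //.
  have sq : (d.-1%:R ^+ j) ^+ 2 <= (4 * N./2%:R * d.-1%:R ^+ 2) ^+ 2 :> R.
    by rewrite lerXn2r ?nnegrE ?mulr_ge0 ?exprn_ge0 // ltW.
  have half : n%:R * (y / 2) <= n%:R * expR (y / 2).
    by rewrite ler_wpM2l ?(ltW n0') // (le_trans _ (expR_ge1Dx _)) // lerDr.
  have E1 : (4 * N./2%:R * d.-1%:R ^+ 2) ^+ 2 = 16 * (N./2%:R ^+ 2 * d.-1%:R ^+ 4) :> R by ring.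
  have -> : N./2%:R ^+ 2 * (32 * d.-1%:R ^+ 4) = 32 * (N./2%:R ^+ 2 * d.-1%:R ^+ 4) :> R by ring.
  rewrite E1 in sq; have := le_trans half (le_trans big sq).
  by rewrite mulrA [n%:R * y]mulrC; lra.
have q0 : 0 < q by apply: lt_le_trans q_lo; rewrite divr_gt0 // mulr_gt0 // exprn_gt0.
apply: (@le_trans _ _ (d%:R * q^-1)).
  rewrite -/q ler_wpM2l // expRN lef_pV2 ?posrE ?expR_gt0 //.
  by apply: le_trans (expR_ge1Dx _); lra.
have -> : 32 * d%:R * d.-1%:R ^+ 4 / y = d%:R * (y / (32 * d.-1%:R ^+ 4))^-1.
  by rewrite invf_div; field; rewrite gt_eqF.
by rewrite ler_wpM2l // lef_pV2 ?posrE // divr_gt0 // mulr_gt0 // exprn_gt0.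
Qed.

Lemma aas_green_late (R : realType) (d s : nat) (omega : nat -> R) (j : nat -> nat)
    (K : R) : (2 < d)%N -> (0 < s)%N ->
  (omega n * ln (ln n%:R) / ln n%:R @[n --> \oo] --> (0 : R))%classic ->
  (\forall n \near \oo%classic,
    logb (d%:R - 1) n%:R - omega n * ln (ln n%:R) <= (j n)%:R <=
      logb (d%:R - 1) n%:R - 5 / 2 * s%:R * logb 2 (ln n%:R)
        + logb (d%:R - 1) (ln n%:R) - K) ->
  aas_green d j (fun _ (g : R) => d%:R - 2 - 1 / s%:R <= g <= d%:R - 2).
Proof.
move=> d2 s0 om0 jn; apply: aas_greenI => eps eps0.
have e2 : 0 < eps / 2 by lra.
have [Y0 HY] := upr_sludge_asym K d2 s0 e2.
have xE : d%:R - 1 = d.-1%:R :> R by rewrite -subn1 natrB // ltnW // ltnW.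
have lx : 0 < ln d.-1%:R :> R by rewrite ln_gt0 // ltr1n -ltnS prednK // (ltn_trans _ d2).
pose C : R := 32 * d%:R * d.-1%:R ^+ 4.
(* A ratio below this constant turns the lower bound on [j] into j >= 3/4 log_(d-1) n. *)
have l4 : 0 < (4 * ln d.-1%:R)^-1 :> R by rewrite invr_gt0 mulr_gt0.
near=> n => m jm.
have [n0 yn] : (0 < n)%N /\ Num.max (Num.max Y0 1) (Num.max (C / (eps / 2)) (4 * ln d.-1%:R))
    <= ln (n%:R : R).
  by near: n; exact: near_ln.
move: yn; rewrite !ge_max => /andP[/andP[yY y1] /andP[yC y4]].
have y0 : 0 < ln n%:R :> R by lra.
have /andP[jlo jhi] : logb (d%:R - 1) n%:R - omega n * ln (ln n%:R) <= (j n)%:R <=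
      logb (d%:R - 1) n%:R - 5 / 2 * s%:R * logb 2 (ln n%:R)
        + logb (d%:R - 1) (ln n%:R) - K.
  by near: n.
have om : omega n * ln (ln n%:R) / ln n%:R <= (4 * ln d.-1%:R)^-1.
  have : `|0 - omega n * ln (ln n%:R) / ln n%:R| <= (4 * ln d.-1%:R)^-1.
    by near: n; move/cvgrPdist_le: om0; apply.
  by rewrite sub0r normrN; apply: le_trans (ler_norm _).
have jl : 3 / 4 * ln n%:R <= (j n)%:R * ln d.-1%:R :> R.
  have : omega n * ln (ln n%:R) * ln d.-1%:R <= ln n%:R / 4.
    move: om; rewrite ler_pdivrMr // invfM mulrAC -(ler_pM2r lx) => om.
    by apply: le_trans om _; rewrite mulfVK ?gt_eqF // mulrC.
  have : (logb (d%:R - 1) n%:R - omega n * ln (ln n%:R)) * ln d.-1%:R <= (j n)%:R * ln d.-1%:R.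
    by rewrite ler_wpM2r // ltW.
  rewrite mulrBl /logb xE mulfVK ?gt_eqF //; lra.
have j2 : (2 < j n)%N.
  rewrite -(ltr_nat R) -(ltr_pM2r lx); apply: lt_le_trans jl; lra.
have jm0 : (0 < j n <= m)%N by rewrite jm ltnW // ltnW.
have lower := HY n (j n) m n0 yY jm0 jhi.
have j2m : (2 < j n <= m)%N by rewrite j2.
have upper : uniform_pr R (fun f : outcome m n d =>
    ~ (rdag_green_number R f (j n) <= d%:R - 2)) <= eps / 2.
  apply: le_trans (upr_green_late d2 n0 j2m jl y0) _.
  by rewrite ler_pdivrMr // [X in _ <= X]mulrC -ler_pdivrMr.
have -> : eps = eps / 2 + eps / 2 by lra.
apply: le_trans (lerD lower upper); apply: le_trans (upr_or _ _ _).
apply: upr_le => f ng; have [lo|] := pselect (d%:R - 2 - 1 / s%:R <= rdag_green_number R f (j n)).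
  by right => up; apply: ng; rewrite lo up.
by left.
Unshelve. all: by end_near. Qed.

(** One constant serves all s >= 4, since d - 2 - 1/4 <= d - 2 - 1/s: the greens always play at rate
    d - 2 - 1/4. *)
Lemma aas_green_final (R : realType) (d : nat) : (2 < d)%N -> exists2 C : R, 0 < C &
  forall s (j : nat -> nat), (4 <= s)%N ->
  (\forall n \near \oo%classic, logb (d%:R - 1) n%:R + C <= (j n)%:R) ->
  aas_green d j (fun _ (g : R) => g <= d%:R - 2 - 1 / s%:R).
Proof.
move=> d2; have [D3 HD3] := upr_loses_v R d2.
exists (4 * D3 + 5)%N%:R => [|s j s4 jn]; first by rewrite ltr0n addnS.
apply: aas_greenI => eps eps0; have [U HU] := HD3 eps eps0.
have xE : d%:R - 1 = d.-1%:R :> R by rewrite -subn1 natrB // ltnW // ltnW.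
have x1 : (1 < d.-1)%N by rewrite -ltnS prednK // (ltn_trans _ d2).
have lx : 0 < ln d.-1%:R :> R by rewrite ln_gt0 // ltr1n.
have x0' : 0 < d.-1%:R :> R by rewrite ltr0n ltnW.
have d16 : (0 < 16 * d)%N by rewrite muln_gt0 (ltn_trans _ d2).
near=> n => m jm.
have n_big : (d.-1 ^ (4 * U) * (16 * d) <= n)%N by near: n; exact: nbhs_infty_ge.
have jlo : logb (d%:R - 1) n%:R + (4 * D3 + 5)%N%:R <= (j n)%:R :> R by near: n.
(* This u places [n] between 16 d (d - 1)^(4 u) and 16 d (d - 1)^(4 u + 4); then 4 u <= log_(d-1) n,
   and the constant 4 D3 + 5 puts [j] beyond level 4 (u + D3) + 3. *)
pose t := trunc_log d.-1 (n %/ (16 * d)); pose u := (t %/ 4)%N.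
have nd : (d.-1 ^ (4 * U) <= n %/ (16 * d))%N by rewrite leq_divRL.
have nd0 : (0 < n %/ (16 * d))%N.
  by apply: leq_trans nd; rewrite expn_gt0 ltnW.
have Uu : (U <= u)%N.
  by rewrite /u leq_divRL // mulnC; apply: trunc_log_max nd.
have ut : (4 * u <= t)%N by rewrite mulnC leq_trunc_div.
have tu : (t.+1 <= 4 * u + 4)%N by rewrite /u; clear; lia.
have xt : (d.-1 ^ t <= n %/ (16 * d))%N by exact: trunc_logP.
have n_lo : (16 * d * d.-1 ^ (4 * u) <= n)%N.
  rewrite mulnC -leq_divRL //; apply: leq_trans xt.
  by rewrite leq_pexp2l // ltnW.
have n_hi : (n < 16 * d * d.-1 ^ (4 * u + 4))%N.
  rewrite mulnC -ltn_divLR //; apply: leq_trans (trunc_log_ltn _ x1) _.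
  by rewrite leq_pexp2l // ltnW.
have n0 : (0 < n)%N.
  by apply: leq_trans n_lo; rewrite muln_gt0 d16 expn_gt0 ltnW.
have Dj : (4 * (u + D3) + 3 < j n)%N.
  have : (4 * u)%N%:R <= logb (d%:R - 1) n%:R :> R.
    rewrite /logb xE ler_pdivlMr // -ler_expR -expr_expR_ln // lnK ?posrE ?ltr0n //.
    rewrite -natrX ler_nat; apply: leq_trans n_lo; exact: leq_pmull.
  move=> lo; have : (4 * u)%N%:R + (4 * D3 + 5)%N%:R <= (j n)%:R :> R.
    by apply: le_trans jlo; rewrite lerD2r.
  by rewrite -natrD ler_nat; clear; lia.
pose q t := (d - 2 - (t %% 4 == 1))%N.
apply: le_trans (HU u Uu n m (j n) q n_lo n_hi Dj jm _ _).
- apply: upr_le => f; apply: contra_notN => w.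
  apply: (@le_trans _ _ (d%:R - 2 - 1 / 4)).
    apply: green_number_le.
      have : 3 <= d%:R :> R by rewrite ler_nat.
      lra.
    rewrite (@wins_eq_quota _ _ _ q) // => k k0; exact: quota_quarter.
  rewrite lerD2l lerN2 !div1r lef_pV2 ?posrE ?ltr0n //.
    by rewrite ler_nat.
  exact: leq_trans s4.
- by move=> k; rewrite /q; case: eqP => _; clear -d2; lia.
- by move=> k /negPf kE; rewrite /q kE subn0.
Unshelve. all: by end_near. Qed.

Local Open Scope classical_set_scope.
Local Open Scope ring_scope.

Theorem theorem3p1 (R : realType) (d : nat) (hd : (3 <= d)%N)
    (omega : nat -> R) (homega : omega @ \oo --> +oo) :
  (* (i) *)
  aas_green d (fun _ : nat => 1%N) (fun (_ : nat) (g : R) => g = d%:R) /\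
  (* (ii) *)
  (forall j : nat -> nat,
     (exists K : nat, \forall n \near \oo, (2 <= j n <= K)%N) ->
     aas_green d j (fun n (g : R) => g = d%:R - 2 + 1 / (j n)%:R)) /\
  (* (iii): g_j = d - 2 up to an error tending to 0 *)
  (forall j : nat -> nat,
     (\forall n \near \oo,
        omega n <= (j n)%:R <=
          logb (d%:R - 1) n%:R - omega n * ln (ln n%:R)) ->
     forall eps : R, 0 < eps ->
     aas_green d j (fun _ (g : R) => `|g - (d%:R - 2)| < eps)) /\
  (* (iv): omega is slow, in the sense that omega log log n = o(log n) *)
  (forall (s : nat) (K : R) (j : nat -> nat), (0 < s)%N ->
     (omega n * ln (ln n%:R) / ln n%:R @[n --> \oo] --> (0 : R)) ->
     (\forall n \near \oo,
        logb (d%:R - 1) n%:R - omega n * ln (ln n%:R) <= (j n)%:R <=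
          logb (d%:R - 1) n%:R - 5 / 2 * s%:R * logb 2 (ln n%:R)
            + logb (d%:R - 1) (ln n%:R) - K) ->
     aas_green d j (fun _ (g : R) => d%:R - 2 - 1 / s%:R <= g <= d%:R - 2)) /\
  (* (v) *)
  (forall s : nat, (4 <= s)%N ->
     exists2 C : R, 0 < C &
       forall j : nat -> nat,
         (\forall n \near \oo, logb (d%:R - 1) n%:R + C <= (j n)%:R) ->
         aas_green d j (fun _ (g : R) => g <= d%:R - 2 - 1 / s%:R)).
Proof.
split; first exact: aas_green_1.
split; first by move=> j [K]; exact: aas_green_bounded.
split; first by move=> j jn eps; exact: aas_green_middle jn.
split; first by move=> s K j s0 om; exact: aas_green_late om.
move=> s s4; have [C C0 HC] := aas_green_final R hd.
by exists C => // j; exact: HC.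
Qed.
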